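(* Let $\lambda>-1$ and let $n\geq4$ be an integer. Let $r\ge1$ be an integer and $p_1,\ldots,p_r>0$ with $p_1+\cdots+p_r=1$, and assume that $p_j\leq0.13$ and $(n+1)p_j<4$ for each $j=1,\ldots,r$. Let $(N_1,\ldots,N_r)$ be multinomially distributed with $n$ trials and class probabilities $(p_1,\ldots,p_r)$, and let $\widetilde{T}_\lambda$ be the normalised power divergence statistic defined in the context. Let $\pi_j=\binom{n}{2}p_j^2(1-p_j)^{n-2}$ and $\mu=\pi_1+\cdots+\pi_r$, let \[ c_\lambda=\max_j\left|\frac{1}{p_j^\lambda\,\mathbb{E}[P^{-\lambda}]}-1\right|,\qquad d_\lambda=\begin{cases} \dfrac{n\,\mathrm{Var}(\log P)}{4(\log 2)^2}, & \lambda=0,\\[2ex] \dfrac{n\,\mathrm{Var}(P^{-\lambda})}{4(2^\lambda-1)^2\,\mathbb{E}[P^{-\lambda}]^2}, & \lambda\neq0, \end{cases} \] and let $N\sim\mathrm{N}(0,1)$ be a standard Gaussian random variable. Then \[ \begin{aligned} d_K\left(\frac{\widetilde{T}_\lambda-\mu}{\sqrt{\mu}},N\right)\leq{}&45\min\{1,\mu^{-1}\}\left(6n\left[\sum_{j=1}^rp_j\pi_j\right]^2+\sum_{j=1}^r\pi_j^2+\frac{24\mu^2}{n}\right)\\ &+18\left(5.55\,\mu c_\lambda\right)^{0.49/c_\lambda} +\frac{8n\mu\max_jp_j}{4-(n+1)\max_jp_j}\\ &+\min\left\{8.1\,d_\lambda,\;2.15\left(\frac{d_\lambda}{\mu}\right)^{1/3}\right\}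 +\frac{0.4748}{\sqrt{\mu}}, \end{aligned} \] where the term $18(5.55\mu c_\lambda)^{0.49/c_\lambda}$ is read as $0$ if $c_\lambda=0$.
   Context: For $\lambda>-1$ and $x\ge 0$ define $g_\lambda(x)=2x\log x$ if $\lambda=0$ (with $0\log 0=0$), and $g_\lambda(x)=\frac{2x(x^\lambda-1)}{\lambda(\lambda+1)}$ if $\lambda\ne0$; at $x=0$ one takes $g_\lambda(0)=0$ (the continuous extension) for every $\lambda>-1$. The power divergence statistic is $T_\lambda=n\sum_{j=1}^rp_j\,g_\lambda\!\left(\frac{N_j}{np_j}\right)$. $P$ is a random variable with $\mathbb{P}(P=p_j)=p_j$ for $j=1,\ldots,r$, meaning that $P=p_X$ where $\mathbb{P}(X=j)=p_j$; thus $\mathbb{E}[f(P)]=\sum_{j=1}^r p_j f(p_j)$ for every function $f$ (and variances are computed accordingly). The normalised statistic is \[ \widetilde{T}_\lambda=\frac{n^\lambda}{g_\lambda(2)\,\mathbb{E}[P^{-\lambda}]}\left(T_\lambda-n^2\,\mathbb{E}\left[P\,g_\lambda\!\left(\frac{1}{nP}\right)\right]\right). \] The Kolmogorov distance between real random variables $A,B$ is $d_K(A,B)=\sup_{y\in\mathbb{R}}|\mathbb{P}(A\geq y)-\mathbb{P}(B\geq y)|$. *)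

(* Defs.v *)
From mathcomp Require Export all_boot all_order all_algebra.
From mathcomp Require Export all_classical all_reals all_analysis.
Export numFieldNormedType.Exports.

Set Implicit Arguments.
Unset Strict Implicit.
Unset Printing Implicit Defensive.

Import Order.TTheory GRing.Theory Num.Theory.

Local Open Scope classical_set_scope.
Local Open Scope ring_scope.

(* g l 0 = 0 for every l, because of the factor x and because ln 0 and 0 `^ l
   are (junk or genuine) real numbers. *)
Definition g (R : realType) (l x : R) : R :=
  if l == 0 then 2 * x * ln x
  else 2 * x * (x `^ l - 1) / (l * (l + 1)).

(* E[f(P)] and Var(f(P)) for the random variable P = p_X, P(X = j) = p_j. *)
Definition meanP (R : realType) (r : nat) (p : 'I_r -> R) (f : R -> R) : R :=
  \sum_(j < r) p j * f (p j).

Definition varP (R : realType) (r : nat) (p : 'I_r -> R) (f : R -> R) : R :=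
  meanP p (fun x => (f x - meanP p f) ^+ 2).

(* The random vector (N_j) is multinomial with n trials and class
   probabilities p: its joint mass function is given on all of nat^r. *)
Definition multinomial (R : realType) (d : measure_display)
    (T : measurableType d) (Pr : probability T R) (n r : nat) (p : 'I_r -> R)
    (N : 'I_r -> {RV Pr >-> nat}) : Prop :=
  forall k : 'I_r -> nat,
    Pr [set w | forall j, N j w = k j] =
    (if (\sum_(j < r) k j == n)%N
     then n`!%:R / (\prod_(j < r) (k j)`!)%:R * \prod_(j < r) p j ^+ k j
     else 0)%:E.

Definition standard_gaussian (R : realType) (d : measure_display)
    (T : measurableType d) (Q : probability T R) (Z : {RV Q >-> R}) : Prop :=
  forall A, measurable A -> distribution Q Z A = normal_prob 0 1 A.

(* A and B may live on different probability spaces.  The set is nonempty and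
   bounded by 1, so that sup is the genuine least upper bound. *)
Definition kolmogorov_distance (R : realType) (d1 d2 : measure_display)
    (T1 : measurableType d1) (T2 : measurableType d2)
    (P1 : probability T1 R) (P2 : probability T2 R)
    (A : T1 -> R) (B : T2 -> R) : R :=
  sup [set `|fine (P1 [set w | y <= A w]) - fine (P2 [set w | y <= B w])|
      | y in [set: R]].

(* The value of T_lambda when the cell counts are k. *)
Definition power_divergence (R : realType) (l : R) (n r : nat)
    (p : 'I_r -> R) (k : 'I_r -> nat) : R :=
  n%:R * \sum_(j < r) p j * g l ((k j)%:R / (n%:R * p j)).

Definition normalised_power_divergence (R : realType) (l : R) (n r : nat)
    (p : 'I_r -> R) (k : 'I_r -> nat) : R :=
  n%:R `^ l / (g l 2 * meanP p (fun x => x `^ (- l))) *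
  (power_divergence l n p k
   - n%:R ^+ 2 * meanP p (fun x => x * g l (1 / (n%:R * x)))).

Definition pi_ (R : realType) (n r : nat) (p : 'I_r -> R) (j : 'I_r) : R :=
  'C(n, 2)%:R * p j ^+ 2 * (1 - p j) ^+ (n - 2).

Definition mu_ (R : realType) (n r : nat) (p : 'I_r -> R) : R :=
  \sum_(j < r) pi_ n p j.

(* Maximum of a family of nonnegative numbers; the default value 0 is
   harmless as soon as r >= 1. *)
Definition max0 (R : realType) (r : nat) (a : 'I_r -> R) : R :=
  \big[Num.max/0]_(j < r) a j.

Definition c_ (R : realType) (l : R) (r : nat) (p : 'I_r -> R) : R :=
  max0 (fun j => `|1 / (p j `^ l * meanP p (fun x => x `^ (- l))) - 1|).

Definition d_ (R : realType) (l : R) (n r : nat) (p : 'I_r -> R) : R :=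
  if l == 0 then n%:R * varP p (@ln R) / (4 * ln 2 ^+ 2)
  else n%:R * varP p (fun x => x `^ (- l)) /
       (4 * (2 `^ l - 1) ^+ 2 * meanP p (fun x => x `^ (- l)) ^+ 2).

(* Main.v *)
(** Off the event that some cell receives at least three balls, the normalised
    statistic is [sum_j a_j 1(N_j = 2)], with [|a_j - 1| <= c_lambda], plus a
    centred linear function of the counts whose second moment is [d_lambda].
    Chebyshev's inequality controls the linear part.  Replacing every [a_j] by 1
    moves the threshold by less than 3/10 (lower tail) or 9/25 (upper tail);
    when [c_lambda] is too large for this, the threshold lies so far above [mu]
    that the Gaussian tail is absorbed by the error terms, the exponential term
    being less than 1.

    The number of cells with exactly two balls is compared with Poisson(mu) by
    the Stein-Chen method: conditioning on [N_i = a] leaves [n - a] balls for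
    the other cells, and the effect of changing the number of balls is estimated
    one ball at a time.  Poisson and Gaussian distribution functions are
    compared through the derivative in the Poisson parameter: for the lower tail
    with the Gaussian at the signed root of the deviance, for the upper tail with
    the Gaussian at the difference of square roots. *)
From HB Require Import structures.
From mathcomp Require Import ring lra zify.
Require Import Defs.

Set Implicit Arguments.
Unset Strict Implicit.
Unset Printing Implicit Defensive.

Import Order.TTheory GRing.Theory Num.Theory.

Local Open Scope classical_set_scope.
Local Open Scope ring_scope.

(** * Calculus *)

Section calculus.
Context {R : realType}.
Implicit Types (f g df dg : R -> R) (x a b c : R).

(** The term 0.4748 / sqrt mu has to pay for two things at once: the Poisson-Gaussian comparison and
    the displacement of the threshold, which is rounded to an integer and moved to make room for the
    weights a_j and for the linear part. A Berry-Esseen bound with that constant would exhaust it.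
    Hence the one-sided comparisons are sharpened to 0.313 for P(Poi <= j) and 0.29 for P(Poi >= k).
    As the Gaussian density is at most 0.4, the threshold may then move by 0.404 and 0.46 beyond the
    unit step that integrality gives for free: 0.4 · 0.404 + 0.313 and 0.4 · 0.46 + 0.29 are below
    47/99 < 0.4748. Of these margins 0.3 and 0.36 go to the weights, the rest to the linear part.

    If 0.4748 / sqrt mu >= 1 there is nothing to prove, so sqrt mu > 47/99 is available where the
    constants are tight. The minimum in d_lambda reflects the two ways of balancing an extra margin,
    which costs Gaussian mass in proportion to its width, against Chebyshev's bound.

    Probabilities of counts are finite recursions over balls ([mexp]); the given probability space
    enters only at the end. *)

Lemma der_eq f x (d d' : R) : is_derive x 1 f d -> d = d' -> is_derive x 1 f d'.
Proof. by move=> ? <-. Qed.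

Lemma der_cst c x : is_derive x (1 : R) (fun _ : R => c) 0.
Proof. exact: is_derive_cst. Qed.

Lemma der_id x : is_derive x (1 : R) (fun y : R => y) 1.
Proof. exact: is_derive_id. Qed.

Lemma derD f g x (d e : R) : is_derive x 1 f d -> is_derive x 1 g e ->
  is_derive x 1 (fun y => f y + g y) (d + e).
Proof. by move=> hf hg; exact: is_deriveD. Qed.

Lemma derN f x (d : R) : is_derive x 1 f d ->
  is_derive x 1 (fun y => - f y) (- d).
Proof. by move=> hf; exact: is_deriveN. Qed.

Lemma derM f g x (d e : R) : is_derive x 1 f d -> is_derive x 1 g e ->
  is_derive x 1 (fun y => f y * g y) (d * g x + f x * e).
Proof.
move=> hf hg; apply: (@der_eq _ _ _ _ (is_deriveM hf hg)).
by rewrite addrC /GRing.scale /= mulrC.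
Qed.

Lemma derX f n x (d : R) : is_derive x 1 f d ->
  is_derive x 1 (fun y => f y ^+ n) (n%:R * f x ^+ n.-1 * d).
Proof.
move=> hf; case: n => [|n].
  by apply: (der_eq (der_cst 1 x)); rewrite !mul0r.
elim: n => [|n IHn] /=.
  by rewrite (_ : (fun _ => _) = f) ?expr0 ?mulr1 ?mul1r//; apply/funext.
rewrite (_ : (fun _ => _) = (fun y => f y * f y ^+ n.+1)); last first.
  by apply/funext => y; rewrite exprS.
apply: (der_eq (derM hf IHn)); rewrite -[n.+2]addn1 natrD !exprS /=.
by ring.
Qed.

Lemma derV f x (d : R) : is_derive x 1 f d -> f x != 0 ->
  is_derive x 1 (fun y => (f y)^-1) (- (f x) ^- 2 * d).
Proof. by move=> hf fx; exact: is_deriveV. Qed.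

Lemma der_comp f g x (d e : R) : is_derive (f x) 1 g e -> is_derive x 1 f d ->
  is_derive x 1 (fun y => g (f y)) (e * d).
Proof.
move=> hg hf; apply: (@der_eq _ _ _ _ (is_derive1_comp hg hf)).
by rewrite /GRing.scale.
Qed.

Lemma der_exp f x (d : R) : is_derive x 1 f d ->
  is_derive x 1 (fun y => expR (f y)) (expR (f x) * d).
Proof. by move=> hf; apply: der_comp. Qed.

Lemma der_ln f x (d : R) : is_derive x 1 f d -> 0 < f x ->
  is_derive x 1 (fun y => ln (f y)) ((f x)^-1 * d).
Proof. by move=> hf fx; apply: der_comp => //; exact: is_derive1_ln. Qed.

Lemma der_sqrt f x (d : R) : is_derive x 1 f d -> 0 < f x ->
  is_derive x 1 (fun y => Num.sqrt (f y)) ((2 * Num.sqrt (f x))^-1 * d).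
Proof. by move=> hf fx; apply: der_comp => //; exact: is_derive1_sqrt. Qed.

Lemma der_continuous f x (d : R) : is_derive x 1 f d -> {for x, continuous f}.
Proof.
by move=> hf; apply: differentiable_continuous; apply/derivable1_diffP; case: hf.
Qed.

Lemma nondecr_der f df a b : a <= b ->
  (forall x, a <= x <= b -> is_derive x 1 f (df x)) ->
  (forall x, a < x < b -> 0 <= df x) -> f a <= f b.
Proof.
rewrite le_eqVlt => /predU1P[->//|ab] hf hd.
have [c|c|c] := @MVT R f df a b ab.
- by rewrite in_itv/= => /andP[ac cb]; apply: hf; rewrite !ltW.
- apply: continuous_in_subspaceT => x; rewrite inE/= in_itv/= => axb.
  exact: der_continuous (hf _ axb).
- rewrite in_itv/= => acb fe; rewrite -subr_ge0 fe mulr_ge0 ?hd//.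
  by rewrite subr_ge0 ltW.
Qed.

Lemma nonincr_der f df a b : a <= b ->
  (forall x, a <= x <= b -> is_derive x 1 f (df x)) ->
  (forall x, a < x < b -> df x <= 0) -> f b <= f a.
Proof.
move=> ab hf hd; rewrite -lerN2.
apply: (@nondecr_der (fun x => - f x) (fun x => - df x)) => // x xab.
  exact: derN (hf _ xab).
by rewrite oppr_ge0 hd.
Qed.

Lemma exists_der_lt0 f df a b : a <= b -> f b < f a ->
  (forall x, a <= x <= b -> is_derive x 1 f (df x)) ->
  exists2 c, a < c < b & df c < 0.
Proof.
move=> ab fba hf; apply: contrapT => h.
suff : f a <= f b by rewrite leNgt fba.
apply: (nondecr_der ab hf) => x xab; rewrite leNgt; apply/negP => dx.
by apply: h; exists x.
Qed.

(** A negative value at [b] would force [df < 0] somewhere before [b], hence [df <= 0] from there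
    on, so [f] would stay below [f b] and contradict the condition at infinity. It serves for
    differences that first rise and then fall. *)
Lemma ge0_single_crossing f df a b :
  (forall x, a <= x -> is_derive x 1 f (df x)) -> 0 <= f a ->
  (forall x y, a < x -> x < y -> df x < 0 -> df y <= 0) ->
  (forall e, 0 < e -> exists M, forall x, M <= x -> - e <= f x) ->
  a <= b -> 0 <= f b.
Proof.
move=> hf fa hd hlim ab; rewrite leNgt; apply/negP => fb.
have [|x axb|c /andP[ac cb] dc] := @exists_der_lt0 f df a b ab.
- exact: lt_le_trans fa.
- by apply: hf; case/andP: axb.
have [M hM] := hlim (- f b / 2) ltac:(lra).
have : f (Num.max M b) <= f b.
  apply: (@nonincr_der f df).
  - by rewrite le_max lexx orbT.
  - by move=> x /andP[bx _]; apply: hf; exact: le_trans bx.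
  - by move=> x /andP[bx _]; apply: hd dc => //; exact: lt_trans bx.
by have := hM (Num.max M b) ltac:(by rewrite le_max lexx); lra.
Qed.

End calculus.

(** [der] differentiates by structure and leaves the side conditions and the equality with the
    announced derivative; [der_atom] is the hook through which [Phi] joins later. *)
Ltac der_atom :=
  first [ exact: is_derive_sin | exact: is_derive_cos ].
Ltac der_step :=
  first [ der_atom | apply: der_cst | apply: der_id | eapply derD | eapply derN
        | eapply derX | eapply derV | eapply der_exp | eapply der_ln
        | eapply der_sqrt | eapply derM ].
Ltac der := eapply der_eq; [repeat der_step|].

(** * The Gaussian distribution function *)

Section gaussian.
Context {R : realType}.
Implicit Types (x y z t : R).

Local Notation gauss := (normal_prob (0 : R) 1).
Local Notation c0 := (normal_peak (1 : R)).

Definition npdf (x : R) : R := normal_pdf 0 1 x.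
Definition Phi (t : R) : R := fine (gauss `]-oo, t]).

Lemma npdfE x : npdf x = c0 * expR (- x ^+ 2 / 2).
Proof. by rewrite /npdf normal_pdfE ?oner_neq0// /normal_fun subr0 expr1n. Qed.

Lemma npdf_gt0 x : 0 < npdf x.
Proof. by rewrite npdfE mulr_gt0 ?expR_gt0// normal_peak_gt0// oner_neq0. Qed.

Lemma PhiE t : Phi t = \int[lebesgue_measure]_(x in `]-oo, t]) npdf x.
Proof. by []. Qed.

Lemma der_Phi t : is_derive t (1 : R) Phi (npdf t).
Proof.
have lt1 : t < t + 1 by rewrite ltrDl.
have npdf_int : lebesgue_measure.-integrable `]-oo, t + 1] (EFin \o npdf).
  by apply: (integrableS _ _ (subsetT _)) => //; exact: integrable_normal_pdf.
have [d e] := continuous_FTC1 lt1 npdf_int (ltNyr _)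
  (continuous_normal_pdf (oner_neq0 _) (x := t)).
by apply: DeriveDef; [exact: d|rewrite -derive1E e].
Qed.

Lemma Phi_ge0 t : 0 <= Phi t. Proof. exact: fine_ge0. Qed.

Lemma Phi_le1 t : Phi t <= 1.
Proof.
by rewrite -lee_fin fineK ?fin_num_measure// probability_le1.
Qed.

Lemma Phi_nondecr x y : x <= y -> Phi x <= Phi y.
Proof.
move=> xy; apply: (nondecr_der xy (fun z _ => der_Phi z)) => z _.
exact/ltW/npdf_gt0.
Qed.

Let idR : measurableTypeR R -> R := idfun.

#[local] HB.instance Definition _ :=
  @isMeasurableFun.Build _ _ _ _ idR (@measurable_id _ _ setT).

Let cdf_id : fine \o cdf (idR : {RV gauss >-> R}) = Phi.
Proof. by []. Qed.

Lemma Phi_cvg1 (e : R) : 0 < e -> exists M, forall x, M <= x -> 1 - e <= Phi x.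
Proof.
move=> e0; have /fine_cvg := @cvg_cdfy1 _ _ _ gauss (idR : {RV gauss >-> R}).
rewrite cdf_id /= => /cvgrPdist_le/(_ _ e0)[M [_ hM]].
exists (M + 1) => x Mx; have := hM x; rewrite /= => /(_ ltac:(lra)).
by rewrite ler_norml => /andP[_]; lra.
Qed.

Lemma Phi_cvg0 (e : R) : 0 < e -> exists M, forall x, x <= M -> Phi x <= e.
Proof.
move=> e0; have /fine_cvg := @cvg_cdfNy0 _ _ _ gauss (idR : {RV gauss >-> R}).
rewrite cdf_id /= => /cvgrPdist_le/(_ _ e0)[M [_ hM]].
exists (M - 1) => x Mx; have := hM x; rewrite /= => /(_ ltac:(lra)).
by rewrite ler_norml => /andP[]; lra.
Qed.

Lemma npdfN x : npdf (- x) = npdf x.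
Proof. by rewrite !npdfE sqrrN. Qed.

(** The sum [Phi t + Phi (- t)] has derivative 0 because the density is even; the limits of [Phi] at
    both ends identify the constant. *)
Lemma PhiN t : Phi (- t) = 1 - Phi t.
Proof.
have dS x : is_derive x 1 (fun y => Phi y + Phi (- y)) 0.
  eapply der_eq; first eapply derD; first exact: der_Phi.
    by apply: (der_comp (der_Phi _)); apply: derN; exact: der_id.
  by rewrite /= npdfN; ring.
have S_cst x y : x <= y -> Phi x + Phi (- x) = Phi y + Phi (- y).
  move=> xy; apply/le_anti/andP; split.
    exact: (nondecr_der xy (fun z _ => dS z)).
  exact: (nonincr_der xy (fun z _ => dS z)).
suff : Phi t + Phi (- t) = 1 by move=> <-; ring.
apply/le_anti/andP; split; apply/ler_addgt0Pr => e e0.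
- have [M hM] := Phi_cvg0 e0; set y := Num.max t (- M).
  rewrite (S_cst t y) ?le_max ?lexx// lerD ?Phi_le1//.
  by apply: hM; rewrite lerNl le_max lexx orbT.
- have [M hM] := Phi_cvg1 e0; set y := Num.max t M.
  rewrite (S_cst t y) ?le_max ?lexx// -lerBlDr.
  by rewrite (le_trans (hM y _)) ?le_max ?lexx ?orbT// lerDl Phi_ge0.
Qed.

Lemma Phi0 : Phi 0 = 1 / 2.
Proof. by have := PhiN 0; rewrite oppr0; lra. Qed.

Lemma gauss_itvNyo t : fine (gauss `]-oo, t[) = Phi t.
Proof.
rewrite PhiE -(@Rintegral_itv_bndo_bndc _ -oo%O t npdf)//.
by apply: (integrableS _ _ (subsetT _)) => //; exact: integrable_normal_pdf.
Qed.

Lemma gauss_itvcy t : fine (gauss `[t, +oo[) = 1 - Phi t.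
Proof.
rewrite -setCitvl probability_setC// fineB ?fin_num_measure//.
by rewrite gauss_itvNyo.
Qed.

End gaussian.

Ltac der_atom ::=
  first [ exact: is_derive_sin | exact: is_derive_cos | exact: der_Phi ].

#[global] Opaque npdf Phi.

(** * Numerical bounds for pi and for the peak of the Gaussian density *)

Section pi_bounds.
Context {R : realType}.
Implicit Types x : R.

Lemma sin_leid x : 0 <= x -> sin x <= x.
Proof.
move=> x0; rewrite -subr_ge0.
have := @nondecr_der R (fun y => y - sin y) (fun y => 1 - cos y) 0 x x0.
rewrite sin0 subrr; apply => y _; first by rewrite subr_ge0 cos_le1.
Qed.

Lemma cos_ge_deg2 x : 0 <= x -> 1 - x ^+ 2 / 2 <= cos x.
Proof.
move=> x0; rewrite -subr_ge0.
have := @nondecr_der R (fun y => cos y - (1 - y ^+ 2 / 2))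
  (fun y => y - sin y) 0 x x0.
rewrite cos0 expr0n mul0r subr0 subrr; apply => y.
  by move=> _; der; rewrite /= ?expr1; lra.
by move=> /andP[y0 _]; rewrite subr_ge0 sin_leid// ltW.
Qed.

Lemma sin_ge_deg3 x : 0 <= x -> x - x ^+ 3 / 6 <= sin x.
Proof.
move=> x0; rewrite -subr_ge0.
have := @nondecr_der R (fun y => sin y - (y - y ^+ 3 / 6))
  (fun y => cos y - (1 - y ^+ 2 / 2)) 0 x x0.
rewrite sin0 expr0n mul0r !subr0; apply => y.
  by move=> _; der; rewrite /=; lra.
by move=> /andP[y0 _]; rewrite subr_ge0 cos_ge_deg2// ltW.
Qed.

Lemma cos_le_deg4 x : 0 <= x -> cos x <= 1 - x ^+ 2 / 2 + x ^+ 4 / 24.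
Proof.
move=> x0; rewrite -subr_ge0.
have := @nondecr_der R (fun y => (1 - y ^+ 2 / 2 + y ^+ 4 / 24) - cos y)
  (fun y => sin y - (y - y ^+ 3 / 6)) 0 x x0.
rewrite cos0 !expr0n/= !mul0r subr0 addr0 subrr; apply => y.
  by move=> _; der; rewrite /= ?expr1; lra.
by move=> /andP[y0 _]; rewrite subr_ge0 sin_ge_deg3// ltW.
Qed.

Lemma sin_le_deg5 x : 0 <= x -> sin x <= x - x ^+ 3 / 6 + x ^+ 5 / 120.
Proof.
move=> x0; rewrite -subr_ge0.
have := @nondecr_der R (fun y => (y - y ^+ 3 / 6 + y ^+ 5 / 120) - sin y)
  (fun y => (1 - y ^+ 2 / 2 + y ^+ 4 / 24) - cos y) 0 x x0.
rewrite sin0 !expr0n/= !mul0r subr0 addr0 subrr; apply => y.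
  by move=> _; der; rewrite /=; lra.
by move=> /andP[y0 _]; rewrite subr_ge0 cos_le_deg4// ltW.
Qed.

Lemma cos_ge_deg6 x : 0 <= x ->
  1 - x ^+ 2 / 2 + x ^+ 4 / 24 - x ^+ 6 / 720 <= cos x.
Proof.
move=> x0; rewrite -subr_ge0.
have := @nondecr_der R
  (fun y => cos y - (1 - y ^+ 2 / 2 + y ^+ 4 / 24 - y ^+ 6 / 720))
  (fun y => (y - y ^+ 3 / 6 + y ^+ 5 / 120) - sin y) 0 x x0.
rewrite cos0 !expr0n/= !mul0r !subr0 addr0 subrr; apply => y.
  by move=> _; der; rewrite /= ?expr1; lra.
by move=> /andP[y0 _]; rewrite subr_ge0 sin_le_deg5// ltW.
Qed.

(** Were pi smaller, the cosine would be nonpositive at 1.5625, against its Taylor polynomial. The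
    value 3.125 is exactly 1 / (2 · 0.4^2), so that the density is at most 0.4; the upper bound
    3.287 likewise yields 0.39. *)
Lemma pi_lower : 3125 / 1000 <= pi :> R.
Proof.
rewrite leNgt; apply/negP => pi3.
have : cos (15625 / 10000) <= 0 :> R.
  rewrite -cos_pihalf leNgt ltr_cos ?in_itv/=; first by rewrite -leNgt; lra.
  - by have := @pi_ge2 R; lra.
  - by have := @pi_ge2 R; lra.
have := @cos_ge_deg6 (15625 / 10000) ltac:(lra).
by lra.
Qed.

Lemma pi_upper : pi <= 3287 / 1000 :> R.
Proof.
rewrite leNgt; apply/negP => pi3.
have := @cos_gt0_pihalf R (16435 / 10000) ltac:(lra).
have := @cos_le_deg4 (16435 / 10000) ltac:(lra).
by lra.
Qed.

Local Notation c0 := (normal_peak (1 : R)).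

Lemma sqr_normal_peak1 : c0 ^+ 2 * (2 * pi) = 1.
Proof.
rewrite /normal_peak expr1n mul1r -mulr_natl exprVn sqr_sqrtr.
  by rewrite mulVf// mulf_neq0// gt_eqF// pi_gt0.
by rewrite mulr_ge0// pi_ge0.
Qed.

Lemma normal_peak1_gt0 : 0 < c0.
Proof. by rewrite normal_peak_gt0// oner_neq0. Qed.

Lemma normal_peak1_le : c0 <= 4 / 10.
Proof.
have := pi_lower; have := sqr_normal_peak1; have := normal_peak1_gt0.
by nra.
Qed.

Lemma normal_peak1_ge : 39 / 100 <= c0.
Proof.
have := pi_upper; have := sqr_normal_peak1; have := normal_peak1_gt0.
have := @pi_gt0 R; nra.
Qed.

End pi_bounds.

(** * A rational bound for the Gaussian tail *)

Section gaussian_tail.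
Context {R : realType}.
Implicit Types (x y z : R).

Lemma npdf_le x : npdf x <= 4 / 10.
Proof.
rewrite npdfE (le_trans _ (@normal_peak1_le R))// ler_piMr//.
  exact/ltW/normal_peak1_gt0.
by rewrite expR_le1; have := sqr_ge0 x; lra.
Qed.

Lemma Phi_lip x y : x <= y -> Phi y - Phi x <= 4 / 10 * (y - x).
Proof.
move=> xy.
have := @nondecr_der R (fun z => 4 / 10 * z - Phi z)
  (fun z => 4 / 10 - npdf z) x y xy.
move=> h; have {h} : 4 / 10 * x - Phi x <= 4 / 10 * y - Phi y; last by lra.
apply: h => z _; last by rewrite subr_ge0 npdf_le.
by der; rewrite /=; ring.
Qed.

Lemma Phi_ge_cubic z : 0 <= z -> 1 / 2 + 39 / 100 * (z - z ^+ 3 / 6) <= Phi z.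
Proof.
move=> z0; rewrite -subr_ge0.
have := @nondecr_der R
  (fun y => Phi y - (1 / 2 + 39 / 100 * (y - y ^+ 3 / 6)))
  (fun y => npdf y - 39 / 100 * (1 - y ^+ 2 / 2)) 0 z z0.
rewrite Phi0 expr0n/= mul0r subr0 mulr0 addr0 subrr; apply => y _.
  by der; rewrite /=; field.
rewrite subr_ge0 npdfE.
have := @normal_peak1_ge R; have := expR_ge1Dx (- y ^+ 2 / 2).
have := expR_gt0 (- y ^+ 2 / 2); set E := expR _; set c := normal_peak _.
move=> E0 Ey c39; apply: (@le_trans _ _ (39 / 100 * E)); first by lra.
by rewrite ler_pM2r.
Qed.

(** Denominator of the tail bound: exact at 0, where the tail is 1/2, and with slope 3/2 there,
    below the slope 4 / sqrt (2 pi) of the reciprocal tail. *)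
Let q (z : R) : R := 2 + 3 / 2 * z + 11 / 10 * z ^+ 2.
Let q' (z : R) : R := 3 / 2 + 11 / 5 * z.
Let F (z : R) : R := npdf z * q z ^+ 2 / q' z.
(** The factor [2 q'^2 - q q'' - z q q'] that carries the sign of the derivative of [F]. *)
Let P (z : R) : R :=
  1 / 10 + 69 / 10 * z + 61 / 100 * z ^+ 2 - 495 / 100 * z ^+ 3
  - 242 / 100 * z ^+ 4.

Let q_gt0 z : 0 <= z -> 0 < q z. Proof. by rewrite /q; nra. Qed.
Let q'_gt0 z : 0 <= z -> 0 < q' z. Proof. by rewrite /q'; nra. Qed.

Let der_F z : 0 <= z ->
  is_derive z 1 F (npdf z * q z / q' z ^+ 2 * P z).
Proof.
move=> z0; have q'z := q'_gt0 z0; rewrite /F /q /q'.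
have -> : (npdf : R -> R) = fun y => normal_peak 1 * expR (- y ^+ 2 / 2).
  by apply/funext => y; rewrite npdfE.
der; first by rewrite gt_eqF.
rewrite /= /q /q' /P expr1; field.
by move: q'z; rewrite /q' => ?; rewrite gt_eqF//; lra.
Qed.

(** [P x / x^2] decreases on the positive axis: the coefficients of degree at most 2 are positive,
    those of higher degree negative. *)
Let P_lt0 x y : 0 < x -> x < y -> P x < 0 -> P y <= 0.
Proof.
move=> x0 xy Px; rewrite leNgt; apply/negP => Py.
have : x ^+ 2 * P y <= y ^+ 2 * P x.
  rewrite -subr_ge0.
  have -> : y ^+ 2 * P x - x ^+ 2 * P y = (y - x) *
    (1 / 10 * (y + x) + 69 / 10 * (x * y)
     + (x * y) ^+ 2 * (495 / 100 + 242 / 100 * (y + x))).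
    by rewrite /P; field.
  have y0 : 0 < y by exact: lt_trans xy.
  have xy0 : 0 < x * y by exact: mulr_gt0.
  apply: mulr_ge0; first by rewrite subr_ge0 ltW.
  have : 0 <= (x * y) ^+ 2 * (495 / 100 + 242 / 100 * (y + x)).
    by apply: mulr_ge0; [exact: sqr_ge0|lra].
  by lra.
have : 0 < x ^+ 2 * P y by rewrite mulr_gt0 ?exprn_gt0.
have : y ^+ 2 * P x < 0.
  by rewrite pmulr_rlt0 ?exprn_gt0//; exact: lt_trans xy.
by lra.
Qed.

(** [F] starts at 1 or above and rises before it falls, so once below 1 it stays there. *)
Let F_crossing x y : 0 < x -> x < y -> F x < 1 -> F y < 1.
Proof.
move=> x0 xy Fx.
have F0 : 1 <= F 0.
  have -> : F 0 = normal_peak 1 * (8 / 3).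
    by rewrite /F /q /q' npdfE expr0n/= oppr0 mul0r expR0; field.
  by have := @normal_peak1_ge R; lra.
have [|z /andP[z0 _]|c /andP[c0 cx] dc] :=
  @exists_der_lt0 R F (fun z => npdf z * q z / q' z ^+ 2 * P z) 0 x (ltW x0).
- exact: lt_le_trans F0.
- exact: der_F.
have pos z : 0 < z -> 0 < npdf z * q z / q' z ^+ 2.
  by move=> z0; rewrite divr_gt0 ?mulr_gt0 ?npdf_gt0 ?exprn_gt0 ?q_gt0 ?q'_gt0
    ?ltW.
apply: le_lt_trans Fx.
apply: (nonincr_der (ltW xy)) => z /andP[xz _].
  by apply: der_F; rewrite (le_trans _ xz)// ltW.
have z0 : 0 < z by exact: lt_trans xz.
rewrite pmulr_rle0 ?pos//; apply: (@P_lt0 c) => //; first exact: lt_trans xz.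
by move: dc; rewrite pmulr_rlt0 ?pos.
Qed.

(** The difference [H] of the two sides vanishes at 0 and at infinity, and its derivative has the
    sign of [F - 1], which changes at most once, from plus to minus. *)
Lemma gaussian_tail z : 0 <= z ->
  1 - Phi z <= (2 + 3 / 2 * z + 11 / 10 * z ^+ 2)^-1.
Proof.
move=> z0; rewrite -subr_ge0.
pose H y := (q y)^-1 - (1 - Phi y).
have dHE y : 0 <= y -> npdf y - q' y / q y ^+ 2 = q' y / q y ^+ 2 * (F y - 1).
  move=> y0; rewrite /F; field; first by rewrite !gt_eqF ?q_gt0 ?q'_gt0.
suff : 0 <= H z by [].
apply: (@ge0_single_crossing R H (fun y => npdf y - q' y / q y ^+ 2) 0) => //.
- move=> y y0; have qy := q_gt0 y0.
  rewrite /H /q; der; first by rewrite -/(q y) gt_eqF.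
  by rewrite /= expr1 -/(q y) /q'; field; rewrite gt_eqF.
- by rewrite /H /q Phi0 expr0n/= !mulr0 !addr0; lra.
- move=> x y x0 xy; have y0 := lt_trans x0 xy.
  have w t : 0 < t -> 0 < q' t / q t ^+ 2.
    by move=> /ltW t0; rewrite divr_gt0 ?exprn_gt0 ?q_gt0 ?q'_gt0.
  rewrite (dHE x (ltW x0)) (dHE y (ltW y0)) (pmulr_rlt0 _ (w _ x0)) => Fx.
  rewrite (pmulr_rle0 _ (w _ y0)) subr_le0 ltW// (@F_crossing x)//.
  by rewrite -subr_lt0.
- move=> e e0; have [M hM] := Phi_cvg1 e0; exists (Num.max M 0) => x.
  rewrite ge_max => /andP[/hM Px x0]; rewrite /H.
  have : 0 < (q x)^-1 by rewrite invr_gt0 q_gt0.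
  by move: Px; lra.
Qed.

End gaussian_tail.

(** * The Poisson distribution *)

Section poisson.
Context {R : realType}.
Implicit Types (m x y z s : R) (i j k : nat).

Definition ppmf i m : R := expR (- m) * m ^+ i / i`!%:R.
(** The sum stops before [k]: this is P(Poi(m) < k), and the distribution function at [j] is
    [pcdf j.+1]. *)
Definition pcdf k m : R := \sum_(i < k) ppmf i m.

Lemma ppmfE i m : ppmf i m = expR (- m) * m ^+ i / i`!%:R. Proof. by []. Qed.

Lemma factR_gt0 i : 0 < i`!%:R :> R. Proof. by rewrite ltr0n fact_gt0. Qed.

Lemma ppmf_ge0 i m : 0 <= m -> 0 <= ppmf i m.
Proof.
by move=> m0; rewrite /ppmf !mulr_ge0 ?expR_ge0 ?exprn_ge0 ?invr_ge0 ?ler0n.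
Qed.

Lemma ppmf_gt0 i m : 0 < m -> 0 < ppmf i m.
Proof.
move=> m0; rewrite /ppmf; apply: mulr_gt0; last by rewrite invr_gt0 factR_gt0.
by rewrite mulr_gt0 ?expR_gt0 ?exprn_gt0.
Qed.

Lemma ppmfS i m : i.+1%:R * ppmf i.+1 m = m * ppmf i m.
Proof.
rewrite /ppmf factS natrM exprS; field.
by rewrite nat1r !pnatr_eq0 -lt0n fact_gt0.
Qed.

Lemma der_ppmf0 m : is_derive m 1 (ppmf 0) (- ppmf 0 m).
Proof. by rewrite /ppmf fact0; der; rewrite /= !expr0; field. Qed.

Lemma der_ppmfS i m : is_derive m 1 (ppmf i.+1) (ppmf i m - ppmf i.+1 m).
Proof.
rewrite /ppmf factS natrM; der; rewrite /= exprS; field.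
by rewrite nat1r !pnatr_eq0 -lt0n fact_gt0.
Qed.

Lemma pcdf0 m : pcdf 0 m = 0. Proof. by rewrite /pcdf big_ord0. Qed.

Lemma pcdfS k m : pcdf k.+1 m = pcdf k m + ppmf k m.
Proof. by rewrite /pcdf big_ord_recr. Qed.

Lemma der_pcdf k m : is_derive m 1 (pcdf k.+1) (- ppmf k m).
Proof.
elim: k => [|k IHk].
  rewrite (_ : pcdf 1 = ppmf 0); first exact: der_ppmf0.
  by apply/funext => x; rewrite pcdfS pcdf0 add0r.
rewrite (_ : pcdf k.+2 = (fun x => pcdf k.+1 x + ppmf k.+1 x)); last first.
  by apply/funext => x; rewrite pcdfS.
eapply der_eq; first (eapply derD; [exact: IHk|exact: der_ppmfS]).
by ring.
Qed.

Lemma pcdf_at0 k : pcdf k.+1 0 = 1.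
Proof.
rewrite /pcdf big_ord_recl /ppmf /= oppr0 expR0 expr0 divr1 mulr1.
by rewrite big1 ?addr0// => i _; rewrite expr0n/= mulr0 mul0r.
Qed.

Lemma pcdf_ge0 k m : 0 <= m -> 0 <= pcdf k m.
Proof. by move=> m0; apply: sumr_ge0 => i _; exact: ppmf_ge0. Qed.

Lemma pcdf_nonincr k x y : 0 <= x -> x <= y -> pcdf k y <= pcdf k x.
Proof.
case: k => [|k] x0 xy; first by rewrite !pcdf0.
have h := @nonincr_der R (pcdf k.+1) (fun m => - ppmf k m) x y xy.
apply: h => z; first by move=> _; exact: der_pcdf.
by move=> /andP[xz _]; rewrite oppr_le0 ppmf_ge0// (le_trans x0)// ltW.
Qed.

Lemma pcdf_le1 k m : 0 <= m -> pcdf k m <= 1.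
Proof.
case: k => [|k] m0; first by rewrite pcdf0.
by rewrite -(pcdf_at0 k) pcdf_nonincr.
Qed.

Lemma ppmf_le1 i m : 0 <= m -> ppmf i m <= 1.
Proof.
move=> m0; have := pcdf_le1 i.+1 m0; rewrite pcdfS; apply: le_trans.
by rewrite lerDr pcdf_ge0.
Qed.

Lemma pcdf_lip k x y : 0 <= x -> x <= y -> pcdf k x - pcdf k y <= y - x.
Proof.
case: k => [|k] x0 xy; first by rewrite !pcdf0; lra.
have h := @nondecr_der R (fun z => pcdf k.+1 z + z) (fun m => - ppmf k m + 1)
  x y xy.
have {h} : pcdf k.+1 x + x <= pcdf k.+1 y + y; last by lra.
apply: h => z.
  by move=> _; eapply derD; [exact: der_pcdf|exact: der_id].
move=> /andP[xz _]; have := @ppmf_le1 k z ltac:(lra).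
by lra.
Qed.

Lemma pcdf_cvg0 k e : 0 < e -> exists M, forall m, M <= m -> pcdf k m <= e.
Proof.
move=> e0; exists (Num.max 1 (k%:R ^+ 2 / e)) => m.
rewrite ge_max => /andP[m1 km]; have m0 : 0 < m by lra.
suff : pcdf k m <= k%:R ^+ 2 / m.
  by move=> /le_trans; apply; rewrite ler_pdivrMr// mulrC -ler_pdivrMr.
have -> : k%:R ^+ 2 / m = \sum_(i < k) k%:R / m.
  by rewrite sumr_const card_ord -[RHS]mulr_natl expr2 mulrA.
apply: ler_sum => i _; rewrite ler_pdivlMr//.
rewrite mulrC -ppmfS (@le_trans _ _ i.+1%:R)//.
  by rewrite ler_piMr ?ppmf_le1// ltW.
by rewrite ler_nat.
Qed.

(** The derivative of the difference in [s] has the sign of [c0 - h / j!], where [h] has logarithmic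
    derivative [2 (x - r)^2 / x]. The choice [r^2 = j + 1/2] is what completes this square, so [h]
    increases and the difference rises, then falls. *)
Lemma sqrt_lower_bound j s : 0 <= s ->
  Phi (2 * Num.sqrt (j%:R + 1 / 2) - 2 * s) <= pcdf j.+1 (s ^+ 2).
Proof.
move=> s0; rewrite -subr_ge0.
set r := Num.sqrt _.
have r2 : r ^+ 2 = j%:R + 1 / 2 by rewrite sqr_sqrtr// addr_ge0.
pose f x := pcdf j.+1 (x ^+ 2) - Phi (2 * r - 2 * x).
pose df x := 2 * npdf (2 * r - 2 * x) - 2 * x * ppmf j (x ^+ 2).
pose h x := x ^+ j.*2.+1 * expR (2 * (r - x) ^+ 2 - x ^+ 2).
have h_ndecr x y : 0 < x -> x <= y -> h x <= h y.
  move=> x0 xy; have hd := @nondecr_der R h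
    (fun z => z ^+ j.*2 * expR (2 * (r - z) ^+ 2 - z ^+ 2) *
              (2 * (z - r) ^+ 2)) x y xy.
  apply: hd => z; last first.
    move=> /andP[xz _]; have z0 : 0 <= z by lra.
    apply: mulr_ge0; first by rewrite mulr_ge0 ?exprn_ge0 ?expR_ge0.
    by rewrite mulr_ge0 ?sqr_ge0.
  move=> _; rewrite /h; der; rewrite /= !expr1 (exprS z j.*2).
  rewrite (_ : j.*2.+1%:R = 2 * r ^+ 2); last first.
    by rewrite r2 -addn1 natrD -mul2n natrM; field.
  by ring.
have dfE x : df x = 2 * expR (- (2 * r - 2 * x) ^+ 2 / 2) *
    (normal_peak 1 - h x / j`!%:R).
  rewrite /df /h npdfE /ppmf; have := factR_gt0 j; set F := _%:R => F0.
  rewrite -exprM mul2n expRD expRN (exprS x j.*2).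
  rewrite [in RHS](_ : 2 * (r - x) ^+ 2 = (2 * r - 2 * x) ^+ 2 / 2); last by field.
  rewrite mulNr !expRN; set E1 := expR _; set E2 := expR _.
  by field; rewrite (gt_eqF F0) !gt_eqF ?expR_gt0.
apply: (@ge0_single_crossing R f df 0) => //.
- move=> x _; rewrite /f; eapply der_eq.
    eapply derD; last (eapply derN; eapply (der_comp (der_Phi _)); repeat der_step).
    by eapply (der_comp (der_pcdf j _)); repeat der_step.
  by rewrite /= expr1 /df; move: (npdf _) (ppmf _ _) => u v; ring.
- by rewrite /f expr0n/= pcdf_at0 subr_ge0 Phi_le1.
- move=> x y x0 xy; rewrite !dfE.
  have E z : 0 < 2 * expR (- (2 * r - 2 * z) ^+ 2 / 2).
    by rewrite mulr_gt0 ?expR_gt0.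
  rewrite (pmulr_rlt0 _ (E x)) (pmulr_rle0 _ (E y)).
  have : h x / j`!%:R <= h y / j`!%:R.
    by rewrite ler_pM2r ?invr_gt0 ?factR_gt0// h_ndecr// ltW.
  by lra.
- move=> e e0; have [M hM] := @Phi_cvg0 R _ e0; exists (r - M / 2) => x xM.
  have := hM (2 * r - 2 * x) ltac:(lra).
  by have := pcdf_ge0 j.+1 (sqr_ge0 x); rewrite /f; lra.
Qed.

End poisson.

#[global] Opaque ppmf pcdf.

(** * Poisson and Gaussian distribution functions *)

Section log_inequalities.
Context {R : realType}.
Implicit Types x v : R.

Lemma ge0_of_min1 (f df : R -> R) v : 0 < v -> f 1 = 0 ->
  (forall x, 0 < x -> is_derive x 1 f (df x)) ->
  (forall x, 1 < x -> 0 <= df x) -> (forall x, 0 < x < 1 -> df x <= 0) ->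
  0 <= f v.
Proof.
move=> v0 f1 hf hp hn; rewrite -f1.
have [v1|/ltW v1] := leP 1 v.
  apply: (nondecr_der v1) => x /andP[x1 _]; first by apply: hf; lra.
  exact: hp.
apply: (nonincr_der v1) => x /andP[vx x1]; first by apply: hf; lra.
by apply: hn; lra.
Qed.

Lemma le0_of_decr (f df : R -> R) v : 0 < v -> f 1 = 0 ->
  (forall x, 0 < x -> is_derive x 1 f (df x)) -> (forall x, 0 < x -> df x <= 0) ->
  (v <= 1 -> 0 <= f v) /\ (1 <= v -> f v <= 0).
Proof.
move=> v0 f1 hf hn; rewrite -f1; split => v1.
  apply: (nonincr_der v1) => x /andP[x1 _]; first by apply: hf; lra.
  by apply: hn; lra.
apply: (nonincr_der v1) => x /andP[x1 _]; first by apply: hf; lra.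
by apply: hn; lra.
Qed.

(** Meant for [v^3 = m / kap]: with the cube root as variable the target involves no fractional
    power, and the derivative of the difference is [(x - 1)^3] times a positive factor. *)
Lemma dev_le_cube v : 0 < v ->
  2 * (v ^+ 3 - 1 - 3 * ln v) <= ((v ^+ 3 - 1) / v) ^+ 2.
Proof.
move=> v0; rewrite -subr_ge0.
pose f x := ((x ^+ 3 - 1) / x) ^+ 2 - 2 * (x ^+ 3 - 1 - 3 * ln x).
pose q x := 2 * (2 * x ^+ 3 + 3 * x ^+ 2 + 3 * x + 1) / x ^+ 3.
have q0 x : 0 < x -> 0 <= q x.
  move=> x0; rewrite /q divr_ge0 ?exprn_ge0 ?ltW// mulr_gt0//.
  by have := exprn_gt0 3 x0; have := exprn_gt0 2 x0; lra.
apply: (@ge0_of_min1 f (fun x => q x * (x - 1) ^+ 3)) => //.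
- by rewrite /f ln1 expr1n; field.
- move=> x x0; rewrite /f; der; rewrite ?gt_eqF//=.
  by rewrite /q !expr1; field; rewrite gt_eqF.
- by move=> x x1; rewrite mulr_ge0 ?q0 ?exprn_ge0//; lra.
- move=> x /andP[x0 x1].
  have -> : (x - 1) ^+ 3 = - (1 - x) ^+ 3 by ring.
  by rewrite mulrN oppr_le0 mulr_ge0 ?q0 ?exprn_ge0//; lra.
Qed.

Lemma dev_vs_chi2 v : 0 < v ->
  (v <= 1 -> 2 * (v - 1 - ln v) <= (v - 1) ^+ 2 / v) /\
  (1 <= v -> (v - 1) ^+ 2 / v <= 2 * (v - 1 - ln v)).
Proof.
move=> v0.
have := @le0_of_decr (fun x => (x - 1) ^+ 2 / x - 2 * (x - 1 - ln x))
  (fun x => - (1 - x^-1) ^+ 2) v v0.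
rewrite /= subrr expr0n/= mul0r ln1 subrr mulr0 subrr => h.
have [||h1 h2] := h erefl.
- move=> x x0; der; rewrite ?gt_eqF//=.
  by rewrite expr1; field; rewrite gt_eqF.
- by move=> x _; rewrite oppr_le0 sqr_ge0.
- by split=> v1; [rewrite -subr_ge0; exact: h1|rewrite -subr_le0; exact: h2].
Qed.

Lemma dev_ge_sqr v : 0 < v -> v <= 1 -> (v - 1) ^+ 2 <= 2 * (v - 1 - ln v).
Proof.
move=> v0 v1.
have := @le0_of_decr (fun x => 2 * (x - 1 - ln x) - (x - 1) ^+ 2)
  (fun x => - (2 * (1 - x) ^+ 2 / x)) v v0.
rewrite /= subrr expr0n/= ln1 subrr mulr0 subrr => h.
have [||h1 _] := h erefl.
- move=> x x0; der; rewrite ?gt_eqF//=.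
  by rewrite expr1; field; rewrite gt_eqF.
- move=> x x0; rewrite oppr_le0; apply: divr_ge0; last exact: ltW.
  by rewrite mulr_ge0 ?sqr_ge0.
- by rewrite -subr_ge0 h1.
Qed.

(* [2 artanh t >= 2 t + 2 t^3 / 3] at [t = 1 / (2 k + 1)]. *)
Lemma ln1p_inv_ge (k : R) : 1 <= k ->
  2 / (2 * k + 1) + 2 / (3 * (2 * k + 1) ^+ 3) <= ln (1 + k^-1).
Proof.
move=> k1; set t := (2 * k + 1)^-1.
have t0 : 0 < t by rewrite invr_gt0; lra.
have t1 : t <= 1 / 3.
  by rewrite /t -[X in X <= _]div1r ler_pdivrMr; lra.
have -> : 1 + k^-1 = (1 + t) / (1 - t).
  by rewrite /t; field; rewrite !gt_eqF//; lra.
rewrite ln_div ?posrE; [|lra|lra].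
have -> : 2 / (2 * k + 1) + 2 / (3 * (2 * k + 1) ^+ 3) = 2 * t + 2 / 3 * t ^+ 3.
  by rewrite /t; field; rewrite gt_eqF//; lra.
rewrite -subr_ge0.
pose f x := ln (1 + x) - ln (1 - x) - (2 * x + 2 / 3 * x ^+ 3).
have f0 : f 0 = 0 by rewrite /f subr0 addr0 subrr expr0n/= !mulr0 addr0 subrr.
rewrite -[X in X <= _]f0 -/(f t).
apply: (@nondecr_der R f (fun x => 2 * x ^+ 4 / (1 - x ^+ 2)) 0 t (ltW t0)).
  move=> x /andP[x0 xt]; rewrite /f.
  have ? : 0 < 1 + x by lra.
  have ? : 0 < 1 - x by lra.
  der => //=; field; rewrite !gt_eqF//.
  by have : 0 < (1 + x) * (1 - x) by [rewrite mulr_gt0]; lra.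
move=> x /andP[x0 xt]; rewrite divr_ge0 ?mulr_ge0 ?exprn_ge0 ?(ltW x0)//.
by have : 0 < (1 + x) * (1 - x) by [rewrite mulr_gt0//; lra]; lra.
Qed.

End log_inequalities.

(** * The deviance and the Poisson weights *)

Section deviance.
Context {R : realType}.
Implicit Types (m x y z s kap : R) (i j k : nat).

Local Notation c0 := (normal_peak (1 : R)).

(* Twice the Kullback-Leibler divergence of Poisson(kap) from Poisson(m). *)
Definition dev kap m : R := 2 * (m - kap + kap * (ln kap - ln m)).

Lemma devE kap m : 0 < kap -> 0 < m ->
  dev kap m = kap * (2 * (m / kap - 1 - ln (m / kap))).
Proof.
by move=> k0 m0; rewrite /dev ln_div ?posrE//; field; rewrite gt_eqF.
Qed.

Lemma der_dev kap m : 0 < m -> is_derive m 1 (dev kap) (2 * (1 - kap / m)).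
Proof. by move=> m0; rewrite /dev; der => //=; ring. Qed.

(** Pearson's chi-square lies above the deviance for [m <= kap] and below it for [m >= kap]; both
    directions say that the signed root of the deviance is at most [(kap - m) / sqrt m]. *)
Lemma dev_le_chi2 kap m : 0 < m -> m <= kap ->
  dev kap m <= (kap - m) ^+ 2 / m.
Proof.
move=> m0 mk; have k0 := lt_le_trans m0 mk.
have v0 : 0 < m / kap by rewrite divr_gt0.
have [h _] := dev_vs_chi2 v0.
rewrite devE// (le_trans (ler_wpM2l (ltW k0) (h _)))//.
  by rewrite ler_pdivrMr// mul1r.
by rewrite le_eqVlt; apply/orP; left; apply/eqP; field; rewrite !gt_eqF.
Qed.

Lemma dev_ge_chi2 kap m : 0 < kap -> kap <= m ->
  (m - kap) ^+ 2 / m <= dev kap m.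
Proof.
move=> k0 km; have m0 := lt_le_trans k0 km.
have v0 : 0 < m / kap by rewrite divr_gt0.
have [_ h] := dev_vs_chi2 v0.
rewrite devE// (le_trans _ (ler_wpM2l (ltW k0) (h _)))//.
  by rewrite le_eqVlt; apply/orP; left; apply/eqP; field; rewrite !gt_eqF.
by rewrite ler_pdivlMr// mul1r.
Qed.

(** Neyman's chi-square as a lower bound; it gives the domination of densities behind
    [stir_pcdf_left]. *)
Lemma dev_ge_neyman kap m : 0 < m -> m <= kap -> (kap - m) ^+ 2 / kap <= dev kap m.
Proof.
move=> m0 mk; have k0 := lt_le_trans m0 mk.
rewrite devE// (le_trans _ (ler_wpM2l (ltW k0) (dev_ge_sqr _ _)))//.
- by rewrite le_eqVlt; apply/orP; left; apply/eqP; field; rewrite !gt_eqF.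
- by rewrite divr_gt0.
- by rewrite ler_pdivrMr// mul1r.
Qed.

Lemma dev_gt0 kap m : 0 < kap -> 0 < m -> m != kap -> 0 < dev kap m.
Proof.
move=> k0 m0 mk; have d2 : 0 < (m - kap) ^+ 2.
  by rewrite exprn_even_gt0//= subr_eq0.
have [/ltW km|km] := ltP kap m.
  by apply: lt_le_trans (dev_ge_chi2 k0 km); rewrite divr_gt0.
apply: lt_le_trans (dev_ge_neyman m0 km); rewrite divr_gt0//.
by rewrite -sqrrN opprB.
Qed.

(** Unsigned: for [m > kap] the signed root is [- devs kap m]. It is not differentiable at
    [m = kap], hence the later split into right, centre and left. *)
Definition devs kap m : R := Num.sqrt (dev kap m).

Lemma devs_sqr kap m : 0 < kap -> 0 < m -> devs kap m ^+ 2 = dev kap m.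
Proof.
move=> k0 m0; rewrite sqr_sqrtr//.
have [->|mk] := eqVneq m kap; last exact/ltW/dev_gt0.
by rewrite /dev !subrr mulr0 add0r mulr0.
Qed.

Lemma devs_gt0 kap m : 0 < kap -> 0 < m -> m != kap -> 0 < devs kap m.
Proof. by move=> k0 m0 mk; rewrite sqrtr_gt0 dev_gt0. Qed.

Lemma der_devs kap m : 0 < kap -> 0 < m -> m != kap ->
  is_derive m 1 (devs kap) ((1 - kap / m) / devs kap m).
Proof.
move=> k0 m0 mk; rewrite /devs.
eapply der_eq; first by eapply der_sqrt; [exact: der_dev|exact: dev_gt0].
by rewrite -/(devs kap m); field; rewrite gt_eqF ?devs_gt0// gt_eqF.
Qed.

Lemma npdf_devs kap m : 0 < kap -> 0 < m ->
  npdf (devs kap m) = c0 * expR (- m + kap - kap * (ln kap - ln m)).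
Proof.
move=> k0 m0; rewrite npdfE devs_sqr// /dev; congr (_ * expR _).
by field.
Qed.

Lemma devs_le_chi kap m : 0 < m -> m <= kap -> devs kap m <= (kap - m) / Num.sqrt m.
Proof.
move=> m0 mk; have k0 := lt_le_trans m0 mk.
rewrite -ler_sqr ?nnegrE ?sqrtr_ge0 ?divr_ge0 ?subr_ge0 ?sqrtr_ge0//.
by rewrite devs_sqr// expr_div_n sqr_sqrtr ?(ltW m0)// dev_le_chi2.
Qed.

Lemma devs_ge_chi kap m : 0 < kap -> kap <= m -> (m - kap) / Num.sqrt m <= devs kap m.
Proof.
move=> k0 mk; have m0 := lt_le_trans k0 mk.
rewrite -ler_sqr ?nnegrE ?sqrtr_ge0 ?divr_ge0 ?subr_ge0 ?sqrtr_ge0//.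
by rewrite devs_sqr// expr_div_n sqr_sqrtr ?(ltW m0)// dev_ge_chi2.
Qed.

(** The exponential is [kap^(1/6) m^(1/3)]. The exponent 1/3 is the origin of the continuity
    correction 2/3: [m ppmf j m] contains [m^(j + 1) = m^(kap + 1/3)]. *)
Lemma devs_le_cube kap m : 0 < kap -> 0 < m ->
  devs kap m * expR (ln kap / 6 + ln m / 3) <= `|m - kap|.
Proof.
move=> k0 m0; set G := expR _.
rewrite -ler_sqr ?nnegrE ?mulr_ge0 ?sqrtr_ge0 ?expR_ge0//.
rewrite exprMn devs_sqr// real_normK ?num_real//.
pose v := expR ((ln m - ln kap) / 3).
have v0 : 0 < v by exact: expR_gt0.
have v3 : v ^+ 3 = m / kap.
  rewrite /v -expRM_natr divfK// expRB !lnK ?posrE//.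
have lv : ln v = (ln m - ln kap) / 3 by rewrite /v expRK.
have G2 : G ^+ 2 = kap * v ^+ 2.
  rewrite -[X in X * _](@lnK _ kap) ?posrE// /G /v -!expRM_natr -expRD.
  by congr expR; field.
have P0 : 0 <= kap ^+ 2 * v ^+ 2 by rewrite mulr_ge0 ?sqr_ge0.
have := ler_wpM2l P0 (dev_le_cube v0); rewrite v3 lv G2 => h.
apply: le_trans (le_trans _ h) _; rewrite le_eqVlt; apply/orP; left; apply/eqP.
  by rewrite /dev; field; rewrite gt_eqF.
by field; rewrite !gt_eqF.
Qed.

(** The constant for which [m ppmf j m] equals [devK j] times the density at [devs kap m] times
    [kap^(1/6) m^(1/3)], with [kap = j + 2/3]; it is close to 1 by Stirling's formula. *)
Definition devK j : R :=
  expR (- (j%:R + 2 / 3) + (j%:R + 1 / 2) * ln (j%:R + 2 / 3)) / (c0 * j`!%:R).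

Lemma devK_gt0 j : 0 < devK j.
Proof.
by rewrite /devK divr_gt0 ?expR_gt0 ?mulr_gt0 ?normal_peak1_gt0 ?factR_gt0.
Qed.

Lemma expRMln j m : 0 < m -> m ^+ j = expR (j%:R * ln m).
Proof. by move=> m0; rewrite expRM_natl lnK. Qed.

(* With [kap = j + 2/3], the density of [devK j * Phi (-+ devs kap m)] in [m]
   dominates [ppmf j m]. *)
Lemma ppmf_dom j m : let kap := j%:R + 2 / 3 in 0 < m -> m != kap ->
  ppmf j m <= devK j * npdf (devs kap m) * (`|m - kap| / (m * devs kap m)).
Proof.
move=> kap m0 mk; have k0 : 0 < kap by rewrite ltr_wpDl.
have s0 := devs_gt0 k0 m0 mk; have F0 := @factR_gt0 R j.
have c00 := @normal_peak1_gt0 R.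
have E : ppmf j m * m =
    devK j * npdf (devs kap m) * expR (ln kap / 6 + ln m / 3).
    rewrite npdf_devs// /devK -/kap ppmfE (expRMln _ m0).
  have -> : expR (- m) * expR (j%:R * ln m) / j`!%:R * m =
      expR (- m + j%:R * ln m + ln m) / j`!%:R.
    by rewrite !expRD lnK ?posrE//; field; rewrite gt_eqF.
  have -> : - m + j%:R * ln m + ln m =
      (- kap + (j%:R + 1 / 2) * ln kap) + (- m + kap - kap * (ln kap - ln m))
      + (ln kap / 6 + ln m / 3) by rewrite /kap; field.
  by rewrite (expRD (_ + _)) (expRD (- kap + _)); field; rewrite !gt_eqF.
rewrite -(ler_pM2r (mulr_gt0 m0 s0)).
have -> : devK j * npdf (devs kap m) * (`|m - kap| / (m * devs kap m))
    * (m * devs kap m) = devK j * npdf (devs kap m) * `|m - kap|.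
  by field; rewrite !gt_eqF.
have -> : ppmf j m * (m * devs kap m) = devK j * npdf (devs kap m) *
    (devs kap m * expR (ln kap / 6 + ln m / 3)) by rewrite mulrA E; ring.
apply: ler_wpM2l; last exact: devs_le_cube.
by rewrite mulr_ge0 ?(ltW (devK_gt0 j))// ltW// npdf_gt0.
Qed.

End deviance.

(** * Poisson distribution functions below Gaussian ones, and the Stirling ratio *)

Section poisson_normal_lower.
Context {R : realType}.
Implicit Types (m x y z s kap : R) (i j k : nat).

Local Notation c0 := (normal_peak (1 : R)).

(** By [ppmf_dom] the difference of the two sides does not increase with [m], and it cannot become
    negative in the limit because the Poisson term tends to 0. *)
Lemma pcdf_dev_right j m : let kap := j%:R + 2 / 3 in kap < m ->
  pcdf j.+1 m <= devK j * Phi (- devs kap m).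
Proof.
move=> kap km; have k0 : 0 < kap by rewrite ltr_wpDl.
have K0 := @devK_gt0 R j.
apply/ler_addgt0Pr => e e0; have [M0 hM] := pcdf_cvg0 j.+1 e0.
pose M := Num.max m M0.
have mM : m <= M by rewrite le_max lexx.
pose D x := devK j * Phi (- devs kap x) - pcdf j.+1 x.
pose dD x := devK j * (npdf (- devs kap x) * - ((1 - kap / x) / devs kap x))
  + ppmf j x.
have : D M <= D m.
  apply: (@nonincr_der R D dD m M mM) => x /andP[mx _].
    have [x0 xk] : 0 < x /\ x != kap by split; [|rewrite gt_eqF//]; lra.
    rewrite /D; eapply der_eq.
      eapply derD; last by eapply derN; exact: der_pcdf.
      eapply derM; first exact: der_cst.
      by eapply (der_comp (der_Phi _)); eapply derN; exact: der_devs.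
    by rewrite /dD; move: (npdf _) (ppmf _ _) (Phi _) => a b c; ring.
  have [x0 xk] : 0 < x /\ kap < x by lra.
  have := @ppmf_dom R j x x0 (negbT (gt_eqF xk)); rewrite -/kap.
  rewrite gtr0_norm ?subr_gt0// /dD npdfN.
  have s0 := devs_gt0 k0 x0 (negbT (gt_eqF xk)).
  have -> : (x - kap) / (x * devs kap x) = (1 - kap / x) / devs kap x.
    by field; rewrite !gt_eqF.
  by lra.
have := hM M ltac:(by rewrite le_max lexx orbT).
have := mulr_ge0 (ltW K0) (Phi_ge0 (- devs kap M)).
by rewrite /D; lra.
Qed.

Lemma pcdf_dev_center j : pcdf j.+1 (j%:R + 2 / 3) <= devK j * (1 / 2) :> R.
Proof.
set kap := (_ + _ : R); have k0 : 0 < kap by rewrite ltr_wpDl.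
apply/ler_addgt0Pr => e e0.
have := @pcdf_dev_right j (kap + e) ltac:(rewrite -/kap; lra).
have := @pcdf_lip R j.+1 kap (kap + e) ltac:(lra) ltac:(lra).
rewrite -/kap => h1 h2.
have : devK j * Phi (- devs kap (kap + e)) <= devK j * (1 / 2).
  rewrite ler_pM2l ?devK_gt0// -Phi0 Phi_nondecr// oppr_le0.
  exact: sqrtr_ge0.
by lra.
Qed.

Lemma pcdf_dev_left j m : let kap := j%:R + 2 / 3 in 0 < m -> m < kap ->
  pcdf j.+1 m <= devK j * Phi (devs kap m).
Proof.
move=> kap m0 km; have k0 : 0 < kap by rewrite ltr_wpDl.
have K0 := @devK_gt0 R j.
apply/ler_addgt0Pr => e e0.
pose M := Num.max m (kap - e / 2).
have mM : m <= M by rewrite le_max lexx.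
have Mk : M < kap by rewrite gt_max km/=; lra.
have Me : kap - e / 2 <= M by rewrite le_max lexx orbT.
pose D x := devK j * Phi (devs kap x) - pcdf j.+1 x.
pose dD x := devK j * (npdf (devs kap x) * ((1 - kap / x) / devs kap x))
  + ppmf j x.
have : D M <= D m.
  apply: (@nonincr_der R D dD m M mM) => x /andP[mx xM].
    have [x0 xk] : 0 < x /\ x != kap by split; [|rewrite lt_eqF//]; lra.
    rewrite /D; eapply der_eq.
      eapply derD; last by eapply derN; exact: der_pcdf.
      eapply derM; first exact: der_cst.
      by eapply (der_comp (der_Phi _)); exact: der_devs.
    by rewrite /dD; move: (npdf _) (ppmf _ _) (Phi _) => a b c; ring.
  have [x0 xk] : 0 < x /\ x < kap by lra.
  have := @ppmf_dom R j x x0 (negbT (lt_eqF xk)); rewrite -/kap.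
  rewrite ltr0_norm ?subr_lt0// /dD.
  have s0 := devs_gt0 k0 x0 (negbT (lt_eqF xk)).
  have -> : - (x - kap) / (x * devs kap x) = - ((1 - kap / x) / devs kap x).
    by field; rewrite !gt_eqF.
  by lra.
have := @pcdf_lip R j.+1 M kap ltac:(lra) ltac:(lra).
have := pcdf_dev_center j; rewrite -/kap.
have : devK j * (1 / 2) <= devK j * Phi (devs kap M).
  by rewrite ler_pM2l// -Phi0 Phi_nondecr// sqrtr_ge0.
by rewrite /D; lra.
Qed.

Lemma pcdf_dev j m : let kap := j%:R + 2 / 3 in 0 < m ->
  pcdf j.+1 m <= devK j * Phi ((kap - m) / Num.sqrt m).
Proof.
move=> kap m0; have k0 : 0 < kap by rewrite ltr_wpDl.
have K0 := @devK_gt0 R j.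
have [mk|km|->] := ltgtP m kap.
- apply: le_trans (pcdf_dev_left m0 mk) _.
  by rewrite ler_pM2l// Phi_nondecr// devs_le_chi// ltW.
- apply: le_trans (pcdf_dev_right km) _.
  rewrite ler_pM2l// Phi_nondecr// -lerN2 opprK -mulNr opprB.
  by rewrite devs_ge_chi// ltW.
- by rewrite subrr mul0r Phi0; exact: pcdf_dev_center.
Qed.

(** The Stirling ratio [k! / (sqrt (2 pi k) (k / e)^k)], written with [(k - 1)!] to match
    [ppmf k.-1]. *)
Definition stir k : R := c0 * k.-1`!%:R * expR (k%:R + (1 / 2 - k%:R) * ln k%:R).

Lemma stir_gt0 k : 0 < stir k.
Proof.
by rewrite /stir mulr_gt0 ?expR_gt0// mulr_gt0 ?normal_peak1_gt0 ?factR_gt0.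
Qed.

(* The density of [1 - Phi (devs k m)] in [m] is dominated by
   [stir k * ppmf k.-1 m] on [0, k]. *)
Lemma stir_pcdf_left j m : 0 < m -> m < j.+1%:R ->
  1 - Phi (devs j.+1%:R m) <= stir j.+1 * (1 - pcdf j.+1 m).
Proof.
set k : R := _%:R => m0 mk; have k0 : 0 < k by rewrite ltr0n.
have S0 := stir_gt0 j.+1.
apply/ler_addgt0Pr => e e0; have [M0 hM] := @Phi_cvg1 R _ e0.
(* For positive [x], [dev k x >= 2 k (ln k - ln x - 1)], and the right-hand side equals [M0^2] at
   [x = y]. *)
pose y : R := expR (ln k - (1 + M0 ^+ 2 / (2 * k))).
have y0 : 0 < y by exact: expR_gt0.
pose x1 := Num.min m y.
have x1m : x1 <= m by rewrite ge_min lexx.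
have x10 : 0 < x1 by rewrite lt_min m0.
have M0x1 : M0 <= devs k x1.
  have : M0 ^+ 2 <= dev k x1.
    have : ln x1 <= ln y by rewrite ler_ln ?posrE// ge_min lexx orbT.
    rewrite /y expRK => /(ler_wpM2l (ltW k0)) h.
    have : k * (ln k - (1 + M0 ^+ 2 / (2 * k))) = k * ln k - k - M0 ^+ 2 / 2.
      by field; rewrite gt_eqF.
    move=> E; rewrite E in h; rewrite /dev; move: (ln x1) (ln k) h x10 => u v.
    by rewrite mulrBr; lra.
  rewrite -devs_sqr// => h; have [M00|M00] := leP M0 0.
    exact: le_trans M00 (sqrtr_ge0 _).
  by rewrite -ler_sqr// nnegrE; [exact: ltW|exact: sqrtr_ge0].
pose D x := stir j.+1 * (1 - pcdf j.+1 x) - (1 - Phi (devs k x)).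
pose dD x := stir j.+1 * ppmf j x + npdf (devs k x) * ((1 - k / x) / devs k x).
have : D x1 <= D m.
  apply: (@nondecr_der R D dD x1 m x1m) => x /andP[x1x xm].
    have [x0 xk] : 0 < x /\ x != k by split; [|rewrite lt_eqF//]; lra.
    rewrite /D; eapply der_eq.
      eapply derD.
        eapply derM; first exact: der_cst.
        eapply derD; first exact: der_cst.
        by eapply derN; exact: der_pcdf.
      eapply derN; eapply derD; first exact: der_cst.
      by eapply derN; eapply (der_comp (der_Phi _)); exact: der_devs.
    by rewrite /dD; move: (npdf _) (ppmf _ _) (pcdf _ _) => a b c; ring.
  have [x0 xk] : 0 < x /\ x < k by lra.
  have s0 := devs_gt0 k0 x0 (negbT (lt_eqF xk)).
  have r0 : 0 < expR (ln k / 2) by exact: expR_gt0.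
  have r2 : expR (ln k / 2) ^+ 2 = k.
    by rewrite -expRM_natr divfK// lnK ?posrE.
  have rE : stir j.+1 * ppmf j x = npdf (devs k x) * (expR (ln k / 2) / x).
    rewrite /stir ppmfE npdf_devs// (expRMln _ x0) -/k /=.
    have E : expR (k + (1 / 2 - k) * ln k) * (expR (- x) * expR (j%:R * ln x) * x)
        = expR (- x + k - k * (ln k - ln x)) * expR (ln k / 2).
      rewrite -[X in _ * (_ * _ * X)](@lnK _ x) ?posrE// -!expRD; congr expR.
      have -> : j%:R = k - 1 :> R by rewrite /k -addn1 natrD addrK.
      by field.
    transitivity (c0 * (expR (- x + k - k * (ln k - ln x)) * expR (ln k / 2)) / x).
      by rewrite -E; field; rewrite !gt_eqF ?factR_gt0.
    by field; rewrite gt_eqF.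
  rewrite /dD rE -mulrDr mulr_ge0 ?(ltW (npdf_gt0 _))//.
  have -> : expR (ln k / 2) / x + (1 - k / x) / devs k x =
      (expR (ln k / 2) * devs k x - (k - x)) / (x * devs k x).
    by field; rewrite !gt_eqF.
  rewrite divr_ge0 ?mulr_ge0 ?(ltW x0) ?(ltW s0)// subr_ge0.
  rewrite -ler_sqr ?nnegrE ?mulr_ge0 ?(ltW r0) ?(ltW s0)//; last by lra.
  rewrite exprMn r2 devs_sqr// mulrC -ler_pdivrMr//.
  by rewrite dev_ge_neyman// ltW.
have := hM _ M0x1.
have := mulr_ge0 (ltW S0) (_ : 0 <= 1 - pcdf j.+1 x1).
rewrite subr_ge0 pcdf_le1 ?(ltW x10)// => /(_ isT).
rewrite /D; move: (stir _ * _) (stir _ * _) => a b; lra.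
Qed.

Lemma stir_pcdf j : 1 / 2 <= stir j.+1 * (1 - pcdf j.+1 j.+1%:R).
Proof.
have S0 := stir_gt0 j.+1.
have k1 : 1 <= j.+1%:R :> R by rewrite ler1n.
apply/ler_addgt0Pr => e e0; set k : R := _%:R in k1 *.
pose d := Num.min e (1 / 2).
have d0 : 0 < d by rewrite lt_min e0; lra.
have dh : d <= 1 / 2 by rewrite ge_min lexx orbT.
have de : d <= e by rewrite ge_min lexx.
have h1 := @stir_pcdf_left j (k - d) ltac:(lra) ltac:(rewrite -/k; lra).
have h2 := @pcdf_nonincr R j.+1 (k - d) k ltac:(lra) ltac:(lra).
have h3 : stir j.+1 * (1 - pcdf j.+1 (k - d)) <= stir j.+1 * (1 - pcdf j.+1 k).
  by rewrite ler_pM2l//; lra.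
have h4 := Phi_lip (sqrtr_ge0 (dev k (k - d))).
have h5 := @devs_le_chi R k (k - d) ltac:(lra) ltac:(lra).
have h6 : (k - (k - d)) / Num.sqrt (k - d) <= d * 2.
  have -> : k - (k - d) = d by ring.
  rewrite ler_pM2l// -[X in X <= _]div1r ler_pdivrMr ?sqrtr_gt0; last by lra.
  rewrite -ler_pdivrMl// mulr1 -[X in X <= _]ger0_norm ?invr_ge0//.
  by rewrite -sqrtr_sqr ler_wsqrtr//; lra.
move: h4 h1; rewrite Phi0 subr0 -/(devs k (k - d)) -/k => h4 h1.
have h7 := le_trans h1 h3; have h8 := le_trans h5 h6.
by move: (stir _ * _) h7 => c h7; lra.
Qed.

(** P(Poi(k) >= k) is at most [1/2 + 0.4 / sqrt k] by the square-root bound, while its product with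
    the Stirling ratio is at least 1/2. This identifies the constant sqrt (2 pi) of Stirling's
    formula from the Poisson law alone. *)
Lemma stir_lower_weak j : 1 - 1 / Num.sqrt j.+1%:R <= stir j.+1 :> R.
Proof.
have S0 := stir_gt0 j.+1; have h := stir_pcdf j.
have k1 : 1 <= j.+1%:R :> R by rewrite ler1n.
move: h (@sqrt_lower_bound R j (Num.sqrt j.+1%:R) (sqrtr_ge0 _)).
rewrite sqr_sqrtr; last by lra.
set k : R := j.+1%:R in k1 *.
set t := Num.sqrt k; set r := Num.sqrt _ => h1 h2.
have t1 : 1 <= t by rewrite /t -sqrtr1 ler_wsqrtr.
have t2 : t ^+ 2 = k by rewrite sqr_sqrtr//; lra.
have r0 : 0 <= r by exact: sqrtr_ge0.
have r2 : r ^+ 2 = k - 1 / 2.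
  have kE : k = j%:R + 1 by rewrite natr1.
  rewrite sqr_sqrtr; first by rewrite kE; lra.
  by rewrite addr_ge0.
have tr : t - r <= 1 / 2 / t.
  by rewrite ler_pdivlMr; nra.
have rt : r <= t by nra.
have := @Phi_lip R (2 * r - 2 * t) 0 ltac:(lra); rewrite Phi0 => h3.
have h4 : 1 - pcdf j.+1 k <= 1 / 2 + 4 / 10 / t.
  have : 8 / 10 * (t - r) <= 8 / 10 * (1 / 2 / t) by rewrite ler_pM2l//; lra.
  have -> : 8 / 10 * (1 / 2 / t) = 4 / 10 / t by field; rewrite gt_eqF//; lra.
  by lra.
have h5 : 1 / 2 <= stir j.+1 * (1 / 2 + 4 / 10 / t).
  by rewrite (le_trans h1)// ler_pM2l.
rewrite leNgt; apply/negP => S1.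
have ti0 : 0 < t^-1 by rewrite invr_gt0; lra.
have ti1 : t^-1 <= 1 by rewrite invf_le1//; lra.
have h6 : stir j.+1 * (1 / 2 + 4 / 10 / t) < (1 - 1 / t) * (1 / 2 + 4 / 10 / t).
  by rewrite ltr_pM2r//; lra.
by move: h5 h6; rewrite div1r; move: (stir _) (t^-1) ti0 ti1 => a b; nra.
Qed.

End poisson_normal_lower.

(** * Stirling's formula with Robbins' lower bound, and the lower Poisson comparison *)

Section stirling.
Context {R : realType}.
Implicit Types (m x y z s kap : R) (i j k : nat).

Local Notation c0 := (normal_peak (1 : R)).

Lemma stirS j : let k : R := j.+1%:R in
  stir j.+2 = stir j.+1 * expR (1 - (k + 1 / 2) * ln (1 + k^-1)).
Proof.
move=> k; have k0 : 0 < k by rewrite ltr0n.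
rewrite (_ : 1 + k^-1 = (k + 1) / k); last by field; rewrite gt_eqF.
rewrite ln_div ?posrE; [|lra|lra].
have kE : j.+2%:R = k + 1 by rewrite natr1.
rewrite /stir /= kE -/k factS natrM -/k.
have -> : k + 1 + (1 / 2 - (k + 1)) * ln (k + 1) =
    k + (1 / 2 - k) * ln k + (1 - (k + 1 / 2) * (ln (k + 1) - ln k)) - ln k.
  by field.
rewrite 2!expRD (expRN (ln k)) lnK ?posrE//.
by field; rewrite gt_eqF.
Qed.

(** The Stirling ratio at [j + 1] divided by Robbins' lower bound for it. It decreases in [j], and
    [stir_lower_weak] keeps its limit at 1 or above. *)
Definition robbins j : R := stir j.+1 * expR (- (12 * j.+1%:R + 1)^-1).

Lemma robbinsS j : robbins j.+1 <= robbins j.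
Proof.
rewrite /robbins stirS -mulrA -expRD ler_pM2l ?stir_gt0// ler_expR.
have -> : j.+2%:R = j.+1%:R + 1 :> R by rewrite natr1.
set k : R := j.+1%:R; have k1 : 1 <= k by rewrite ler1n.
have := ler_wpM2l (_ : 0 <= k + 1 / 2) (ln1p_inv_ge k1).
move=> /(_ ltac:(lra)).
have -> : (k + 1 / 2) * (2 / (2 * k + 1) + 2 / (3 * (2 * k + 1) ^+ 3)) =
    1 + (3 * (2 * k + 1) ^+ 2)^-1.
  by field; rewrite gt_eqF//; lra.
have : (12 * k + 1)^-1 - (12 * (k + 1) + 1)^-1 <= (3 * (2 * k + 1) ^+ 2)^-1.
  have -> : (12 * k + 1)^-1 - (12 * (k + 1) + 1)^-1 =
      ((12 * k + 1) * (12 * k + 13) / 12)^-1.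
    by field; rewrite ?gt_eqF//; lra.
  by rewrite lef_pV2 ?posrE; nra.
by move: (_^-1) (_^-1) (_^-1) => a b c; lra.
Qed.

Lemma robbins_nonincr i j : (i <= j)%N -> robbins j <= robbins i.
Proof.
elim: j => [|j IHj]; first by rewrite leqn0 => /eqP ->.
rewrite leq_eqVlt => /predU1P[->//|]; rewrite ltnS => /IHj.
exact: le_trans (robbinsS j).
Qed.

Lemma stir_ge j : expR (12 * j.+1%:R + 1)^-1 <= stir j.+1 :> R.
Proof.
suff : 1 <= robbins j.
  by rewrite /robbins expRN ler_pdivlMr ?expR_gt0// mul1r.
apply/ler_addgt0Pr => e e0.
(* So large that [(1 - 1 / sqrt k)^2 >= 1 - e] at [k = i + 1]: one factor bounds the ratio, the
   other the exponential. *)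
pose i := maxn j (Num.truncn (4 / e ^+ 2)).
have ji : (j <= i)%N by rewrite leq_maxl.
have ie : 4 / e ^+ 2 <= i.+1%:R.
  have := @truncnS_gt R (4 / e ^+ 2).
  move=> /ltW /le_trans; apply; rewrite ler_nat ltnS leq_maxr//.
have := robbins_nonincr ji; have := @stir_lower_weak R i; rewrite {1}/robbins.
have k1 : 1 <= i.+1%:R :> R by rewrite ler1n.
set k : R := i.+1%:R in ie k1 *; set t := Num.sqrt k => h1 h2.
have t1 : 1 <= t by rewrite /t -sqrtr1 ler_wsqrtr.
have t2 : t ^+ 2 = k by rewrite sqr_sqrtr//; lra.
have te : 2 / t <= e.
  rewrite ler_pdivrMr; last by lra.
  rewrite -ler_sqr ?nnegrE ?mulr_ge0//; [|lra|lra].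
  by rewrite exprMn t2; move: ie; rewrite ler_pdivrMr ?exprn_gt0//; lra.
have h3 : 1 - 1 / t <= expR (- (12 * k + 1)^-1).
  apply: le_trans (expR_ge1Dx _); rewrite lerD2l lerN2 div1r.
  by rewrite lef_pV2 ?posrE; nra.
have ti1 : t^-1 <= 1 by rewrite invf_le1//; lra.
have h4 : (1 - 1 / t) * (1 - 1 / t) <= stir i.+1 * expR (- (12 * k + 1)^-1).
  have p0 : 0 <= 1 - 1 / t by rewrite div1r; lra.
  exact: ler_pM.
have ti0 : 0 < t^-1 by rewrite invr_gt0; lra.
move: h4 te; rewrite div1r => h4 te; nra.
Qed.

Lemma ln1B_le x : 0 <= x < 1 ->
  ln (1 - x) <= - (x + x ^+ 2 / 2 + x ^+ 3 / 3 + x ^+ 4 / 4).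
Proof.
move=> /andP[x0 x1]; rewrite -subr_ge0.
pose f y : R := - (y + y ^+ 2 / 2 + y ^+ 3 / 3 + y ^+ 4 / 4) - ln (1 - y).
have f0 : f 0 = 0 by rewrite /f !expr0n/= !mul0r !addr0 subr0 ln1 oppr0 addr0.
rewrite -[X in X <= _]f0 -/(f x).
apply: (@nondecr_der R f (fun y => y ^+ 4 / (1 - y)) 0 x x0).
  move=> y /andP[y0 yx]; have ? : 0 < 1 - y by lra.
  by rewrite /f; der => //=; rewrite ?expr1; field; rewrite gt_eqF.
by move=> y /andP[y0 yx]; rewrite divr_ge0 ?exprn_ge0 ?(ltW y0)//; lra.
Qed.

(** The exponent of [devK j] at [k = j + 1], where [kap / k = 1 - 1 / (3 k)], after Robbins' bound;
    the constant terms cancel. *)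
Lemma devK_exponent_le (k : R) : 1 <= k ->
  1 / 3 + (k - 1 / 2) * ln (1 - (3 * k)^-1) - (12 * k + 1)^-1
  <= 163 / 1000 * (3 * k)^-1.
Proof.
move=> k1; set t := (3 * k)^-1.
have t0 : 0 < t by rewrite invr_gt0; lra.
have t3 : t <= 1 / 3 by rewrite /t -[X in X <= _]div1r ler_pdivrMr; lra.
have ktE : k = (3 * t)^-1 by rewrite /t; field; rewrite gt_eqF//; lra.
have k2 : 0 <= k - 1 / 2 by lra.
have tl : 0 <= t < 1 by lra.
have := ler_wpM2l k2 (ln1B_le tl).
have -> : (k - 1 / 2) * - (t + t ^+ 2 / 2 + t ^+ 3 / 3 + t ^+ 4 / 4) =
  - (1 / 3) + t / 3 + 5 / 36 * t ^+ 2 + t ^+ 3 / 12 + t ^+ 4 / 8.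
  by rewrite ktE; field; rewrite gt_eqF.
have -> : (12 * k + 1)^-1 = t / (4 + t).
  by rewrite ktE; field; rewrite !gt_eqF//; lra.
move: (_ * ln _) => u; clearbody t; clear - t0 t3.
have h1 : 3 / 13 * t <= t / (4 + t) by rewrite ler_pdivlMr; nra.
have h2 : t ^+ 2 <= t / 3 by nra.
have h3 : t ^+ 3 <= t / 9 by nra.
have h4 : t ^+ 4 <= t / 27.
  have -> : t ^+ 4 = t ^+ 3 * t by ring.
  by have : 0 <= t ^+ 3 by [rewrite exprn_ge0// ltW]; nra.
by move: (t / _) h1 => a h1; lra.
Qed.

Lemma expR_le_quadratic_inv (x : R) : 0 <= x < 2 ->
  expR x <= ((1 - x / 2) ^+ 2)^-1.
Proof.
move=> x02; have p0 : 0 < 1 - x / 2 by lra.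
have -> : expR x = (expR (- (x / 2))) ^- 2.
  by rewrite expRN exprVn invrK -expRM_natr divfK.
rewrite lef_pV2 ?posrE ?exprn_gt0 ?expR_gt0//.
rewrite ler_sqr ?nnegrE ?expR_ge0 ?(ltW p0)//.
exact: expR_ge1Dx.
Qed.

(** The constant 5/108 is what 0.313 leaves once [kap] has been replaced by [j]: 0.4 · 2/3 + 5/108
    <= 0.313. *)
Lemma devK_le j :
  devK j <= 1 + 5 / 108 / Num.sqrt (j%:R + 2 / 3 : R).
Proof.
set kap : R := j%:R + 2 / 3; pose k : R := j%:R + 1.
have k0 : 2 / 3 <= kap by rewrite /kap lerDr.
have kE : j.+1%:R = k :> R by rewrite /k natr1.
have k1 : 1 <= k by rewrite /k lerDr.
have c00 := @normal_peak1_gt0 R.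
have KS : devK j * stir j.+1 = expR (1 / 3 + (k - 1 / 2) * ln (1 - (3 * k)^-1)).
  rewrite /devK /stir /= kE -/kap.
  have -> : 1 - (3 * k)^-1 = kap / k.
    by rewrite /kap /k; field; rewrite gt_eqF// ltr_wpDl.
  rewrite ln_div ?posrE; [|lra|lra].
  transitivity (expR (- kap + (j%:R + 1 / 2) * ln kap) *
                expR (k + (1 / 2 - k) * ln k)).
    by field; rewrite !gt_eqF ?factR_gt0.
  by rewrite -expRD; congr expR; rewrite /kap /k; field.
have KL : devK j <= expR (163 / 1000 * (3 * k)^-1).
  rewrite -(ler_pM2r (@stir_gt0 R j.+1)) KS.
  apply: le_trans (ler_wpM2l (expR_ge0 _) (stir_ge j)).
  rewrite -expRD ler_expR kE.
  by have := devK_exponent_le k1; lra.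
have kk : 3 * k = 3 * kap + 1 by rewrite /k /kap; field.
clearbody k; clear kE KS c00.
apply: le_trans KL _; rewrite kk; set y := Num.sqrt kap.
have y2 : y ^+ 2 = kap by rewrite sqr_sqrtr//; lra.
have y0 : 0 <= y by exact: sqrtr_ge0.
clearbody y; clearbody kap; rewrite -y2 in k0 *; clear - k0 y0.
have y1 : 40 / 49 <= y by nra.
have tE : (3 * y ^+ 2 + 1) * (3 * y ^+ 2 + 1)^-1 = 1.
  by rewrite divff// gt_eqF//; lra.
have t0 : 0 < (3 * y ^+ 2 + 1)^-1 by rewrite invr_gt0; lra.
move: (_^-1) tE t0 => t tE t0.
have t3 : t <= 1 / 3 by nra.
have t2 : 0 <= 163 / 1000 * t < 2 by lra.
apply: le_trans (expR_le_quadratic_inv t2) _.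
apply: (@le_trans _ _ (1 + 17 / 100 * t)).
  have p0 : 0 < (1 - 163 / 1000 * t / 2) ^+ 2 by apply: exprn_gt0; lra.
  rewrite -[X in X <= _]div1r ler_pdivrMr//; clear - t0 t3.
  have h1 : 0 <= (1 / 3 - t) * (13 / 625 - t / 1000).
    by rewrite mulr_ge0; lra.
  have := mulr_ge0 (ltW t0) h1; have := exprn_ge0 2 (ltW t0).
  have := exprn_ge0 3 (ltW t0); lra.
rewrite lerD2l ler_pdivlMr; last by lra.
by nra.
Qed.

(** With [y^2 = kap] and [s^2 = m], this turns the relative error of order [1 / sqrt kap] in [devK]
    into an absolute one of order [1 / sqrt m]: when [m] is well above [kap], [Phi] is small enough.
    The number 40/49 lies just below sqrt (2/3), the least value of [sqrt kap]. *)
Lemma mul_Phi_le (y s : R) : 40 / 49 <= y -> 0 < s ->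
  s * Phi ((y ^+ 2 - s ^+ 2) / s) <= y.
Proof.
move=> y1 s0; set z := _ / s.
have zs : z * s = y ^+ 2 - s ^+ 2 by rewrite divfK// gt_eqF.
clearbody z.
have [sy|ys] := leP s y.
  by apply: (@le_trans _ _ s) => //; rewrite ler_piMr ?Phi_le1// ltW.
have z0 : z <= 0 by nra.
have [s2|s2] := leP s (2 * y).
  have : Phi z <= 1 / 2 by rewrite -Phi0 Phi_nondecr.
  by have := Phi_ge0 z; move: (Phi z) => u; nra.
have z1 : 3 / 4 * s <= - z by nra.
have nz0 : 0 <= - z by lra.
have := gaussian_tail nz0; rewrite PhiN opprB addrC subrK => hP.
apply: le_trans y1.
have p0 : 0 < 2 + 11 / 10 * (3 / 4 * s) ^+ 2 by nra.
have : Phi z <= (2 + 11 / 10 * (3 / 4 * s) ^+ 2)^-1.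
  apply: le_trans hP _; rewrite lef_pV2 ?posrE//; nra.
move=> /(ler_wpM2l (ltW s0)) /le_trans; apply.
by rewrite ler_pdivrMr//; nra.
Qed.

Lemma poisson_normal_lower j m : 0 < m ->
  pcdf j.+1 m <= Phi ((j%:R - m) / Num.sqrt m) + 313 / 1000 / Num.sqrt m.
Proof.
move=> m0; apply: le_trans (pcdf_dev j m0) _; set kap : R := j%:R + 2 / 3.
have k0 : 2 / 3 <= kap by rewrite /kap lerDr.
have := devK_le j; rewrite -/kap.
have s0 : 0 < Num.sqrt m by rewrite sqrtr_gt0.
have s2 : Num.sqrt m ^+ 2 = m by rewrite sqr_sqrtr// ltW.
have y0 : 0 <= Num.sqrt kap by exact: sqrtr_ge0.
have y2 : Num.sqrt kap ^+ 2 = kap by rewrite sqr_sqrtr//; lra.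
move: (Num.sqrt m) s0 s2 => s s0 <-; move: (Num.sqrt kap) y0 y2 => y y0 y2 hK.
have y1 : 40 / 49 <= y by move: k0; rewrite -y2; clear - y0; nra.
set z := (kap - s ^+ 2) / s.
have h1 : s * Phi z <= y by rewrite /z -y2; exact: mul_Phi_le.
have P0 := Phi_ge0 z.
have h2 : devK j * Phi z <= Phi z + 5 / 108 / s.
  have := ler_wpM2r P0 hK; rewrite mulrDl mul1r => /le_trans; apply.
  rewrite lerD2l ler_pdivlMr//.
  have -> : 5 / 108 / y * Phi z * s = 5 / 108 * (s * Phi z / y) by ring.
  have : s * Phi z / y <= 1 by rewrite ler_pdivrMr ?mul1r//; lra.
  by move: (_ / y) => u; lra.
have zE : z = (j%:R - s ^+ 2) / s + 2 / 3 / s.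
  by rewrite /z /kap; field; rewrite gt_eqF.
have si0 : 0 < s^-1 by rewrite invr_gt0.
have zle : (j%:R - s ^+ 2) / s <= z by rewrite zE lerDl mulr_ge0// ltW.
have zB : z - (j%:R - s ^+ 2) / s = 2 / 3 / s by rewrite zE; ring.
have := Phi_lip zle; rewrite zB.
by move: h2; move: (Phi _) (Phi _) (_ * Phi _) => a b c; clear - si0; lra.
Qed.

End stirling.

(** * Variance-stabilised against standardised Gaussian arguments *)

Section poisson_normal_upper.
Context {R : realType}.
Implicit Types (m x y z s r : R) (i j k : nat).

Lemma Phi_diff_le x y (M : R) : x <= y -> (forall z, x <= z <= y -> npdf z <= M) ->
  Phi y - Phi x <= M * (y - x).
Proof.
move=> xy hM.
have h := @nondecr_der R (fun z => M * z - Phi z) (fun z => M - npdf z) x y xy.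
have {h} : M * x - Phi x <= M * y - Phi y; last by lra.
apply: h => z; last by move=> /andP[xz zy]; rewrite subr_ge0 hM// !ltW.
by move=> _; der; rewrite /=; ring.
Qed.

Lemma npdf_le_expR z y : y ^+ 2 <= z ^+ 2 -> npdf z <= 4 / 10 * expR (- y ^+ 2 / 2).
Proof.
move=> yz; rewrite npdfE; apply: ler_pM; rewrite ?expR_ge0//.
- exact/ltW/normal_peak1_gt0.
- exact: normal_peak1_le.
- by rewrite ler_expR; lra.
Qed.

Let expR_inv_cube (y : R) : expR (- y ^+ 2 / 2) <= ((1 + y ^+ 2 / 6) ^+ 3)^-1.
Proof.
have -> : - y ^+ 2 / 2 = - (y ^+ 2 / 6 * 3%:R) by field.
have y20 : 0 <= y ^+ 2 by exact: sqr_ge0.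
have p0 : 0 < 1 + y ^+ 2 / 6 by lra.
rewrite expRN expRM_natr lef_pV2 ?posrE ?exprn_gt0 ?expR_gt0//.
by rewrite lerXn2r ?nnegrE ?expR_ge0 ?(ltW p0)// expR_ge1Dx.
Qed.

Let cube_tangent (v a : R) : 0 <= v -> 0 <= a ->
  3 * a ^+ 2 * v - 2 * a ^+ 3 <= v ^+ 3.
Proof.
move=> v0 a0; rewrite -subr_ge0.
have -> : v ^+ 3 - (3 * a ^+ 2 * v - 2 * a ^+ 3) = (v - a) ^+ 2 * (v + 2 * a).
  by ring.
by rewrite mulr_ge0 ?sqr_ge0//; lra.
Qed.

(** On each range of [D] the cube is replaced by its tangent at a point [a] near the values of [v]
    there, which leaves an inequality quadratic in [D]. *)
Let sextic_ge0 (D : R) : 167 / 100 <= D ->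
  4 / 10 * (D ^+ 2 - 12 / 5 * D + 97 / 50) <=
  29 / 100 * (2 / 3 + 13 / 102 * D ^+ 2) ^+ 3.
Proof.
move=> D1; set v := 2 / 3 + _; set L := D ^+ 2 - _ + _.
have v0 : 0 <= v by rewrite /v; have := sqr_ge0 D; lra.
have vE : v = 2 / 3 + 13 / 102 * D ^+ 2 by [].
have LE : L = D ^+ 2 - 12 / 5 * D + 97 / 50 by [].
clearbody v L.
have h (a : R) : 0 <= a ->
    4 / 10 * L <= 29 / 100 * (3 * a ^+ 2 * v - 2 * a ^+ 3) ->
    4 / 10 * L <= 29 / 100 * v ^+ 3.
  move=> a0 /le_trans; apply.
  by rewrite ler_pM2l; [exact: cube_tangent|lra].
have seg (l u : R) : l <= D -> D <= u -> 0 <= (D - l) * (u - D).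
  by move=> lD Du; rewrite mulr_ge0 ?subr_ge0.
have [D2|/ltW D2] := leP D 2.
  have hs := seg _ _ D1 D2; apply: (h (11 / 10)); first lra.
  by rewrite vE LE; clear - hs D1 D2; lra.
have [D3|/ltW D3] := leP D (12 / 5).
  have hs := seg _ _ D2 D3; apply: (h (127 / 100)); first lra.
  by rewrite vE LE; clear - hs D2 D3; lra.
have [D4|/ltW D4] := leP D 3.
  have hs := seg _ _ D3 D4; apply: (h (145 / 100)); first lra.
  by rewrite vE LE; clear - hs D3 D4; lra.
have hs := sqr_ge0 (D - 3); apply: (h 2) => //.
by rewrite vE LE; clear - hs D4; lra.
Qed.

Let bound_neg (z E : R) : 0 <= E -> E <= ((1 + z ^+ 2 / 6) ^+ 3)^-1 ->
  4 / 10 * E * (z ^+ 2 / 4 + 1 / 2) <= 29 / 100.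
Proof.
have := sqr_ge0 z; move: (z ^+ 2) => t t0 E0 hE.
have p0 : 0 < (1 + t / 6) ^+ 3 by apply: exprn_gt0; lra.
have h : E * (1 + t / 2) <= 1.
  move: hE; rewrite -[X in _ <= X]div1r ler_pdivlMr//; apply: le_trans.
  apply: ler_wpM2l => //; rewrite -subr_ge0.
  have -> : (1 + t / 6) ^+ 3 - (1 + t / 2) = t ^+ 2 / 12 + t ^+ 3 / 216 by field.
  by rewrite addr_ge0 ?divr_ge0 ?exprn_ge0.
have -> : 4 / 10 * E * (t / 4 + 1 / 2) = 2 / 10 * (E * (1 + t / 2)) by field.
by clear - h; lra.
Qed.

(** With [E = D^2], the square of [y] is the convex function [(E - 1.94)^2 / E]; the line used is
    nearly its tangent at [E = 4]. *)
Let y0_sqr (D y : R) : 167 / 100 <= D -> y * D = D ^+ 2 - 97 / 50 ->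
  2 / 3 + 13 / 102 * D ^+ 2 <= 1 + y ^+ 2 / 6.
Proof.
move=> D1 yD; have D2 : 2 <= D ^+ 2 by nra.
have D20 : 0 < D ^+ 2 by lra.
have h : y ^+ 2 * D ^+ 2 = (D ^+ 2 - 97 / 50) ^+ 2 by rewrite -yD; ring.
suff : 13 / 17 * D ^+ 2 - 2 <= y ^+ 2 by lra.
rewrite -(ler_pM2r D20) h; clear h.
by move: (D ^+ 2) D2 => E E2; have := sqr_ge0 (E - 4); lra.
Qed.

Let bound_pos (D y E : R) : 167 / 100 <= D -> y * D = D ^+ 2 - 97 / 50 ->
  0 <= E -> E <= ((1 + y ^+ 2 / 6) ^+ 3)^-1 ->
  4 / 10 * E * (D ^+ 2 - 12 / 5 * D + 97 / 50) <= 29 / 100.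
Proof.
move=> D1 yD E0 hE; have h1 := y0_sqr D1 yD; have h2 := sextic_ge0 D1.
have v0 : 0 < 2 / 3 + 13 / 102 * D ^+ 2 by have := sqr_ge0 D; lra.
have h3 : (2 / 3 + 13 / 102 * D ^+ 2) ^+ 3 <= (1 + y ^+ 2 / 6) ^+ 3.
  by rewrite lerXn2r ?nnegrE ?(ltW v0)// (le_trans _ h1)// ltW.
have {v0}V0 : 0 < (2 / 3 + 13 / 102 * D ^+ 2) ^+ 3 by exact: exprn_gt0.
move: ((2 / 3 + _) ^+ 3) ((1 + _) ^+ 3) (_ + 97 / 50) V0 h3 h2 hE => V W L V0 VW LV EW.
have W0 := lt_le_trans V0 VW.
have EV : E * V <= 1.
  apply: (@le_trans _ _ (E * W)); first exact: ler_wpM2l.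
  by rewrite -ler_pdivlMr// div1r.
have := ler_wpM2l E0 LV; clear - EV; lra.
Qed.

(* [Phi] at the variance-stabilised point [2 (s - r)] against [Phi] at the
   standardised point, [m = s ^+ 2] and [r ^+ 2 = k - 1 / 2]. *)
Lemma Phi_sqrt_standardised s r : 6 / 5 <= r -> 0 < s ->
  Phi (2 * s - 2 * r) <= Phi ((s ^+ 2 - (r ^+ 2 + 1 / 2)) / s) + 29 / 100 / s.
Proof.
move=> r1 s0; set z := 2 * s - 2 * r; set y := (s ^+ 2 - _) / s.
have ys : y * s = s ^+ 2 - (r ^+ 2 + 1 / 2) by rewrite divfK// gt_eqF.
have dE : (z - y) * s = z ^+ 2 / 4 + 1 / 2 by rewrite mulrBl ys /z; field.
have rE : s = r + z / 2 by rewrite /z; field.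
clearbody z y.
have w0 : 0 <= z ^+ 2 / 4 + 1 / 2 by rewrite addr_ge0 ?divr_ge0 ?sqr_ge0.
have yz : y <= z by rewrite -subr_ge0 -(pmulr_lge0 _ s0) dE.
(* By [dE] the claim reduces to bounding [z^2 / 4 + 1 / 2] times the largest density between [y] and
   [z]. *)
have bound M : (forall x, y <= x <= z -> npdf x <= M) ->
    M * (z ^+ 2 / 4 + 1 / 2) <= 29 / 100 -> Phi z <= Phi y + 29 / 100 / s.
  move=> hM; rewrite -dE mulrA -ler_pdivlMr// => h.
  by have := Phi_diff_le yz hM; lra.
have [z0|z0] := leP z 0.
  apply: (bound (4 / 10 * expR (- z ^+ 2 / 2))).
    move=> x /andP[_ xz]; apply: npdf_le_expR; rewrite -subr_ge0.
    have -> : x ^+ 2 - z ^+ 2 = (z - x) * - (z + x) by ring.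
    by rewrite mulr_ge0//; lra.
  exact: bound_neg (expR_ge0 _) (expR_inv_cube z).
(* Close to the largest [z] for which the global density bound 0.4 suffices. *)
have [z1|z1] := leP z (47 / 50).
  apply: (bound (4 / 10)); first by move=> x _; exact: npdf_le.
  by nra.
pose D := 6 / 5 + z / 2.
have D1 : 167 / 100 <= D by rewrite /D; lra.
have Ds : D <= s by rewrite rE /D; lra.
have D0 : 0 < D by lra.
have zE : z ^+ 2 / 4 + 1 / 2 = D ^+ 2 - 12 / 5 * D + 97 / 50.
  by rewrite /D; field.
have zD : z = 2 * D - 12 / 5 by rewrite /D; field.
clearbody D.
(* For fixed [z], [y = z - (z^2 / 4 + 1 / 2) / s] grows with [s], and [s >= D] because [r >= 6 / 5];
   [y0] is its value at [s = D]. *)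
pose y0 := D - 97 / 50 / D.
have y0D : y0 * D = D ^+ 2 - 97 / 50 by rewrite /y0; field; rewrite gt_eqF.
clearbody y0.
have y00 : 0 <= y0 by rewrite -(pmulr_lge0 _ D0) y0D; nra.
have y0y : y0 <= y.
  have : (z - y0) * D = z ^+ 2 / 4 + 1 / 2 by rewrite mulrBl y0D zE zD; ring.
  rewrite -dE => h; rewrite leNgt; apply/negP => yy0.
  have : (z - y0) * D < (z - y) * s.
    apply: (@lt_le_trans _ _ ((z - y) * D)); first by rewrite ltr_pM2r// ltrD2l ltrN2.
    by rewrite ler_wpM2l// subr_ge0.
  by rewrite h ltxx.
rewrite zE in bound; apply: (bound (4 / 10 * expR (- y0 ^+ 2 / 2))).
  move=> x /andP[yx _]; apply: npdf_le_expR; rewrite -subr_ge0 subr_sqr.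
  by rewrite mulr_ge0//; lra.
exact: bound_pos D1 y0D (expR_ge0 _) (expR_inv_cube y0).
Qed.

End poisson_normal_upper.

(** * Numerical bounds for the exponential *)

Section exp_bounds.
Context {R : realType}.
Implicit Types (x : R).

Lemma expRN_le_quadratic x : 0 <= x -> expR (- x) <= 1 - x + x ^+ 2 / 2.
Proof.
move=> x0; rewrite -subr_ge0.
pose f y : R := 1 - y + y ^+ 2 / 2 - expR (- y).
have f0 : f 0 = 0 by rewrite /f expr0n/= mul0r subr0 addr0 oppr0 expR0 subrr.
rewrite -[X in X <= _]f0 -/(f x).
apply: (@nondecr_der R f (fun y => expR (- y) - (1 - y)) 0 x x0).
  by move=> y _; rewrite /f; der => /=; rewrite expr1; field.
by move=> y _; rewrite subr_ge0 expR_ge1Dx.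
Qed.

Lemma expRN_ge_cubic x : 0 <= x ->
  1 - x + x ^+ 2 / 2 - x ^+ 3 / 6 <= expR (- x).
Proof.
move=> x0; rewrite -subr_ge0.
pose f y : R := expR (- y) - (1 - y + y ^+ 2 / 2 - y ^+ 3 / 6).
have f0 : f 0 = 0.
  by rewrite /f !expr0n/= !mul0r !subr0 addr0 oppr0 expR0 subrr.
rewrite -[X in X <= _]f0 -/(f x).
apply: (@nondecr_der R f (fun y => 1 - y + y ^+ 2 / 2 - expR (- y)) 0 x x0).
  by move=> y _; rewrite /f; der => /=; rewrite expr1; field.
by move=> y /andP[/ltW y0 _]; rewrite subr_ge0 expRN_le_quadratic.
Qed.

Lemma expRN1_ge : 9 / 25 <= expR (- 1) :> R.
Proof.
have h := @expRN_ge_cubic (1 / 4) ltac:(lra).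
have -> : - 1 = - (1 / 4) * 4%:R :> R by field.
rewrite expRM_natr.
have h1 : 77 / 99 <= expR (- (1 / 4)) :> R by lra.
have h2 : 4 / 10 + 1 / 5 <= expR (- (1 / 4)) ^+ 2 :> R by nra.
rewrite (exprM _ 2 2) expr2; nra.
Qed.

Lemma expRN2_ge : 67 / 500 <= expR (- 2) :> R.
Proof.
have h := @expRN_ge_cubic (1 / 4) ltac:(lra).
have -> : - 2 = - (1 / 4) * 8%:R :> R by field.
rewrite expRM_natr.
have h1 : 299 / 384 <= expR (- (1 / 4)) :> R by lra.
have h2 : 606 / 1000 <= expR (- (1 / 4)) ^+ 2 :> R by nra.
have h3 : 367 / 1000 <= expR (- (1 / 4)) ^+ 4 :> R.
  by rewrite (exprM _ 2 2); move: (_ ^+ 2) h2 => a; nra.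
rewrite (exprM _ 4 2); move: (_ ^+ 4) h3 => a; nra.
Qed.

Lemma expRN4_ge : 7 / 400 <= expR (- 4) :> R.
Proof.
have -> : - 4 = - 2 * 2%:R :> R by field.
by rewrite expRM_natr; have := expRN2_ge; nra.
Qed.

Lemma expR4_le : expR 4 <= 60 :> R.
Proof.
have -> : 4 = - - 4 :> R by rewrite opprK.
rewrite (expRN (- 4)) -[X in X <= _]div1r ler_pdivrMr ?expR_gt0//.
by have := expRN4_ge; lra.
Qed.

Lemma expR3_le : expR 3 <= 24 :> R.
Proof.
have h : 9 / 200 <= expR (- 3) :> R.
  have -> : - 3 = - 2 + - 1 :> R by field.
  by rewrite expRD; have := expRN2_ge; have := expRN1_ge; nra.
have -> : 3 = - - 3 :> R by rewrite opprK.
rewrite (expRN (- 3)) -[X in X <= _]div1r ler_pdivrMr ?expR_gt0//.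
by lra.
Qed.

Lemma expR288_le : expR (72 / 25) <= 18 :> R.
Proof.
have h := @expRN_ge_cubic (6 / 25) ltac:(lra).
suff : 1 / 18 <= expR (- (72 / 25)) :> R.
  by rewrite expRN ler_pdivrMr// mulrC ler_pdivlMr ?expR_gt0// mul1r.
have -> : - (72 / 25) = - (6 / 25) * 12%:R :> R by field.
rewrite expRM_natr.
have h1 : 983 / 1250 <= expR (- (6 / 25)) :> R by lra.
have h2 : 773 / 1250 <= expR (- (6 / 25)) ^+ 2 :> R by nra.
have h3 : 239 / 625 <= expR (- (6 / 25)) ^+ 4 :> R.
  by rewrite (exprM _ 2 2); move: (_ ^+ 2) h2 => a; nra.
rewrite (exprM _ 4 3); move: (_ ^+ 4) h3 => a a0.
have a2 : 146 / 1000 <= a ^+ 2 by nra.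
by rewrite exprS; nra.
Qed.

End exp_bounds.

(** * The upper Poisson comparison *)

Section poisson_normal_upper.
Context {R : realType}.
Implicit Types (m x y z s r : R) (i j k : nat).

Lemma Phi_ge_lin z : z <= 0 -> 1 / 2 + 4 / 10 * z <= Phi z.
Proof. by move=> z0; have := Phi_lip z0; rewrite Phi0; lra. Qed.

Let expRN_tangent (a x : R) : expR (- a) * (1 + a - x) <= expR (- x).
Proof.
have -> : expR (- x) = expR (- a) * expR (a - x) by rewrite -expRD; congr expR; ring.
rewrite ler_pM2l ?expR_gt0//.
by apply: le_trans (expR_ge1Dx _); lra.
Qed.

Let tail_scaled (s z : R) : 0 <= s -> 0 <= z ->
  s <= 29 / 100 * (2 + 3 / 2 * z + 11 / 10 * z ^+ 2) ->
  s * (1 - Phi z) <= 29 / 100.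
Proof.
move=> s0 z0 h.
have p0 : 0 < 2 + 3 / 2 * z + 11 / 10 * z ^+ 2 by have := sqr_ge0 z; lra.
have := ler_wpM2l s0 (gaussian_tail z0) => /le_trans; apply.
by rewrite ler_pdivrMr.
Qed.

(* The case [P (Poi m >= 1)], with [m = s ^+ 2]. *)
Let upper1 (s : R) : 0 < s ->
  s * (1 - expR (- s ^+ 2)) <= s * Phi ((s ^+ 2 - 1) / s) + 29 / 100.
Proof.
move=> s0; set z := _ / s; have zs : z * s = s ^+ 2 - 1 by rewrite divfK// gt_eqF.
clearbody z.
have P0 := Phi_ge0 z; set E := expR _.
(* On successive ranges of [s], [exp (- s^2)] is bounded below by its tangents at [s^2] = 0, 1, 2
   and 4; from 2.1 on the Gaussian tail bound alone suffices. *)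
have [s1|s1] := leP s (33 / 50).
  have := expR_ge1Dx (- s ^+ 2); rewrite -/E => h.
  have : s * (1 - E) <= s * s ^+ 2 by rewrite ler_pM2l//; lra.
  have : 0 <= s * Phi z by rewrite mulr_ge0 ?(ltW s0).
  have : s * s ^+ 2 <= 29 / 100 by nra.
  lra.
have [s2|s2] := leP s 1.
  have z0 : z <= 0 by nra.
  have := expRN_tangent 1 (s ^+ 2); rewrite -/E.
  have e1 := @expRN1_ge R; have h1 := Phi_ge_lin z0 => h2.
  have q0 : 0 <= 2 - s ^+ 2 by nra.
  have {}h2 : 9 / 25 * (2 - s ^+ 2) <= E by have := ler_wpM2r q0 e1; lra.
  have h3 : s * (1 / 2) + 4 / 10 * (z * s) <= s * Phi z by nra.
  have h4 : s * (1 - E) <= s * (1 - 9 / 25 * (2 - s ^+ 2)) by rewrite ler_pM2l//; lra.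
  apply: le_trans h4 _; move: h3; rewrite zs => h3.
  apply: le_trans (lerD h3 (lexx _)); rewrite -subr_ge0.
  nra.
have z0 : 0 <= z by nra.
have [s5|s5] := leP (21 / 10) s.
  suff : s * (1 - Phi z) <= 29 / 100.
    have : 0 <= s * E by rewrite mulr_ge0 ?expR_ge0// ltW.
    lra.
  apply: tail_scaled => //; first exact: ltW.
  have z1 : s - 10 / 21 <= z by nra.
  nra.
have hc := Phi_ge_cubic z0.
have [s3|s3] := leP s (8 / 5).
  have := expRN_tangent 2 (s ^+ 2); rewrite -/E => h2.
  have e2 := @expRN2_ge R.
  have q0 : 0 <= 3 - s ^+ 2 by nra.
  have {}h2 : 67 / 500 * (3 - s ^+ 2) <= E by have := ler_wpM2r q0 e2; lra.
  have z1 : z <= 39 / 40 by nra.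
  have h3 : s * (1 / 2) + 327 / 1000 * (z * s) <= s * Phi z by nra.
  have h4 : s * (1 - E) <= s * (1 - 67 / 500 * (3 - s ^+ 2)) by rewrite ler_pM2l//; lra.
  apply: le_trans h4 _; move: h3; rewrite zs => h3.
  apply: le_trans (lerD h3 (lexx _)); rewrite -subr_ge0.
  nra.
have := expRN_tangent 4 (s ^+ 2); rewrite -/E => h2.
have e2 := @expRN4_ge R.
have q0 : 0 <= 5 - s ^+ 2 by nra.
have {}h2 : 7 / 400 * (5 - s ^+ 2) <= E by have := ler_wpM2r q0 e2; lra.
have z1 : z <= 163 / 100 by nra.
have z2 : 39 / 40 <= z by nra.
(* A line just below the chord of the concave cubic over the interval given by [z1] and [z2]. *)
have hz : 267 / 1000 + 53 / 1000 * z <= 39 / 100 * (z - z ^+ 3 / 6).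
  have : 0 <= (z - 39 / 40) * (163 / 100 - z) * (z + 39 / 40 + 163 / 100).
    by rewrite mulr_ge0 ?mulr_ge0//; lra.
  by lra.
have h3 : s * (1 / 2 + 267 / 1000) + 53 / 1000 * (z * s) <= s * Phi z by nra.
have h4 : s * (1 - E) <= s * (1 - 7 / 400 * (5 - s ^+ 2)) by rewrite ler_pM2l//; lra.
apply: le_trans h4 _; move: h3; rewrite zs => h3.
apply: le_trans (lerD h3 (lexx _)); rewrite -subr_ge0.
nra.
Qed.

(** [Phi_sqrt_standardised] requires [r^2 = k - 1/2 >= 36/25], so [k = 0] and [k = 1] are treated
    directly. *)
Lemma poisson_normal_upper k m : 0 < m ->
  1 - pcdf k m <= Phi ((m - k%:R) / Num.sqrt m) + 29 / 100 / Num.sqrt m.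
Proof.
move=> m0; have s0 : 0 < Num.sqrt m by rewrite sqrtr_gt0.
have s2 : Num.sqrt m ^+ 2 = m by rewrite sqr_sqrtr// ltW.
move: (Num.sqrt m) s0 s2 => s s0 <-.
case: k => [|[|j]].
- have -> : (s ^+ 2 - 0) / s = s by field; rewrite gt_eqF.
  rewrite pcdf0 subr0 -lerBlDl ler_pdivlMr// mulrC.
  by apply: tail_scaled; rewrite ?ltW//; nra.
- rewrite pcdfS pcdf0 add0r ppmfE fact0 expr0 mulr1 divr1.
  rewrite -(ler_pM2l s0) [X in _ <= X]mulrDr.
  rewrite (_ : s * (29 / 100 / s) = 29 / 100); last by field; rewrite gt_eqF.
  exact: upper1.
- have := @sqrt_lower_bound R j.+1 s (ltW s0).
  set r := Num.sqrt _ => h.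
  have r2 : r ^+ 2 = j.+1%:R + 1 / 2 by rewrite sqr_sqrtr// addr_ge0.
  have r0 : 0 <= r by exact: sqrtr_ge0.
  have j1 : 1 <= j.+1%:R :> R by rewrite ler1n.
  have jE : j.+2%:R = j.+1%:R + 1 :> R by rewrite natr1.
  clearbody r.
  have r1 : 6 / 5 <= r by nra.
  have := Phi_sqrt_standardised r1 s0.
  have -> : s ^+ 2 - (r ^+ 2 + 1 / 2) = s ^+ 2 - j.+2%:R by rewrite r2 jE; field.
  apply: le_trans; rewrite -[X in _ <= Phi X]opprB PhiN.
  by rewrite lerD2l lerN2.
Qed.

End poisson_normal_upper.

(** * The Stein equation *)

Section stein_poisson.
Context {R : realType}.
Variable m : R.
Hypothesis m0 : 0 < m.
Implicit Types (i j n : nat).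

Let p i := ppmf i m.
Let F i := pcdf i m.
Let p_gt0 i : 0 < p i. Proof. exact: ppmf_gt0. Qed.
Let F_ge0 i : 0 <= F i. Proof. by apply: pcdf_ge0; exact: ltW. Qed.
Let F_le1 i : F i <= 1. Proof. by apply: pcdf_le1; exact: ltW. Qed.
Let FS i : F i.+1 = F i + p i. Proof. exact: pcdfS. Qed.
Let pS i : i.+1%:R * p i.+1 = m * p i. Proof. exact: ppmfS. Qed.

Let F_homo i j : (i <= j)%N -> F i <= F j.
Proof.
move=> /subnK <-; elim: (j - i)%N => [|k IHk]; first by rewrite add0n.
by rewrite addSn FS (le_trans IHk)// lerDl ltW.
Qed.

(** Summation of [m p_i = (i + 1) p_(i+1) <= (n + 1) p_(i+1)] over [i <= n]. *)
Let mul_F_le n : m * F n.+1 <= n.+1%:R * (F n.+2 - p 0).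
Proof.
elim: n => [|n IHn].
  by have := pS 0; rewrite !FS /F pcdf0; lra.
have := F_homo (isT : (1 <= n.+2)%N); rewrite {1}FS {1}/F pcdf0 add0r => h.
rewrite !FS in IHn *; have := pS n.+1; rewrite !FS in h.
rewrite -(natr1 n.+1); move: IHn h.
move: (F n) (p n) (p n.+1) (p n.+2) (p 0) (n.+1%:R) => a b c d e k.
by lra.
Qed.

Let sub_mul_F_le n : (m - n%:R) * F n <= n%:R * p n.
Proof.
elim: n => [|n IHn]; first by rewrite /F pcdf0 mulr0 mul0r.
rewrite pS FS -natr1; have := F_ge0 n; have := p_gt0 n; move: IHn.
by move: (F n) (p n) (n%:R) => a b k; lra.
Qed.

(** For X Poisson, m P(X >= n) = E[X; X > n] >= n P(X > n). Differentiation in [m] replaces the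
    infinite sum. *)
Let sub_mul_tail_le n : (n%:R - m) * (1 - F n.+1) <= m * p n.
Proof.
rewrite -subr_ge0.
pose h x : R := x * ppmf n x - (n%:R - x) * (1 - pcdf n.+1 x).
have h0 : h 0 = 0 by rewrite /h pcdf_at0 subrr mulr0 mul0r subr0.
rewrite -[X in X <= _]h0 -/(h m).
apply: (@nondecr_der R h (fun x => ppmf n x + (1 - pcdf n.+1 x)) 0 m (ltW m0)).
  move=> x _; rewrite /h.
  have dp : is_derive x 1 (ppmf n) ((if n is k.+1 then ppmf k x else 0) - ppmf n x).
    by case: (n) => [|k]; [rewrite sub0r; exact: der_ppmf0|exact: der_ppmfS].
  eapply der_eq.
    eapply derD.
      by eapply derM; [exact: der_id|exact: dp].
    eapply derN; eapply derM.
      by eapply derD; [exact: der_cst|eapply derN; exact: der_id].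
    by eapply derD; [exact: der_cst|eapply derN; exact: der_pcdf].
  rewrite /=; case: n {h h0 dp} => [|k]; first by move: (ppmf _ _) (pcdf _ _) => a b; ring.
  have := ppmfS k x; move: (ppmf _ _) (ppmf _ _) (pcdf _ _) => a b c; lra.
move=> x /andP[/ltW x0 _]; rewrite addr_ge0 ?ppmf_ge0// subr_ge0.
exact: pcdf_le1.
Qed.

(* The value at [i = 0] is irrelevant: it enters the Stein equation multiplied
   by 0. *)
Definition stein_sol j i : R :=
  F (minn i.-1 j).+1 * (1 - F (maxn i.-1 j).+1) / (m * p i.-1).

Lemma stein_eq j i :
  m * stein_sol j i.+1 - i%:R * stein_sol j i = (i <= j)%N%:R - F j.+1.
Proof.
rewrite /stein_sol /=; case: i => [|i].
  have F1 : F 1 = p 0 by rewrite FS /F pcdf0 add0r.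
  by rewrite min0n max0n mul0r subr0 F1 /=; field; rewrite !gt_eqF.
have hp := pS i; have pi0 := p_gt0 i.
have -> x y : i.+1%:R * (x * y / (m * p i)) = x * y / p i.+1.
  have -> : m * p i = i.+1%:R * p i.+1 by [].
  by field; rewrite !gt_eqF ?ltr0n.
have -> x y : m * (x * y / (m * p i.+1)) = x * y / p i.+1.
  by field; rewrite !gt_eqF.
have [ij|ji] := leqP i.+1 j.
  rewrite (minn_idPl (ltnW ij)) (maxn_idPr (ltnW ij)) (FS i.+1) /=.
  by field; rewrite gt_eqF.
rewrite ltnS in ji; rewrite (minn_idPr ji) (maxn_idPl ji) (FS i.+1) /=.
by field; rewrite gt_eqF.
Qed.

(** The increment is nonnegative for [i < j] and nonpositive for [i >= j]. The factor depending on
    [j] is replaced by its largest value, reached at [j = i + 1] or [j = i]; the three preceding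
    bounds then give the classical constant [(1 - exp (- m)) / m]. *)
Lemma stein_sol_lip1 j i : `|stein_sol j i.+2 - stein_sol j i.+1| <= (1 - p 0) / m.
Proof.
rewrite /stein_sol /=.
have hp := pS i; have pi0 := p_gt0 i; have pi1 := p_gt0 i.+1.
have k0 : 0 < i.+1%:R :> R by rewrite ltr0n.
have mpE : m * p i = i.+1%:R * p i.+1 by [].
have h1 := mul_F_le i; have h2 := sub_mul_F_le i.+1; have h3 := sub_mul_tail_le i.+1.
have G0 : 0 <= 1 - F i.+2 by rewrite subr_ge0.
have Fi0 := F_ge0 i.+1.
have F2 : F i.+2 = F i.+1 + p i.+1 by exact: FS.
rewrite mpE; have [ij|] := boolP (i.+1 <= j)%N.
  rewrite (minn_idPl ij) (maxn_idPr ij) (minn_idPl (ltnW ij)) (maxn_idPr (ltnW ij)).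
  have b0 : 0 <= 1 - F j.+1 by rewrite subr_ge0.
  have bG : 1 - F j.+1 <= 1 - F i.+2 by rewrite lerD2l lerN2 F_homo.
  move: (1 - F j.+1) b0 bG => b b0 bG; rewrite F2 in G0 bG h1 h3 *.
  move: (F i.+1) (p i.+1) (i.+1%:R) (p 0) pi1 k0 h1 h2 h3 G0 Fi0 bG (p_gt0 0).
  move=> a P k q P0 k0 h1 h2 h3 G0 a0 bG q0.
  have -> : (a + P) * b / (m * P) - a * b / (k * P) =
      b * (k * (a + P) - m * a) / (k * P * m) by field; rewrite !gt_eqF.
  have c0 : 0 <= k * (a + P) - m * a by nra.
  rewrite ger0_norm; last by rewrite divr_ge0 ?mulr_ge0 ?(ltW k0) ?(ltW P0) ?(ltW m0).
  rewrite ler_pdivrMr ?mulr_gt0//.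
  have -> : (1 - q) / m * (k * P * m) = (1 - q) * (k * P) by field; rewrite gt_eqF.
  apply: le_trans (ler_wpM2r c0 bG) _.
  have := ler_wpM2l a0 h3; have := ler_wpM2l (ltW P0) h1; lra.
rewrite -ltnNge ltnS => ji.
rewrite (minn_idPr ji) (maxn_idPl ji) (minn_idPr (leqW ji)) (maxn_idPl (leqW ji)).
have b0 := F_ge0 j.+1; have ba : F j.+1 <= F i.+1 by exact: F_homo.
move: (F j.+1) b0 ba => b b0 ba; rewrite F2 in G0 h1 h3 *.
move: (F i.+1) (p i.+1) (i.+1%:R) (p 0) pi1 k0 h1 h2 h3 G0 Fi0 ba (p_gt0 0).
move=> a P k q P0 k0 h1 h2 h3 G0 a0 ba q0.
have -> : b * (1 - (a + P)) / (m * P) - b * (1 - a) / (k * P) =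
    - (b * (m * (1 - a) - k * (1 - (a + P))) / (k * P * m)).
  by field; rewrite !gt_eqF.
have c0 : 0 <= m * (1 - a) - k * (1 - (a + P)) by nra.
rewrite normrN ger0_norm; last by rewrite divr_ge0 ?mulr_ge0 ?(ltW k0) ?(ltW P0) ?(ltW m0).
rewrite ler_pdivrMr ?mulr_gt0//.
have -> : (1 - q) / m * (k * P * m) = (1 - q) * (k * P) by field; rewrite gt_eqF.
apply: le_trans (ler_wpM2r c0 ba) _.
have := ler_wpM2r G0 h2; have := ler_wpM2l (ltW P0) h1; lra.
Qed.

Definition stein_factor : R := Num.min 1 m^-1.

Lemma stein_sol_lip j i k :
  `|stein_sol j i.+1 - stein_sol j k.+1| <= stein_factor * `|i%:R - k%:R|.
Proof.
have M1 : (1 - p 0) / m <= stein_factor.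
  have p01 : p 0 <= 1 by apply: ppmf_le1; exact: ltW.
  rewrite le_min; apply/andP; split.
    rewrite ler_pdivrMr// mul1r /p ppmfE fact0 expr0 mulr1 divr1.
    by have := expR_ge1Dx (- m); lra.
  by rewrite -[X in _ <= X]mul1r ler_pM2r ?invr_gt0// gerDl oppr_le0 ltW.
have M0 : 0 <= stein_factor by rewrite le_min ler01 invr_ge0 ltW.
wlog ki : i k / (k <= i)%N.
  move=> h; have [/h//|/ltnW/h] := leqP k i.
  by rewrite distrC (distrC k%:R).
rewrite -[X in `|X - _|]addr0; move/subnK : ki => <-.
elim: (i - k)%N => [|d IHd]; first by rewrite add0n addr0 subrr normr0 mulr_ge0.
move: IHd; rewrite !addr0 addSn => IHd.
rewrite -[X in `|X - _|](subrK (stein_sol j (d + k).+1)) -addrA.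
apply: le_trans (ler_normD _ _) _.
apply: le_trans (lerD (le_trans (stein_sol_lip1 j (d + k)) M1) IHd) _.
rewrite -[X in X + _]mulr1 -mulrDr ler_wpM2l// -addSn !natrD !addrK.
by rewrite !ger0_norm// -natr1 addrC.
Qed.

End stein_poisson.

(** * Expectations over multinomial counts *)

Section multinomial_expectation.
Context {R : realType} {r : nat}.
Implicit Types (q p : 'I_r -> R) (k : 'I_r -> nat) (n a : nat) (i j : 'I_r).
Implicit Types (F G : ('I_r -> nat) -> R).

Definition add_ball k j : 'I_r -> nat := fun i => (k i + (i == j))%N.

(* Expectation of [F] over the cell counts of [n] independent balls, each
   falling in cell [j] with (possibly unnormalised) weight [q j]. *)
Fixpoint mexp q n F : R :=
  if n is n'.+1 then \sum_j q j * mexp q n' (fun k => F (add_ball k j))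
  else F (fun=> 0%N).

Lemma sum_add_ball k j : (\sum_i add_ball k j i = (\sum_i k i).+1)%N.
Proof.
rewrite big_split/= -addn1; congr (_ + _)%N.
by rewrite (bigD1 j)//= eqxx big1 ?addn0// => i /negbTE ->.
Qed.

Lemma le_mexp q n F G : (forall j, 0 <= q j) ->
  (forall k, (\sum_i k i = n)%N -> F k <= G k) -> mexp q n F <= mexp q n G.
Proof.
move=> q0; elim: n F G => [|n IHn] F G FG /=; first by apply: FG; rewrite big1.
apply: ler_sum => j _; rewrite ler_wpM2l// IHn// => k kn.
by rewrite FG// sum_add_ball kn.
Qed.

Lemma eq_mexp q n F G :
  (forall k, (\sum_i k i = n)%N -> F k = G k) -> mexp q n F = mexp q n G.
Proof.
elim: n F G => [|n IHn] F G FG /=; first by apply: FG; rewrite big1.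
apply: eq_bigr => j _; congr (_ * _); apply: IHn => k kn.
by rewrite FG// sum_add_ball kn.
Qed.

Lemma mexpD q n F G : mexp q n (fun k => F k + G k) = mexp q n F + mexp q n G.
Proof.
elim: n F G => [//|n IHn] F G /=; rewrite -big_split/=.
by apply: eq_bigr => j _; rewrite IHn mulrDr.
Qed.

Lemma mexpZ q n (c : R) F : mexp q n (fun k => c * F k) = c * mexp q n F.
Proof.
elim: n F => [//|n IHn] F /=; rewrite mulr_sumr.
by apply: eq_bigr => j _; rewrite IHn mulrCA.
Qed.

Lemma mexpB q n F G : mexp q n (fun k => F k - G k) = mexp q n F - mexp q n G.
Proof.
rewrite mexpD; congr (_ + _); rewrite -mulN1r -mexpZ.
by apply: eq_mexp => k _; rewrite mulN1r.
Qed.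

Lemma mexp_sum q n (I : Type) (s : seq I) (P : pred I)
    (F : I -> ('I_r -> nat) -> R) :
  mexp q n (fun k => \sum_(x <- s | P x) F x k) =
  \sum_(x <- s | P x) mexp q n (F x).
Proof.
elim: n F => [//|n IHn] F /=; under eq_bigr => j _ do rewrite IHn mulr_sumr.
by rewrite exchange_big.
Qed.

Lemma mexp_cst q n (c : R) : \sum_j q j = 1 -> mexp q n (fun=> c) = c.
Proof.
move=> q1; elim: n => [//|n IHn] /=.
by rewrite -mulr_suml q1 mul1r.
Qed.

Lemma mexp_scale (c : R) q n F : mexp (fun j => c * q j) n F = c ^+ n * mexp q n F.
Proof.
elim: n F => [|n IHn] F /=; first by rewrite mul1r.
rewrite mulr_sumr; apply: eq_bigr => j _; rewrite IHn exprS; ring.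
Qed.

Lemma norm_mexp_le q n F G : (forall j, 0 <= q j) ->
  (forall k, (\sum_i k i = n)%N -> `|F k| <= G k) -> `|mexp q n F| <= mexp q n G.
Proof.
move=> q0 FG; rewrite ler_norml -mulN1r -mexpZ !le_mexp// => k /FG.
  by rewrite ler_norml => /andP[].
by rewrite ler_norml mulN1r => /andP[].
Qed.

(** Binomial moments by induction on the balls: a ball entering cell [j] acts by Pascal's rule. *)
Lemma mexp_bin q n j a : \sum_i q i = 1 ->
  mexp q n (fun k => 'C(k j, a)%:R) = 'C(n, a)%:R * q j ^+ a.
Proof.
move=> q1; elim: n a => [|n IHn] a /=.
  by case: a => [|a]; rewrite ?bin0 ?bin0n/= ?mul0r ?expr0 ?mulr1.
transitivity (\sum_i q i * (mexp q n (fun k => 'C(k j, a)%:R) +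
    (j == i)%:R * (if a is a'.+1 then mexp q n (fun k => 'C(k j, a')%:R) else 0))).
  apply: eq_bigr => i _; congr (_ * _); rewrite /add_ball.
  case: eqVneq => [_|_]; last by rewrite mul0r addr0; under eq_fun do rewrite addn0.
  rewrite mul1r; case: a => [|a].
    by rewrite addr0; apply: eq_mexp => k _; rewrite !bin0.
  by rewrite -mexpD; apply: eq_mexp => k _; rewrite addn1 binS natrD.
under eq_bigr do rewrite mulrDr; rewrite big_split/= -mulr_suml q1 mul1r.
rewrite (bigD1 j)//= eqxx mul1r big1 ?addr0; last first.
  by move=> i /negbTE ij; rewrite eq_sym ij mul0r mulr0.
case: a => [|a]; first by rewrite mulr0 addr0 IHn !bin0.
by rewrite !IHn binS natrD exprS; ring.
Qed.

Definition drop_cell q i : 'I_r -> R := fun j => if j == i then 0 else q j.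

(** Conditioning on [N_i = a] without a division: the other [n - a] balls avoid cell [i], which is
    why the weights of [mexp] may have total below 1. The induction separates a ball in cell [i]
    from one elsewhere and recombines by Pascal's rule. *)
Lemma mexp_cell q n i a G : (forall k, G (add_ball k i) = G k) ->
  mexp q n (fun k => (k i == a)%:R * G k) =
  'C(n, a)%:R * q i ^+ a * mexp (drop_cell q i) (n - a) G.
Proof.
elim: n a G => [|n IHn] a G Gi /=.
  by case: a => [|a]; rewrite ?bin0 ?bin0n/= ?mul0r ?expr0 ?mulr1.
rewrite (bigD1 i)//=.
have other : \sum_(j < r | j != i)
    q j * mexp q n (fun k => (add_ball k j i == a)%:R * G (add_ball k j)) =
    'C(n, a)%:R * q i ^+ a * mexp (drop_cell q i) (n - a).+1 G.
  rewrite /= [in RHS](bigD1 i)//= {1}/drop_cell eqxx mul0r add0r mulr_sumr.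
  apply: eq_bigr => j ji; rewrite /drop_cell (negbTE ji) mulrCA; congr (_ * _).
  rewrite -IHn; last first.
    move=> k; rewrite -[in RHS](Gi (add_ball k j)); congr G.
    by apply/funext => l; rewrite /add_ball addnAC.
  by apply: eq_mexp => k _; rewrite /add_ball [i == j]eq_sym (negbTE ji) addn0.
have own : mexp q n (fun k => (add_ball k i i == a)%:R * G (add_ball k i)) =
    if a is b.+1 then 'C(n, b)%:R * q i ^+ b * mexp (drop_cell q i) (n - b) G
    else 0.
  case: a {other} => [|b].
    rewrite -[RHS](mul0r (mexp q n (fun=> 0))) -mexpZ; apply: eq_mexp => k _.
    by rewrite /add_ball eqxx addn1 !mul0r.
  rewrite -IHn//; apply: eq_mexp => k _.
  by rewrite Gi /add_ball eqxx addn1 eqSS.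
rewrite other own; case: a {other own} => [|b].
  by rewrite mulr0 add0r !bin0 subn0.
have [bn|nb] := ltnP b n.
  by rewrite binS natrD subSS -subSn// subSS exprS; ring.
by rewrite binS natrD subSS (@bin_small n b.+1)// exprS; ring.
Qed.

End multinomial_expectation.

(** * Poisson approximation of the number of pairs *)

Lemma natr_bin2 {R : realType} b : 2 * 'C(b, 2)%:R = b%:R * (b%:R - 1) :> R.
Proof.
elim: b => [|b IHb]; first by rewrite bin0n mulr0 mul0r.
by rewrite binS bin1 natrD mulrDr IHb -natr1; ring.
Qed.

Section stein_chen.
Context {R : realType} {r : nat}.
Implicit Types (q p : 'I_r -> R) (k : 'I_r -> nat) (n a : nat) (i j : 'I_r).

Definition pairs k := (\sum_j (k j == 2))%N.
Definition pairs_but i k := (\sum_(j < r | j != i) (k j == 2))%N.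

Lemma pairs_split i k : pairs k = (pairs_but i k + (k i == 2))%N.
Proof. by rewrite /pairs (bigD1 i)//= addnC. Qed.

Lemma pairs_but_add_ball i k : pairs_but i (add_ball k i) = pairs_but i k.
Proof.
by apply: eq_bigr => j ji; rewrite /add_ball (negbTE ji) addn0.
Qed.

(** A ball added to cell [j] creates a pair if the cell held one ball and destroys one if it held
    two; the binomials dominate these indicators and have explicit means. *)
Lemma pairs_but_step i j k (m : R) (h : nat -> R) :
  0 <= m -> (forall a b, `|h a - h b| <= m * `|a%:R - b%:R|) ->
  `|h (pairs_but i (add_ball k j)) - h (pairs_but i k)| <=
  m * ('C(k j, 1)%:R + 'C(k j, 2)%:R).
Proof.
move=> m0 hm; apply: (le_trans (hm _ _)); rewrite ler_wpM2l//.
have [<-|ji] := eqVneq j i.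
  by rewrite pairs_but_add_ball subrr normr0 addr_ge0.
rewrite /pairs_but !(bigD1 j (P := fun l => l != i))//=.
rewrite (eq_bigr (fun l => (k l == 2) : nat)); last first.
  by move=> l /andP[_ lj]; rewrite /add_ball (negbTE lj) addn0.
rewrite !natrD opprD addrACA subrr addr0 /add_ball eqxx addn1.
case: (k j) => [|[|[|b]]]; rewrite ?bin1 ?eqxx//=.
- by rewrite subr0 normr0 addr_ge0.
- by rewrite subr0 normr1 lerDl.
- by rewrite sub0r normrN normr1 (_ : 'C(2, 2)%:R = 1 :> R)// lerDr.
- by rewrite subrr normr0 addr_ge0.
Qed.

Lemma mexp_partition q n i (F : nat -> ('I_r -> nat) -> R) :
  (forall a k, F a (add_ball k i) = F a k) ->
  mexp q n (fun k => F (k i) k) =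
  \sum_(a < n.+1) 'C(n, a)%:R * q i ^+ a * mexp (drop_cell q i) (n - a) (F a).
Proof.
move=> Fi; under [RHS]eq_bigr => a _ do rewrite -mexp_cell//.
rewrite -mexp_sum; apply: eq_mexp => k kn.
have kin : (k i < n.+1)%N by rewrite ltnS -kn (bigD1 i)//= leq_addr.
rewrite (bigD1 (Ordinal kin))//= eqxx mul1r big1 ?addr0// => a /eqP ai.
case: eqP => [kia|_]; last by rewrite mul0r.
by case: ai; apply: val_inj.
Qed.

Section one_cell.
Variables (p : 'I_r -> R) (n : nat) (i : 'I_r) (h : nat -> R) (m : R).
Hypotheses (p0 : forall j, 0 <= p j) (p1 : \sum_j p j = 1) (pi1 : p i < 1).
Hypotheses (m0 : 0 <= m) (hm : forall a b, `|h a - h b| <= m * `|a%:R - b%:R|).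
Hypothesis (n2 : (2 <= n)%N).

Definition rest_cell : 'I_r -> R := fun j => drop_cell p i j / (1 - p i).

Let q := rest_cell.

Let opi : 1 - p i != 0. Proof. by rewrite gt_eqF// subr_gt0. Qed.

Lemma rest_cell_ge0 j : 0 <= q j.
Proof.
rewrite /q /rest_cell /drop_cell; case: ifP => _; first by rewrite mul0r.
by rewrite divr_ge0// subr_ge0 ltW.
Qed.

Lemma sum_rest_cell : \sum_j q j = 1.
Proof.
rewrite -mulr_suml (bigD1 i)//= {1}/drop_cell eqxx add0r.
rewrite (eq_bigr p); last by move=> j ji; rewrite /drop_cell (negbTE ji).
have -> : \sum_(j < r | j != i) p j = 1 - p i.
  by rewrite -p1 [in RHS](bigD1 i)//= addrAC subrr add0r.
exact: divff opi.
Qed.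

Lemma mexp_drop_cell b F : mexp (drop_cell p i) b F = (1 - p i) ^+ b * mexp q b F.
Proof.
rewrite -mexp_scale; congr (mexp _ _ _); apply/funext => j.
by rewrite /q /rest_cell mulrC divfK.
Qed.

(** Bounds the expected change of [pairs_but i] caused by one more ball, uniformly over at most [n]
    balls already placed. *)
Definition ball_effect : R := \sum_j q j * (n%:R * q j + 'C(n, 2)%:R * q j ^+ 2).

Lemma ball_effect_ge0 : 0 <= ball_effect.
Proof.
apply: sumr_ge0 => j _; have q0 := rest_cell_ge0 j.
by rewrite mulr_ge0// addr_ge0// mulr_ge0// exprn_ge0.
Qed.

Let H k := h (pairs_but i k).

Lemma mexp_step b : (b <= n)%N -> `|mexp q b.+1 H - mexp q b H| <= m * ball_effect.
Proof.
move=> bn /=.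
have -> : mexp q b H = \sum_j q j * mexp q b H.
  by rewrite -mulr_suml sum_rest_cell mul1r.
rewrite -sumrB (le_trans (ler_norm_sum _ _ _))// /ball_effect mulr_sumr.
apply: ler_sum => j _; have q0 := rest_cell_ge0 j.
rewrite -mulrBr normrM ger0_norm// mulrCA ler_wpM2l//.
rewrite -mexpB.
apply: (le_trans (norm_mexp_le (G := fun k => m * ('C(k j, 1)%:R + 'C(k j, 2)%:R)) _ _)).
- exact: rest_cell_ge0.
- by move=> k _; exact: pairs_but_step.
rewrite mexpZ mexpD !mexp_bin ?sum_rest_cell// ler_wpM2l// lerD//.
  by rewrite bin1 expr1 ler_wpM2r// ler_nat.
by rewrite ler_wpM2r ?exprn_ge0// ler_nat leq_bin2l.
Qed.

Lemma mexp_steps b e : (b + e <= n)%N ->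
  `|mexp q (b + e) H - mexp q b H| <= e%:R * (m * ball_effect).
Proof.
elim: e => [|e IHe] be; first by rewrite addn0 subrr normr0 mul0r.
rewrite -(subrKA (mexp q (b + e) H)) (le_trans (ler_normD _ _))//.
rewrite -natr1 mulrDl mul1r addrC lerD ?IHe//; first by lia.
by rewrite addnS mexp_step//; lia.
Qed.

Lemma mexp_shift a : (a <= n)%N ->
  `|mexp q (n - a) H - mexp q (n - 2) H| <= `|a%:R - 2| * (m * ball_effect).
Proof.
move=> an; have [a2|a2] := leqP a 2.
  have -> : (n - a = (n - 2) + (2 - a))%N by lia.
  apply: (le_trans (mexp_steps _)); first by lia.
  by rewrite distrC ger0_norm ?subr_ge0 ?ler_nat// natrB.
have -> : (n - 2 = (n - a) + (a - 2))%N by lia.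
rewrite distrC; apply: (le_trans (mexp_steps _)); first by lia.
by rewrite ger0_norm ?subr_ge0 ?ler_nat 1?ltnW// natrB// ltnW.
Qed.

(** For an integer [d = b - 2], [(|d| - 1) (|d| - 2) >= 0], whence [|d| <= (d^2 + 2) / 3]. The mean
    of the right-hand side is at most 10/3, its quadratic bound being largest at [n p_i = 4]. *)
Lemma mexp_dist2_le : n%:R * p i <= 4 -> mexp p n (fun k => `|(k i)%:R - 2|) <= 10 / 3.
Proof.
move=> np4.
have nat_ineq b : `|b%:R - 2| <= 1 / 3 * (2 * 'C(b, 2)%:R - 3 * 'C(b, 1)%:R + 6) :> R.
  rewrite natr_bin2.
  rewrite bin1; case: b => [|[|b]].
  - by rewrite sub0r normrN ger0_norm//; lra.
  - by rewrite ler_norml; apply/andP; split; lra.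
  rewrite -addn2 natrD addrK ger0_norm//.
  case: b => [|b]; first by lra.
  have [|b0] := eqVneq b 0%N; first by move=> ->; lra.
  have : 1 <= b%:R :> R by rewrite ler1n lt0n.
  by rewrite -natr1; nra.
apply: (le_trans (le_mexp (G := fun k => 1 / 3 * (2 * 'C(k i, 2)%:R +
    (-3) * 'C(k i, 1)%:R + 6)) p0 _)).
  by move=> k _; apply: (le_trans (nat_ineq _)); lra.
rewrite mexpZ !mexpD !mexpZ !mexp_bin// mexp_cst// bin1 expr1.
have -> : 'C(n, 2)%:R = n%:R * (n%:R - 1) / 2 :> R.
  by rewrite -natr_bin2; field.
have n0 : 0 <= n%:R :> R by [].
have x0 : 0 <= n%:R * p i by rewrite mulr_ge0.
have y0 : 0 <= n%:R * p i ^+ 2 by rewrite mulr_ge0// exprn_ge0.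
have -> : n%:R * (n%:R - 1) / 2 * p i ^+ 2 =
  ((n%:R * p i) ^+ 2 - n%:R * p i ^+ 2) / 2 by field.
move: (n%:R * p i) (n%:R * p i ^+ 2) np4 x0 y0 => x y x4 x0 y0; nra.
Qed.

(** Given [N_i = a] the other cells share [n - a] balls, while the second mean always has [n - 2] of
    them. The two differ by [|a - 2|] ball steps, plus one unit when [a = 2] because [pairs] then
    also counts cell [i]; this unit yields the square of [pi_ n p i]. *)
Lemma stein_chen_cell : n%:R * p i <= 4 ->
  `|pi_ n p i * mexp p n (fun k => h (pairs k)) -
    mexp p n (fun k => (k i == 2)%:R * h (pairs_but i k))| <=
  m * (pi_ n p i * (pi_ n p i + 10 / 3 * ball_effect)).
Proof.
move=> np4.
pose b a : R := 'C(n, a)%:R * p i ^+ a * (1 - p i) ^+ (n - a).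
have b0 a : 0 <= b a by rewrite !mulr_ge0// ?exprn_ge0// subr_ge0 ltW.
have mean_b phi : mexp p n (fun k => phi (k i)) = \sum_(a < n.+1) b a * phi a.
  rewrite (@mexp_partition p n i (fun a _ => phi a))//.
  by apply: eq_bigr => a _; rewrite mexp_drop_cell mexp_cst ?sum_rest_cell// mulrA.
have b1 : \sum_(a < n.+1) b a = 1.
  rewrite -(mexp_cst n 1 p1) (mean_b (fun=> 1)).
  by apply: eq_bigr => a _; rewrite mulr1.
have pib : pi_ n p i = b 2 by [].
have -> : mexp p n (fun k => (k i == 2)%:R * h (pairs_but i k)) =
    pi_ n p i * mexp q (n - 2) H.
  rewrite mexp_cell; last by move=> k; rewrite pairs_but_add_ball.
  by rewrite mexp_drop_cell mulrA.
have -> : mexp p n (fun k => h (pairs k)) =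
    \sum_(a < n.+1) b a * mexp q (n - a) (fun k => h (pairs_but i k + (a == 2 :> nat))).
  under eq_mexp => k _ do rewrite (pairs_split i).
  rewrite (@mexp_partition p n i (fun a k => h (pairs_but i k + (a == 2 :> nat))%N)).
    by apply: eq_bigr => a _; rewrite mexp_drop_cell mulrA.
  by move=> a k; rewrite pairs_but_add_ball.
have pi0 : 0 <= pi_ n p i by rewrite pib.
rewrite -mulrBr normrM (ger0_norm pi0) mulrCA ler_wpM2l//.
have -> : mexp q (n - 2) H = \sum_(a < n.+1) b a * mexp q (n - 2) H.
  by rewrite -mulr_suml b1 mul1r.
rewrite -sumrB (le_trans (ler_norm_sum _ _ _))//.
have -> : pi_ n p i + 10 / 3 * ball_effect =
    \sum_(a < n.+1) b a * (a == 2 :> nat)%:R + 10 / 3 * ball_effect.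
  congr (_ + _); rewrite pib (bigD1 (Ordinal (n2 : (2 < n.+1)%N)))//= mulr1.
  rewrite big1 ?addr0// => a /eqP a2.
  case: eqP => [a2'|_]; last by rewrite mulr0.
  by case: a2; apply: val_inj.
have := mexp_dist2_le np4; rewrite (mean_b (fun a => `|a%:R - 2|)) => dist.
apply: (@le_trans _ _ (m * (\sum_(a < n.+1) b a * (a == 2 :> nat)%:R +
    (\sum_(a < n.+1) b a * `|a%:R - 2|) * ball_effect))); last first.
  by rewrite ler_wpM2l// lerD2l ler_wpM2r// ball_effect_ge0.
rewrite mulr_suml -big_split/= mulr_sumr; apply: ler_sum => -[a an] _ /=.
rewrite -mulrBr normrM (ger0_norm (b0 a)).
have -> : m * (b a * (a == 2)%:R + b a * `|a%:R - 2| * ball_effect) =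
    b a * (m * (a == 2)%:R + `|a%:R - 2| * (m * ball_effect)) by ring.
rewrite ler_wpM2l//.
rewrite -(subrKA (mexp q (n - a) H)) (le_trans (ler_normD _ _))//.
apply: lerD; last by apply: mexp_shift; rewrite -ltnS.
rewrite -mexpB -[leRHS](mexp_cst (n - a) _ sum_rest_cell).
apply: norm_mexp_le => [|k _]; first exact: rest_cell_ge0.
by rewrite (le_trans (hm _ _))// natrD addrAC subrr add0r ger0_norm.
Qed.

End one_cell.

Lemma poisson_pairs_le p n J : (forall j, 0 <= p j) -> \sum_j p j = 1 ->
  (forall j, p j < 1) -> (2 <= n)%N -> (forall j, n%:R * p j <= 4) ->
  0 < mu_ n p ->
  `|mexp p n (fun k => (pairs k <= J)%N%:R) - pcdf J.+1 (mu_ n p)| <=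
  stein_factor (mu_ n p) *
    \sum_i pi_ n p i * (pi_ n p i + 10 / 3 * ball_effect p n i).
Proof.
move=> p0 p1 plt n2 np4 mu0.
(* Shifted by one, so that on [N_i = 2] the value [h (pairs_but i k)] is the Stein solution at
   [pairs k]. *)
pose h a := stein_sol (mu_ n p) J a.+1.
rewrite -[pcdf _ _](mexp_cst n _ p1) -mexpB.
have -> : mexp p n (fun k => (pairs k <= J)%N%:R - pcdf J.+1 (mu_ n p)) =
    \sum_i (pi_ n p i * mexp p n (fun k => h (pairs k)) -
      mexp p n (fun k => (k i == 2)%:R * h (pairs_but i k))).
  rewrite sumrB -mulr_suml -/(mu_ n p) -mexpZ -mexp_sum -mexpB.
  apply: eq_mexp => k _; rewrite -stein_eq//; congr (_ - _).
  rewrite {1}/pairs natr_sum mulr_suml; apply: eq_bigr => i _.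
  rewrite (pairs_split i); case: (k i == 2); last by rewrite !mul0r.
  by rewrite /h addn1.
have m0 : 0 <= stein_factor (mu_ n p).
  by rewrite /stein_factor le_min ler01 invr_ge0 ltW.
rewrite (le_trans (ler_norm_sum _ _ _))// mulr_sumr; apply: ler_sum => i _.
apply: stein_chen_cell => // a b; exact: stein_sol_lip.
Qed.

End stein_chen.

(** * Bounds for the occupation probabilities of one cell *)

Section cell_bounds.
Context {R : realType}.
Implicit Types (x p : R) (n : nat).

(** From [1 - x >= exp (- (x + 3/4 x^2))]: the surplus [3/4 (n - 2) x^2] is at most [3 x] because
    [(n + 1) x <= 4], and [3 x] is the gap between [(n - 2) x] and [(n + 1) x]. *)
Lemma one_sub_expX_ge x n : 0 <= x -> x <= 13 / 100 -> (n%:R + 1) * x <= 4 ->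
  (2 <= n)%N -> expR (- ((n%:R + 1) * x)) <= (1 - x) ^+ (n - 2).
Proof.
move=> x0 x13 nx4 n2.
pose y := x + 3 / 4 * x ^+ 2.
have y0 : 0 <= y by rewrite addr_ge0// mulr_ge0// exprn_ge0.
have ey : expR (- y) <= 1 - x.
  apply: (le_trans (expRN_le_quadratic y0)).
  have : 0 <= x ^+ 2 * (3 / 2 - (1 + 3 / 4 * x) ^+ 2).
    by rewrite mulr_ge0 ?sqr_ge0//; nra.
  by rewrite /y; nra.
have n2R : (n - 2)%:R = n%:R - 2 :> R by rewrite natrB.
apply: (@le_trans _ _ (expR (- y) ^+ (n - 2))); last first.
  by rewrite lerXn2r ?nnegrE ?expR_ge0//; lra.
rewrite -expRM_natl ler_expR n2R mulrN lerN2 /y.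
have nr2 : 2 <= n%:R :> R by rewrite ler_nat.
have : 0 <= x * (4 - (n%:R + 1) * x) by rewrite mulr_ge0// subr_ge0.
nra.
Qed.

Lemma expR_mul_le24 x : expR x * (4 - x) <= 24.
Proof.
apply: le_trans (@expR3_le R).
have -> : 3 = x + (3 - x) :> R by ring.
rewrite expRD ler_wpM2l ?expR_ge0//.
by have := expR_ge1Dx (3 - x); lra.
Qed.

(** [C(n,3) p^3] is [C(n,2) p^2] times [(n - 2) p / 3], and [(1 - p)^(n-2) >= exp (- x) >= (4 - x) /
    24] at [x = (n + 1) p]; the factor 8 is 24/3. *)
Lemma bin3_le p n : 0 <= p -> p <= 13 / 100 -> (n%:R + 1) * p < 4 -> (2 <= n)%N ->
  'C(n, 3)%:R * p ^+ 3 <=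
  8 * n%:R * ('C(n, 2)%:R * p ^+ 2 * (1 - p) ^+ (n - 2)) * p / (4 - (n%:R + 1) * p).
Proof.
move=> p0 p13 np4 n2.
have := one_sub_expX_ge p0 p13 (ltW np4) n2; have := expR_mul_le24 ((n%:R + 1) * p).
rewrite expRN.
have n2R : (n - 2)%:R = n%:R - 2 :> R by rewrite natrB.
have b3 : 'C(n, 3)%:R = 'C(n, 2)%:R * (n%:R - 2) / 3 :> R.
  by rewrite -n2R -natrM mulnC -mul_bin_left natrM; field.
have nr2 : 2 <= n%:R :> R by rewrite ler_nat.
have b2 : 0 <= 'C(n, 2)%:R :> R by [].
rewrite b3; have e0 := expR_gt0 ((n%:R + 1) * p).
move: (expR _) ('C(_, _)%:R) ((1 - p) ^+ _) e0 b2 => e b y e0 b2 e24 ey.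
rewrite ler_pdivlMr ?subr_gt0//.
have -> : b * (n%:R - 2) / 3 * p ^+ 3 * (4 - (n%:R + 1) * p) =
  b * p ^+ 3 * ((n%:R - 2) * (4 - (n%:R + 1) * p) / 3) by field.
have -> : 8 * n%:R * (b * p ^+ 2 * y) * p = b * p ^+ 3 * (8 * n%:R * y) by ring.
rewrite ler_wpM2l ?mulr_ge0// ?exprn_ge0//.
have y24 : (4 - (n%:R + 1) * p) / 24 <= y.
  apply: le_trans ey; by rewrite ler_pdivrMr// [leRHS]mulrC ler_pdivlMr// mulrC.
have : 0 <= 4 - (n%:R + 1) * p by rewrite subr_ge0 ltW.
move: y24 nr2; move: (4 - _) => v; move: (n%:R) => m; nra.
Qed.

End cell_bounds.

(** * The Stein-Chen and crowding errors in closed form *)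

Section error_terms.
Context {R : realType} {r : nat}.
Variables (p : 'I_r -> R) (n : nat).
Hypotheses (p0 : forall j, 0 < p j) (p1 : \sum_j p j = 1).
Hypotheses (p13 : forall j, p j <= 13 / 100).
Hypotheses (np4 : forall j, (n%:R + 1) * p j < 4) (n4 : (4 <= n)%N).

Let nR4 : 4 <= n%:R :> R. Proof. by rewrite ler_nat. Qed.
Let n2 : (2 <= n)%N. Proof. exact: leq_trans n4. Qed.
Let p_ge0 j : 0 <= p j. Proof. exact: ltW. Qed.
Let p_lt1 j : p j < 1. Proof. by have := p13 j; lra. Qed.

Lemma pi_gt0 j : 0 < pi_ n p j.
Proof.
rewrite /pi_ !mulr_gt0// ?exprn_gt0// ?subr_gt0//.
by rewrite ltr0n bin_gt0.
Qed.

Lemma mu_gt0 : (0 < r)%N -> 0 < mu_ n p.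
Proof.
move=> r0; rewrite /mu_ (bigD1 (Ordinal r0))//= ltr_wpDr ?pi_gt0//.
by apply: sumr_ge0 => j _; exact/ltW/pi_gt0.
Qed.

Lemma pi_ge j : 'C(n, 2)%:R * p j ^+ 2 <= 60 * pi_ n p j.
Proof.
have := one_sub_expX_ge (p_ge0 j) (p13 j) (ltW (np4 j)) n2 => le1.
have le2 : 1 <= 60 * (1 - p j) ^+ (n - 2).
  have : 1 / 60 <= expR (- ((n%:R + 1) * p j)).
    rewrite mul1r expRN lef_pV2 ?posrE ?expR_gt0//.
    apply: le_trans (@expR4_le R); rewrite ler_expR; exact: ltW.
  by lra.
have : 0 <= 'C(n, 2)%:R * p j ^+ 2 by rewrite mulr_ge0// exprn_ge0.
rewrite /pi_; move: ('C(n, 2)%:R * _) ((1 - _) ^+ _) le2 => a b; nra.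
Qed.

(** The factor 60 comes from [pi_ge], 1.52 bounds [(100/87)^3] with [1 - p_i >= 87/100], and 8/3
    comes from [n^2 <= 8/3 C(n,2)], valid for [n >= 4]. *)
Lemma ball_effect_le i : ball_effect p n i <=
  60 * (152 / 100) * (8 / 3 * mu_ n p / n%:R + \sum_j p j * pi_ n p j).
Proof.
have n0 : 0 < n%:R :> R by have := nR4; lra.
rewrite /mu_ mulr_sumr mulr_suml -big_split/= mulr_sumr; apply: ler_sum => j _.
have q_le : rest_cell p i j <= 100 / 87 * p j.
  rewrite /rest_cell /drop_cell; case: ifP => _.
    by rewrite mul0r mulr_ge0// divr_ge0.
  rewrite ler_pdivrMr ?subr_gt0//.
  by have := p13 i; have := p_ge0 j; nra.
have q0 := rest_cell_ge0 p_ge0 (p_lt1 i) j.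
have C0 : 0 <= 'C(n, 2)%:R :> R by [].
have pj0 := p_ge0 j.
have q2 : rest_cell p i j ^+ 2 <= 152 / 100 * p j ^+ 2.
  apply: (@le_trans _ _ ((100 / 87 * p j) ^+ 2)); last by have := sqr_ge0 (p j); lra.
  by rewrite lerXn2r// nnegrE// mulr_ge0// divr_ge0.
have q3 : rest_cell p i j ^+ 3 <= 152 / 100 * p j ^+ 3.
  apply: (@le_trans _ _ ((100 / 87 * p j) ^+ 3)).
    by rewrite lerXn2r// nnegrE// mulr_ge0// divr_ge0.
  have : 0 <= p j ^+ 3 by rewrite exprn_ge0.
  by lra.
have -> : rest_cell p i j *
  (n%:R * rest_cell p i j + 'C(n, 2)%:R * rest_cell p i j ^+ 2) =
  n%:R * rest_cell p i j ^+ 2 + 'C(n, 2)%:R * rest_cell p i j ^+ 3 by ring.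
apply: (@le_trans _ _ (n%:R * (152 / 100 * p j ^+ 2) +
    'C(n, 2)%:R * (152 / 100 * p j ^+ 3))).
  by rewrite lerD// ler_wpM2l.
have np2 : n%:R * p j ^+ 2 <= 60 * (8 / 3 * pi_ n p j / n%:R).
  rewrite [leRHS]mulrA ler_pdivlMr//.
  have := pi_ge j; have := @natr_bin2 R n.
  have := sqr_ge0 (p j); have := nR4.
  move: ('C(n, 2)%:R) (pi_ n p j) (p j ^+ 2) (n%:R) => b f x m m4 x0 eb bf.
  have : 0 <= m * (m - 4) * x by rewrite !mulr_ge0//; lra.
  have : 2 * b * x = m * (m - 1) * x by rewrite eb.
  nra.
have cp3 : 'C(n, 2)%:R * p j ^+ 3 <= 60 * (p j * pi_ n p j).
  have := pi_ge j; rewrite exprSr; nra.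
by lra.
Qed.

Lemma poisson_pairs_bound J : (0 < r)%N ->
  `|mexp p n (fun k => (pairs k <= J)%N%:R) - pcdf J.+1 (mu_ n p)| <=
  45 * Num.min 1 (mu_ n p)^-1 *
    (6 * n%:R * (\sum_j p j * pi_ n p j) ^+ 2 + \sum_j (pi_ n p j) ^+ 2
     + 24 * mu_ n p ^+ 2 / n%:R).
Proof.
move=> r0; have m0 := mu_gt0 r0.
have np4' j : n%:R * p j <= 4.
  by have := np4 j; have := p_ge0 j; rewrite mulrDl mul1r; lra.
apply: (le_trans (poisson_pairs_le J p_ge0 p1 p_lt1 n2 np4' m0)).
have sf0 : 0 <= stein_factor (mu_ n p).
  by rewrite /stein_factor le_min ler01 invr_ge0 ltW.
rewrite [leRHS]mulrAC [leRHS]mulrC ler_wpM2l//.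
have n0 : 0 < n%:R :> R by have := nR4; lra.
have S0 : 0 <= \sum_j p j * pi_ n p j.
  by apply: sumr_ge0 => j _; rewrite mulr_ge0// ltW// pi_gt0.
have Q0 : 0 <= \sum_j pi_ n p j ^+ 2 by apply: sumr_ge0 => j _; rewrite sqr_ge0.
have bd : \sum_i pi_ n p i * (pi_ n p i + 10 / 3 * ball_effect p n i) <=
    \sum_i pi_ n p i ^+ 2 + mu_ n p * (10 / 3 * (60 * (152 / 100) *
      (8 / 3 * mu_ n p / n%:R + \sum_j p j * pi_ n p j))).
  rewrite {1}/mu_ mulr_suml -big_split/=; apply: ler_sum => i _.
  rewrite mulrDr -expr2 lerD2l ler_wpM2l ?(ltW (pi_gt0 i))//.
  by rewrite ler_wpM2l ?ball_effect_le// divr_ge0.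
apply: (le_trans bd); move: m0 S0 Q0 n0.
move: (\sum_j p j * _) (\sum_j _ ^+ 2) (mu_ n p) (n%:R) => S V m x m0 S0 V0 x0.
(* AM-GM: 304 m S <= 270 x S^2 + 90 m^2 / x *)
have : 0 <= x * (3 * S - 17 / 10 * m / x) ^+ 2 by rewrite mulr_ge0 ?sqr_ge0// ltW.
have -> : x * (3 * S - 17 / 10 * m / x) ^+ 2 =
  9 * (x * S ^+ 2) - 102 / 10 * (m * S) + 289 / 100 * (m ^+ 2 / x) by field; lra.
have -> : m * (10 / 3 * (60 * (152 / 100) * (8 / 3 * m / x + S))) =
  304 * (m * S) + 304 * 8 / 3 * (m ^+ 2 / x) by field; lra.
have : 0 <= m ^+ 2 / x by rewrite divr_ge0 ?sqr_ge0// ltW.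
have : 0 <= m * S by rewrite mulr_ge0// ltW.
have -> : 24 * m ^+ 2 / x = 24 * (m ^+ 2 / x) by rewrite mulrA.
have -> : 6 * x * S ^+ 2 = 6 * (x * S ^+ 2) by rewrite mulrA.
move: (m ^+ 2 / x) (m * S) (x * S ^+ 2) => u v w; lra.
Qed.

(** Markov's inequality for the sum of [C(N_j, 3)], which is at least 1 on this event. *)
Lemma crowded_cells_bound :
  mexp p n (fun k => ([exists j, 2 < k j]%N)%:R) <=
  8 * n%:R * mu_ n p * max0 p / (4 - (n%:R + 1) * max0 p).
Proof.
apply: (@le_trans _ _ (\sum_j 'C(n, 3)%:R * p j ^+ 3)).
  under eq_bigr => j _ do rewrite -mexp_bin//.
  rewrite -mexp_sum; apply: le_mexp => // k _.
  case: existsP => [[j kj]|_]; last by rewrite sumr_ge0.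
  rewrite (bigD1 j)//= ler_wpDr ?sumr_ge0//.
  by rewrite ler1n bin_gt0.
rewrite [_ * mu_ n p]mulr_sumr mulr_suml mulr_suml; apply: ler_sum => j _.
apply: (le_trans (bin3_le (p_ge0 j) (p13 j) (np4 j) n2)).
have pj : p j <= max0 p by exact: le_bigmax.
have pm4 : (n%:R + 1) * max0 p < 4.
  rewrite mulrC -ltr_pdivlMr; last by have := nR4; lra.
  by apply: bigmax_lt => [|i _]; [rewrite divr_gt0//; have := nR4; lra|rewrite ltr_pdivlMr 1?mulrC//; have := nR4; lra].
have pm0 : 0 <= max0 p by exact: le_trans pj.
rewrite -/(pi_ n p j) -[leLHS]mulrA -[leRHS]mulrA ler_wpM2l//.
  by rewrite mulr_ge0// ltW// pi_gt0.
rewrite ler_pM ?invr_ge0 ?subr_ge0 ?(ltW (np4 j))//.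
rewrite lef_pV2 ?posrE ?subr_gt0// lerD2l lerN2 ler_wpM2l//; have := nR4; lra.
Qed.

End error_terms.

(** * The normalised statistic *)

Section linear_statistic.
Context {R : realType} {r : nat}.
Variables (p v : 'I_r -> R).
Hypotheses (p0 : forall j, 0 <= p j) (p1 : \sum_j p j = 1).
Hypothesis (pv0 : \sum_j p j * v j = 0).

Lemma linear_statistic_add_ball (k : 'I_r -> nat) j :
  \sum_i (add_ball k j i)%:R * v i = \sum_i (k i)%:R * v i + v j.
Proof.
rewrite /add_ball; under eq_bigr do rewrite natrD mulrDl.
rewrite big_split/=; congr (_ + _); rewrite (bigD1 j)//= eqxx mul1r big1 ?addr0//.
by move=> i /negbTE ->; rewrite mul0r.
Qed.

Lemma mexp_linear_sqr n :
  mexp p n (fun k => (\sum_i (k i)%:R * v i) ^+ 2) = n%:R * \sum_j p j * v j ^+ 2.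
Proof.
elim: n => [|n IHn] /=.
  by rewrite big1 ?expr0n ?mul0r// => i _; rewrite mul0r.
transitivity (\sum_j p j * (n%:R * (\sum_j p j * v j ^+ 2)) +
    \sum_j 2 * (p j * v j) * mexp p n (fun k => \sum_i (k i)%:R * v i) +
    \sum_j p j * v j ^+ 2).
  rewrite -!big_split/=; apply: eq_bigr => j _.
  rewrite -IHn [2 * _]mulrC -!mulrA -!mulrDr; congr (_ * _).
  rewrite -[v j ^+ 2](mexp_cst n _ p1) -!mexpZ -!mexpD.
  by apply: eq_mexp => k _; rewrite linear_statistic_add_ball; ring.
rewrite -!mulr_suml p1 mul1r -mulr_sumr pv0 mulr0 mul0r addr0 -natr1; ring.
Qed.

Lemma linear_statistic_chebyshev n (u : R) : 0 < u ->
  mexp p n (fun k => (u <= `|\sum_i (k i)%:R * v i|)%R%:R) <=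
  n%:R * (\sum_j p j * v j ^+ 2) / u ^+ 2.
Proof.
move=> u0; rewrite -mexp_linear_sqr mulrC -mexpZ; apply: le_mexp => // k _.
rewrite -[X in _ * X]real_normK ?num_real//.
case: (leP u) => [ux|_]; last by rewrite mulr_ge0 ?invr_ge0 ?exprn_ge0// ltW.
rewrite mulrC ler_pdivlMr ?exprn_gt0// mul1r lerXn2r// nnegrE//; exact: ltW.
Qed.

End linear_statistic.

(** * Splitting the statistic into pairs and a linear part *)

Section decomposition.
Context {R : realType} {r : nat}.
Variables (p : 'I_r -> R) (n : nat) (l : R).
Hypotheses (p0 : forall j, 0 < p j) (p1 : \sum_j p j = 1).
Hypotheses (n0 : (0 < n)%N) (l1 : -1 < l).

Let S := meanP p (fun x => x `^ (- l)).

Lemma mean_powRN_gt0 : 0 < S.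
Proof.
have [r0|r0] := posnP r.
  move: p1; rewrite big1 => [/esym/eqP|[i ir]]; first by rewrite oner_eq0.
  by exfalso; move: ir; rewrite r0.
rewrite /S /meanP (bigD1 (Ordinal r0))//= ltr_wpDr ?mulr_gt0 ?powR_gt0//.
by apply: sumr_ge0 => j _; rewrite mulr_ge0 ?powR_ge0// ltW.
Qed.

Definition cell_weight j : R := 1 / (p j `^ l * S).

Lemma cell_weight_close j : `|cell_weight j - 1| <= c_ l p.
Proof. exact: (le_bigmax _ (fun j => `|1 / (p j `^ l * S) - 1|)). Qed.

(** The case [l = 0] is the limit of the other formula, which explains its minus sign. *)
Definition linear_weight j : R :=
  if l == 0 then - (ln (p j) - meanP p (@ln R)) / (2 * ln 2)
  else (p j `^ (- l) - S) / (2 * (2 `^ l - 1) * S).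

Lemma mean_centered (f : R -> R) (c : R) :
  \sum_j p j * (c * (f (p j) - meanP p f)) = 0.
Proof.
under eq_bigr do rewrite mulrCA; rewrite -mulr_sumr.
under eq_bigr do rewrite mulrBr; rewrite sumrB -mulr_suml p1 mul1r.
by rewrite /meanP subrr mulr0.
Qed.

Lemma mean_linear_weight : \sum_j p j * linear_weight j = 0.
Proof.
rewrite /linear_weight; case: eqP => _.
  rewrite -[RHS](mean_centered (@ln R) (- (2 * ln 2)^-1)).
  by apply: eq_bigr => j _; congr (_ * _); rewrite [RHS]mulrC mulrN mulNr.
rewrite -[RHS](mean_centered (fun x => x `^ (- l)) (2 * (2 `^ l - 1) * S)^-1).
by apply: eq_bigr => j _; rewrite [_^-1 * _]mulrC.
Qed.

Lemma var_linear_weight : n%:R * (\sum_j p j * linear_weight j ^+ 2) = d_ l n p.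
Proof.
rewrite /d_ /linear_weight; case: eqP => _.
  rewrite -mulrA; congr (_ * _); rewrite /varP [X in X / _]/meanP mulr_suml.
  apply: eq_bigr => j _; rewrite -mulrA; congr (_ * _).
  rewrite expr_div_n sqrrN; congr (_ / _); ring.
rewrite -[RHS]mulrA; congr (_ * _); rewrite /varP [X in X / _]/meanP mulr_suml.
apply: eq_bigr => j _; rewrite -[RHS]mulrA; congr (_ * _).
rewrite expr_div_n; congr (_ / _); rewrite /S; ring.
Qed.

(** For a count [K] in {0, 1, 2}, [K K^l = K + 1(K = 2) 2 (2^l - 1)] when [l] is nonzero, and
    [K ln K = 1(K = 2) 2 ln 2]; everything else is affine in the counts. *)
Lemma statistic_decomposition k : (\sum_j k j = n)%N -> (forall j, (k j <= 2)%N) ->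
  normalised_power_divergence l n p k =
  \sum_j (k j == 2)%:R * cell_weight j + \sum_j (k j)%:R * linear_weight j.
Proof.
move=> kn k2; have S0 := mean_powRN_gt0.
have nR0 : 0 < n%:R :> R by rewrite ltr0n.
have kR : \sum_j (k j)%:R = n%:R :> R by rewrite -natr_sum kn.
have npR : \sum_j n%:R * p j = n%:R by rewrite -mulr_sumr p1 mulr1.
rewrite -big_split/= /normalised_power_divergence /power_divergence -/S.
rewrite [X in n%:R ^+ 2 * X]/meanP [X in _ * (X - _)]mulr_sumr.
rewrite [X in _ * (_ - X)]mulr_sumr -sumrB [LHS]mulr_sumr.
(* The two sides do not agree cell by cell; [e j] is the discrepancy, which sums to 0 because the
   counts add up to [n] and the [p j] to 1. *)
pose e j : R :=
  if l == 0 then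
    (- (k j)%:R * ln n%:R + n%:R * p j * ln n%:R + n%:R * (p j * ln (p j))
     - (k j)%:R * meanP p (@ln R)) / (2 * ln 2)
  else (- n%:R * (p j * p j `^ (- l)) + (k j)%:R * S
        - n%:R `^ l * (k j)%:R + n%:R `^ l * (n%:R * p j)) / (2 * (2 `^ l - 1) * S).
have e0 : \sum_j e j = 0.
  rewrite /e; case: (l == 0); rewrite -mulr_suml.
    rewrite !(sumrB, big_split)/= -!mulr_suml sumrN -!mulr_sumr kR p1 /meanP/=; ring.
  rewrite !(sumrB, big_split)/= -!mulr_suml -!mulr_sumr kR p1 /S /meanP/=; ring.
rewrite -[RHS]addr0 -[X in _ = _ + X]e0 -big_split/=; apply: eq_bigr => j _.
rewrite /e /g /cell_weight /linear_weight.
have pj0 := p0 j; have np0 : 0 < n%:R * p j by rewrite mulr_gt0.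
case: (eqVneq l 0) => [l0|l0].
  have S1 : S = 1.
    by rewrite -p1; apply: eq_bigr => i _; rewrite l0 oppr0 powRr0 mulr1.
  have ln2 : 0 < ln 2 :> R by rewrite ln_gt0//; lra.
  rewrite S1 l0 !powRr0 div1r lnV ?posrE// lnM ?posrE//.
  have : (k j)%:R * ln ((k j)%:R / (n%:R * p j)) =
      (k j == 2)%:R * (2 * ln 2) - (k j)%:R * (ln n%:R + ln (p j)).
    case: (posnP (k j)) => [->|kj]; first by rewrite !mul0r subr0.
    rewrite ln_div ?posrE ?ltr0n// lnM ?posrE// mulrBr; congr (_ - _).
    by case: (k j) (k2 j) kj => [|[|[|]]]//= _ _; rewrite ?ln1 ?mulr0 ?mul0r ?mul1r.
  move: (ln (_ / _)) (ln 2) (ln n%:R) (ln (p j)) (meanP _ _) ln2 nR0 pj0.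
  move: (k j)%:R (k j == 2)%:R (n%:R) (p j) => K b m x X L Lm Lx M L0 m0 x0 KX.
  have -> : m * (x * (2 * (K / (m * x)) * X)) = 2 * (K * X).
    by field; rewrite !gt_eqF.
  by rewrite KX; field; rewrite !gt_eqF.
have B0 : p j `^ l != 0 by rewrite gt_eqF// powR_gt0.
have A0 : n%:R `^ l != 0 :> R by rewrite gt_eqF// powR_gt0.
have D0 : 2 `^ l - 1 != 0 :> R.
  by apply/eqP => /eqP; rewrite subr_eq0 powR_eq1 (negbTE l0) orbF => /orP[/eqP|]; lra.
have l10 : l + 1 != 0 by rewrite gt_eqF// -ltrBlDr sub0r.
have xl (x : R) : 0 <= x ->
    (x / (n%:R * p j)) `^ l = x `^ l / (n%:R `^ l * p j `^ l).
  have npl : (n%:R * p j) `^ l = n%:R `^ l * p j `^ l.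
    by rewrite powRM//; exact: ltW.
  move=> x0; rewrite -npl powRM//; last by rewrite invr_ge0 (ltW np0).
  by congr (_ * _); rewrite -powRN -mulN1r powRrM powR_inv1// (ltW np0).
rewrite !xl// !powR1 !powRN.
have : (k j)%:R * (k j)%:R `^ l = (k j)%:R + (k j == 2)%:R * (2 * (2 `^ l - 1)) :> R.
  case: (k j) (k2 j) => [|[|[|]]]//= _; rewrite ?mul0r ?powR1 ?mul1r ?addr0//.
  by ring.
have S0' : S != 0 by rewrite gt_eqF.
move: S S0' ((k j)%:R `^ l) (2 `^ l) (n%:R `^ l) (p j `^ l) B0 A0 D0 nR0 pj0 l10 l0.
move: (k j)%:R (k j == 2)%:R (n%:R) (p j) => K b m x V V0 Kl t A B B0 A0 D0 m0 x0 l10 l0 KKl.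
have -> : m * (x * (2 * (K / (m * x)) * (Kl / (A * B) - 1) / (l * (l + 1)))) =
    (2 * (K * Kl / (A * B)) - 2 * K) / (l * (l + 1)).
  by field; rewrite l0 l10 A0 B0 !gt_eqF.
rewrite KKl; field; rewrite l0 l10 A0 B0 D0 V0 !gt_eqF//.
Qed.

End decomposition.

(** * Shifting the threshold *)

Section smoothing.
Context {R : realType}.
Implicit Types (m s t c D b x u w e k : R).

(* [s] is the variance of the linear part times sqrt mu, [dl] the width of
   the margin left for it and [th0 - e] the part of the margin still available
   when the quadratic part is off by [e]. *)
Lemma smoothing (th0 e al s b : R) : 0 <= s -> 0 <= al -> 0 <= e -> e < th0 -> e < 1 ->
  1 <= 4 * al * (th0 - e) * (4 / 10 * th0) ->
  1 <= (81 / 10 - 4 / 10 * al) * (1 - e) ^+ 2 ->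
  b = 81 / 10 * s \/ (exists t, [/\ 0 <= t, t ^+ 3 = s & b = 215 / 100 * t]) ->
  exists dl, [/\ 0 <= dl, 4 / 10 * dl <= b,
    forall w, th0 + dl <= w -> s / (w - e) ^+ 2 <= 4 / 10 * th0 + b,
    forall w, 1 <= w -> th0 + dl <= w -> w <= th0 + 1 + dl ->
      4 / 10 * (w - 1) + s / (w - e) ^+ 2 <= 4 / 10 * th0 + b
    & forall w, 1 + dl <= w -> s / w ^+ 2 <= b].
Proof.
move=> s0 al0 e0 eth e1 h1 h2 [->|[t [t0 ts ->]]].
(* A margin proportional to [s]: Chebyshev's bound is controlled through
   [4 al s (th0 - e) <= (th0 - e + al s)^2]. *)
- exists (al * s); have als : 0 <= al * s by rewrite mulr_ge0.
  have al81 : 4 / 10 * al <= 81 / 10.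
    rewrite leNgt; apply/negP => h; have := sqr_ge0 (1 - e).
    move: ((1 - e) ^+ 2) h2 => z; nra.
  split=> //.
  + by rewrite mulrA ler_wpM2r.
  + move=> w hw; have we0 : 0 < w - e by lra.
    apply: (@le_trans _ _ (4 / 10 * th0)); last by rewrite lerDl mulr_ge0.
    rewrite ler_pdivrMr ?exprn_gt0//.
    apply: (@le_trans _ _ (s * (4 * al * (th0 - e) * (4 / 10 * th0)))).
      by rewrite ler_peMr.
    have -> : s * (4 * al * (th0 - e) * (4 / 10 * th0)) =
      4 / 10 * th0 * (4 * (al * s) * (th0 - e)) by ring.
    rewrite ler_wpM2l//; first by lra.
    apply: (@le_trans _ _ ((th0 - e + al * s) ^+ 2)).
      by have := sqr_ge0 (th0 - e - al * s); nra.
    by rewrite lerXn2r ?nnegrE//; lra.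
  + move=> w w1 hw hw'.
    have : s / (w - e) ^+ 2 <= s * (81 / 10 - 4 / 10 * al).
      rewrite ler_pdivrMr; last by rewrite exprn_gt0//; lra.
      rewrite -[leRHS]mulrA ler_peMr//; apply: (le_trans h2).
      rewrite ler_wpM2l//; first by lra.
      by rewrite lerXn2r ?nnegrE//; lra.
    by nra.
  + move=> w hw; rewrite ler_pdivrMr; last by rewrite exprn_gt0//; lra.
    have w1 : 1 <= w by lra.
    have : 1 <= w ^+ 2 by rewrite expr_ge1//; lra.
    by nra.
(* With margin [t], the cube root of [s], Chebyshev's bound [s / w^2] is at most [t] as soon as
   [w >= t]. *)
- have ratio w : 0 < w -> t <= w -> s / w ^+ 2 <= t.
    move=> w0 tw; rewrite ler_pdivrMr ?exprn_gt0// -ts exprS ler_wpM2l//.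
    by rewrite lerXn2r// nnegrE// ltW.
  exists t; split=> //.
  + by lra.
  + by move=> w hw; have := @ratio (w - e); lra.
  + by move=> w w1 hw hw'; have := @ratio (w - e); lra.
  + by move=> w hw; have := @ratio w; lra.
Qed.

(** Brings the minimum of the theorem, multiplied by [sqrt m], into the form expected by
    [smoothing]. *)
Lemma variance_term m D : 0 < m -> 0 <= D ->
  let b := Num.min (81 / 10 * D) (215 / 100 * (D / m) `^ (1 / 3)) * Num.sqrt m in
  b = 81 / 10 * (D * Num.sqrt m) \/
  (exists t, [/\ 0 <= t, t ^+ 3 = D * Num.sqrt m & b = 215 / 100 * t]).
Proof.
move=> m0 D0 b; have s0 : 0 < Num.sqrt m by rewrite sqrtr_gt0.
rewrite /b; case: (leP (81 / 10 * D)) => _; [left|right]; first by rewrite mulrA.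
exists ((D / m) `^ (1 / 3) * Num.sqrt m); split; last by rewrite mulrA.
  by rewrite mulr_ge0 ?powR_ge0// ltW.
rewrite exprMn -powR_mulrn ?powR_ge0// -powRrM mulrC.
have -> : 1 / 3 * 3%:R = 1 :> R by lra.
rewrite powRr1 ?divr_ge0// ?ltW// exprS sqr_sqrtr ?ltW//.
by field; rewrite gt_eqF.
Qed.

(** As [exp 2.88 <= 18], the hypothesis gives [2.88 + 0.49 ln a / c < 0]; multiplication by
    [c / 0.49] removes the awkward exponent. *)
Lemma exp_term_small a c : 0 < a -> 0 < c ->
  18 * a `^ (49 / 100 / c) < 1 -> expR (288 / 49 * c) * a < 1.
Proof.
move=> a0 c0; rewrite /powR (gt_eqF a0) => h.
have : expR (72 / 25 + 49 / 100 / c * ln a) < 1.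
  rewrite expRD; apply: le_lt_trans h.
  by rewrite ler_wpM2r ?expR_ge0// expR288_le.
rewrite -[X in _ < X]expR0 ltr_expR => h'.
have : 288 / 49 * c + ln a < 0.
  have -> : 288 / 49 * c + ln a = (72 / 25 + 49 / 100 / c * ln a) * (100 / 49 * c).
    by field; rewrite gt_eqF.
  by rewrite pmulr_llt0// mulr_gt0.
have -> : expR (288 / 49 * c) * a = expR (288 / 49 * c + ln a).
  by rewrite expRD (@lnK R a).
by rewrite -[X in _ -> _ < X]expR0 ltr_expR.
Qed.

(** [x^3 / (x + g)^2] increases, is at least [h] at [k] and is below [h] at [K]. *)
Lemma cubic_threshold (h g k K : R) : 0 < h -> 0 < g -> 0 < k ->
  h * (k + g) ^+ 2 <= k ^+ 3 -> K ^+ 3 < h * (K + g) ^+ 2 -> K <= k.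
Proof.
move=> h0 g0 k0 hk hK; rewrite leNgt; apply/negP => kK.
have K0 : 0 < K by exact: lt_trans kK.
have : k ^+ 3 * (K + g) ^+ 2 <= K ^+ 3 * (k + g) ^+ 2.
  rewrite !exprS !expr0 !mulr1.
  have -> : k * (k * k) * ((K + g) * (K + g)) = k * (k * (K + g)) ^+ 2 by ring.
  have -> : K * (K * K) * ((k + g) * (k + g)) = K * (K * (k + g)) ^+ 2 by ring.
  have kKg : k * (K + g) <= K * (k + g).
    by rewrite !mulrDr [K * k]mulrC lerD2l ler_wpM2r ?ltW.
  have kg0 : 0 <= k * (K + g) by rewrite mulr_ge0 ?addr_ge0 ?ltW.
  by rewrite ler_pM ?sqr_ge0 ?(ltW k0) ?(ltW kK)// lerXn2r ?nnegrE ?(le_trans kg0).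
have Kg : 0 < (K + g) ^+ 2 by rewrite exprn_gt0// addr_gt0.
have kg : 0 < (k + g) ^+ 2 by rewrite exprn_gt0// addr_gt0.
apply/negP; rewrite -ltNge.
apply: (@lt_le_trans _ _ (h * (K + g) ^+ 2 * (k + g) ^+ 2)); first by rewrite ltr_pM2r.
by rewrite mulrAC ler_pM2r.
Qed.

Lemma quadratic_threshold (h g k K : R) : 0 < h -> 0 < g -> 0 < k ->
  h * (k + g) <= k ^+ 2 -> K ^+ 2 < h * (K + g) -> K <= k.
Proof.
move=> h0 g0 k0 hk hK; rewrite leNgt; apply/negP => kK.
have K0 : 0 < K by exact: lt_trans kK.
have : (K - k) * (K * k + g * (K + k)) <= 0.
  have -> : (K - k) * (K * k + g * (K + k)) = K ^+ 2 * (k + g) - k ^+ 2 * (K + g) by ring.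
  rewrite subr_le0; apply: (@le_trans _ _ (h * (K + g) * (k + g))).
    by rewrite ler_wpM2r ?addr_ge0// ltW.
  by rewrite mulrAC ler_wpM2r ?addr_ge0// ltW.
apply/negP; rewrite -ltNge mulr_gt0 ?subr_gt0//.
by rewrite addr_gt0 ?mulr_gt0 ?addr_gt0.
Qed.

Lemma tail_le_of_mul z y s a : 0 < s -> 0 <= z -> z <= y ->
  s <= a * (2 + 3 / 2 * z + 11 / 10 * z ^+ 2) -> 1 - Phi y <= a / s.
Proof.
move=> s0 z0 zy h.
apply: (@le_trans _ _ (1 - Phi z)); first by rewrite lerD2l lerN2 Phi_nondecr.
apply: (le_trans (gaussian_tail z0)); have := sqr_ge0 z => zz.
rewrite -[_^-1]mul1r ler_pdivrMr; last by lra.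
by rewrite mulrAC ler_pdivlMr// mul1r.
Qed.

Lemma lower_exp_tail s c : 47 / 99 < s -> 0 < c ->
  expR (288 / 49 * c) * (111 / 20 * s ^+ 2 * c) < 1 ->
  1 - Phi ((3 / 10 / c - 351 / 250 - s ^+ 2) / s) <= 47 / 99 / s.
Proof.
move=> s1 c0 hexp; have s0 : 0 < s by lra.
have ex : (1 + 144 / 49 * c) ^+ 2 <= expR (288 / 49 * c).
  have -> : 288 / 49 * c = 144 / 49 * c + 144 / 49 * c by lra.
  rewrite expRD -expr2 lerXn2r ?nnegrE ?expR_ge0//; last exact: expR_ge1Dx.
  lra.
have k0 : 0 < 3 / 10 / c by apply: divr_gt0 => //; lra.
have hk : 333 / 200 * s ^+ 2 * (3 / 10 / c + 216 / 245) ^+ 2 <= (3 / 10 / c) ^+ 3.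
  have c30 : 0 < 27 / 1000 / c ^+ 3 by apply: divr_gt0; [lra|exact: exprn_gt0].
  have -> : 333 / 200 * s ^+ 2 * (3 / 10 / c + 216 / 245) ^+ 2 =
    27 / 1000 / c ^+ 3 * ((1 + 144 / 49 * c) ^+ 2 * (111 / 20 * s ^+ 2 * c)).
    by field; rewrite gt_eqF.
  have -> : (3 / 10 / c) ^+ 3 = 27 / 1000 / c ^+ 3 * 1.
    by rewrite mulr1; field; rewrite gt_eqF.
  rewrite (ler_pM2l c30); apply: le_trans (ltW hexp).
  apply: ler_wpM2r; last exact: ex.
  by rewrite (pmulr_lge0 _ c0) (pmulr_lge0 _ (exprn_gt0 2 s0)); lra.
have h0 : 0 < 333 / 200 * s ^+ 2 by rewrite (pmulr_lgt0 _ (exprn_gt0 2 s0)); lra.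
have g0 : 0 < 216 / 245 :> R by lra.
have thr K : K ^+ 3 < 333 / 200 * s ^+ 2 * (K + 216 / 245) ^+ 2 -> K <= 3 / 10 / c.
  exact: cubic_threshold.
move: (3 / 10 / c) k0 thr => k k0 thr {hk hexp ex}.
have [s949|s949] := leP s (949 / 1000).
  have hK : 67 / 25 * s - 233 / 1000 <= k.
    apply: thr.
    have : 0 <= (s * (s - 563 / 1000)) ^+ 2 by rewrite sqr_ge0.
    nra.
  have hK' : s ^+ 2 + 5 / 4 * s + 87 / 400 <= k by apply: le_trans hK; nra.
  have [z0|z0] := leP 0 ((k - 351 / 250 - s ^+ 2) / s).
    have := Phi_nondecr z0; rewrite Phi0 => h.
    apply: (@le_trans _ _ (1 / 2)); first by lra.
    by rewrite ler_pdivlMr//; lra.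
  have := Phi_ge_lin (ltW z0) => h.
  apply: (@le_trans _ _ (1 / 2 - 4 / 10 * ((k - 351 / 250 - s ^+ 2) / s))).
    by lra.
  have : (k - 351 / 250 - s ^+ 2) / s * s = k - 351 / 250 - s ^+ 2.
    by rewrite divfK// gt_eqF.
  rewrite ler_pdivlMr//; move: (_ / s) => q; lra.
have [s12|s12] := leP s (6 / 5).
  have hK : 49 / 20 * s + 53 / 200 <= k.
    apply: thr; nra.
  apply: (@tail_le_of_mul (3 / 10) _ _ _ s0); [lra| |lra].
  rewrite ler_pdivlMr//; nra.
have hK : 3 / 2 * s ^+ 2 + 351 / 250 <= k.
  have m1 : 36 / 25 <= s ^+ 2 by nra.
  by apply: thr; move: (s ^+ 2) m1 => m m1; nra.
apply: (@tail_le_of_mul (1 / 2 * s) _ _ _ s0); first by lra.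
  by rewrite ler_pdivlMr//; nra.
by have := sqr_ge0 (s - 5 / 2); nra.
Qed.

(** Here a single factor [1 + 288/49 c] suffices and gives [0.36 / c >= 1.998 s^2 + 3/4]. The value
    23/125 = 0.184 fits into what 0.29 leaves of 47/99. *)
Lemma upper_exp_tail s c : 47 / 99 < s -> 0 < c ->
  expR (288 / 49 * c) * (111 / 20 * s ^+ 2 * c) < 1 ->
  1 - Phi ((9 / 25 / c - s ^+ 2) / s) <= 23 / 125 / s.
Proof.
move=> s1 c0 hexp; have s0 : 0 < s by lra.
have ex := expR_ge1Dx (288 / 49 * c).
have k0 : 0 < 9 / 25 / c by apply: divr_gt0 => //; lra.
have hk : 999 / 500 * s ^+ 2 * (9 / 25 / c + 2592 / 1225) <= (9 / 25 / c) ^+ 2.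
  have c30 : 0 < 81 / 625 / c ^+ 2 by apply: divr_gt0; [lra|exact: exprn_gt0].
  have -> : 999 / 500 * s ^+ 2 * (9 / 25 / c + 2592 / 1225) =
    81 / 625 / c ^+ 2 * ((1 + 288 / 49 * c) * (111 / 20 * s ^+ 2 * c)).
    by field; rewrite gt_eqF.
  have -> : (9 / 25 / c) ^+ 2 = 81 / 625 / c ^+ 2 * 1.
    by rewrite mulr1; field; rewrite gt_eqF.
  rewrite (ler_pM2l c30); apply: le_trans (ltW hexp).
  apply: ler_wpM2r; last exact: ex.
  by rewrite (pmulr_lge0 _ c0) (pmulr_lge0 _ (exprn_gt0 2 s0)); lra.
have h0 : 0 < 999 / 500 * s ^+ 2 by rewrite (pmulr_lgt0 _ (exprn_gt0 2 s0)); lra.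
have hK : 999 / 500 * s ^+ 2 + 3 / 4 <= 9 / 25 / c.
  apply: (quadratic_threshold h0 _ k0 hk); first by lra.
  have m1 : 9 / 40 <= s ^+ 2 by nra.
  by move: (s ^+ 2) m1 => m m1; nra.
move: (9 / 25 / c) hK => k hK {hk hexp ex k0}.
have si0 : 0 < 3 / 4 / s by apply: divr_gt0 s0; lra.
apply: (@tail_le_of_mul (499 / 500 * s + 3 / 4 / s) _ _ _ s0).
- by lra.
- rewrite ler_pdivlMr// mulrDl divfK ?gt_eqF//; nra.
have i0 : 0 < s^-1 by rewrite invr_gt0.
have si : s * s^-1 = 1 by rewrite divff// gt_eqF.
move: (s^-1) i0 si => i i0 si.
have -> : (499 / 500 * s + 3 / 4 * i) ^+ 2 =
  (499 / 500) ^+ 2 * s ^+ 2 + 3 / 2 * (499 / 500) * (s * i) + 9 / 16 * i ^+ 2 by field.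
rewrite si.
have i2 : 0 <= i ^+ 2 by rewrite sqr_ge0.
suff : 0 <= 23 / 125 * (2 + 3 / 2 * (499 / 500 * s + 3 / 4 * i) +
    11 / 10 * ((499 / 500) ^+ 2 * s ^+ 2 + 3 / 2 * (499 / 500))) - s by lra.
have : 0 <= s * (23 / 125 * (2 + 3 / 2 * (499 / 500 * s + 3 / 4 * i) +
    11 / 10 * ((499 / 500) ^+ 2 * s ^+ 2 + 3 / 2 * (499 / 500))) - s).
  have -> : s * (23 / 125 * (2 + 3 / 2 * (499 / 500 * s + 3 / 4 * i) +
    11 / 10 * ((499 / 500) ^+ 2 * s ^+ 2 + 3 / 2 * (499 / 500))) - s) =
    23 / 125 * (2 * s + 3 / 2 * (499 / 500 * s ^+ 2 + 3 / 4 * (s * i)) +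
    11 / 10 * ((499 / 500) ^+ 2 * s ^+ 3 + 3 / 2 * (499 / 500) * s)) - s ^+ 2 by field.
  rewrite si.
  have : 0 <= s * (s - 37 / 20) ^+ 2 by rewrite mulr_ge0 ?sqr_ge0// ltW.
  have : 0 <= (s - 37 / 20) ^+ 2 by rewrite sqr_ge0.
  nra.
by rewrite pmulr_rge0.
Qed.

End smoothing.

(** * Choice of the integer threshold *)

Section thresholds.
Context {R : realType}.
Variables (m c D b x : R).
Hypotheses (m0 : 0 < m) (c0 : 0 <= c) (D0 : 0 <= D).

Let sg := Num.sqrt m.

Hypothesis sg_ge : 47 / 99 < Num.sqrt m.
Hypothesis hexp : 0 < c -> expR (288 / 49 * c) * (111 / 20 * m * c) < 1.
Hypothesis hb : b = 81 / 10 * (D * Num.sqrt m) \/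
  (exists t, [/\ 0 <= t, t ^+ 3 = D * Num.sqrt m & b = 215 / 100 * t]).

Let sg0 : 0 < sg. Proof. by rewrite sqrtr_gt0. Qed.
Let sgm : sg ^+ 2 = m. Proof. by rewrite sqr_sqrtr// ltW. Qed.
Let s0 : 0 <= D * sg. Proof. by rewrite mulr_ge0// ltW. Qed.

Let varE w : D / w = D * sg / w / sg.
Proof. by rewrite mulrAC mulfK ?gt_eqF. Qed.

Lemma Phi_shift_le a w : Phi ((a + (w - 1)) / sg) <=
  Phi (a / sg) + (if w <= 1 then 0 else 4 / 10 * (w - 1) / sg).
Proof.
case: (leP w 1) => w1.
  by rewrite addr0 Phi_nondecr// ler_pM2r ?invr_gt0//; lra.
have h : a / sg <= (a + (w - 1)) / sg by rewrite ler_pM2r ?invr_gt0//; lra.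
have := Phi_lip h; rewrite -mulrBl addrAC subrr add0r mulrA; lra.
Qed.

Lemma Phi_ge_sub a e : 0 <= e -> Phi (a / sg) - 4 / 10 * e / sg <= Phi ((a - e) / sg).
Proof.
move=> e0.
have h : (a - e) / sg <= a / sg by rewrite ler_pM2r ?invr_gt0//; lra.
have := Phi_lip h; rewrite -mulrBl opprB addrCA subrr addr0 mulrA; lra.
Qed.

Lemma smoothed_bound (th0 e dl a w : R) : e < th0 -> 0 <= dl ->
  (forall w, th0 + dl <= w -> D * sg / (w - e) ^+ 2 <= 4 / 10 * th0 + b) ->
  (forall w, 1 <= w -> th0 + dl <= w -> w <= th0 + 1 + dl ->
      4 / 10 * (w - 1) + D * sg / (w - e) ^+ 2 <= 4 / 10 * th0 + b) ->
  th0 + dl <= w -> w <= th0 + 1 + dl ->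
  Phi ((a + (w - 1)) / sg) + D / (w - e) ^+ 2 <= Phi (a / sg) + (4 / 10 * th0 + b) / sg.
Proof.
move=> eth dl0 h1 h2 w1 w2; have := Phi_shift_le a w; rewrite varE.
case: (leP w 1) => ww h.
  apply: lerD; first by move: h; rewrite addr0.
  by rewrite ler_pM2r ?invr_gt0// h1.
apply: (le_trans (lerD h (lexx _))); rewrite -addrA lerD2l -mulrDl.
by rewrite ler_pM2r ?invr_gt0// h2// ltW.
Qed.

(** [k] is the least integer above [x + 0.404 + dl], or 0 when that number is negative. If
    [c k > 0.3], then [x] is so large that the Gaussian tail beyond it is within the error, which is
    the first alternative. *)
Lemma lower_threshold :
  1 <= Phi ((x - m) / sg) + (47 / 99 + b) / sg \/
  exists (k : nat) (u : R), [/\ 0 < u, c * k%:R <= 3 / 10, u + x + 3 / 10 <= k%:R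
    & pcdf k m + D / u ^+ 2 <= Phi ((x - m) / sg) + (47 / 99 + b) / sg].
Proof.
(* 14.9 is nearly the least [al] with [4 al (th0 - e) 0.4 th0 >= 1], which leaves the most room in
   the other constraint. *)
have [|||||||dl [dl0 dlb h1 h2 _]] :=
  @smoothing R (101 / 250) (3 / 10) (149 / 10) (D * sg) b _ _ _ _ _ _ _ hb.
- exact: s0.
- lra.
- lra.
- lra.
- lra.
- lra.
- lra.
have [v0|v0] := leP 0 (x + 101 / 250 + dl); last first.
  right; exists 0%N, (- x - 3 / 10); split; [lra|by rewrite mulr0; lra|lra|].
  rewrite pcdf0 add0r varE; apply: (@le_trans _ _ ((47 / 99 + b) / sg)); last first.
    by rewrite lerDr Phi_ge0.
  rewrite ler_pM2r ?invr_gt0//; apply: (le_trans (h1 _ _)); lra.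
have /andP[k1 k2] := truncn_itv v0; set K := Num.truncn _ in k1 k2.
pose w : R := K.+1%:R - x.
have wl : 101 / 250 + dl <= w by rewrite /w; lra.
have wu : w <= 101 / 250 + 1 + dl by rewrite /w -natr1; lra.
have [ck|ck] := leP (c * K.+1%:R) (3 / 10).
  right; exists K.+1, (w - 3 / 10); split; [lra|exact: ck|rewrite /w; lra|].
  have := poisson_normal_lower K m0.
  have : (K%:R - m) / sg = (x - m + (w - 1)) / sg.
    by congr (_ / _); rewrite /w -natr1; ring.
  rewrite -/sg => -> hP.
  have := @smoothed_bound (101 / 250) (3 / 10) dl (x - m) w _ dl0 h1 h2 wl wu.
  move=> hs; have {}hs := hs ltac:(lra).
  have : (4 / 10 * (101 / 250) + b) / sg + 313 / 1000 / sg <= (47 / 99 + b) / sg.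
    by rewrite -mulrDl ler_pM2r ?invr_gt0//; lra.
  lra.
left; have c1 : 0 < c.
  rewrite lt_def c0 andbT; apply/eqP => cc; move: ck; rewrite cc mul0r; lra.
have hk : 3 / 10 / c < K.+1%:R by rewrite ltr_pdivrMr// [_ * c]mulrC.
have := @lower_exp_tail R sg c sg_ge c1; rewrite sgm => /(_ (hexp c1)) ht.
have := @Phi_ge_sub (3 / 10 / c - 351 / 250 - m) dl dl0.
have : Phi ((3 / 10 / c - 351 / 250 - m - dl) / sg) <= Phi ((x - m) / sg).
  by apply: Phi_nondecr; rewrite ler_pM2r ?invr_gt0//; move: wu; rewrite /w; lra.
have : 47 / 99 / sg + 4 / 10 * dl / sg <= (47 / 99 + b) / sg.
  by rewrite -mulrDl ler_pM2r ?invr_gt0//; lra.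
lra.
Qed.

(** When [x < 0.46 + dl] the right-hand side already exceeds 1. Otherwise the integer is the floor
    of [x - 0.46 - dl]; if [c] is too large for it, it is lowered to the floor of [0.36 / c], which
    only widens the room [u], and [upper_exp_tail] shows that the Poisson tail is still within the
    error. *)
Lemma upper_threshold :
  1 <= 1 - Phi ((x - m) / sg) + (47 / 99 + b) / sg \/
  exists (j : nat) (u : R), [/\ 0 < u, c * j%:R <= 9 / 25, j%:R + 9 / 25 + u <= x
    & 1 - pcdf j.+1 m + D / u ^+ 2 <= 1 - Phi ((x - m) / sg) + (47 / 99 + b) / sg].
Proof.
have [|||||||dl [dl0 dlb h1 h2 h3]] :=
  @smoothing R (23 / 50) (9 / 25) (68 / 5) (D * sg) b _ _ _ _ _ _ _ hb.
- exact: s0.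
- lra.
- lra.
- lra.
- lra.
- lra.
- lra.
have negE : 1 - Phi ((x - m) / sg) = Phi ((m - x) / sg).
  by rewrite -PhiN -mulNr opprB.
have [v0|v0] := leP 0 (x - 23 / 50 - dl); last first.
  left; rewrite negE; have := poisson_normal_upper 0 m0; rewrite pcdf0 -/sg.
  have := @Phi_ge_sub m (23 / 50 + dl); rewrite subr0 subr0 => /(_ ltac:(lra)).
  have : Phi ((m - (23 / 50 + dl)) / sg) <= Phi ((m - x) / sg).
    by apply: Phi_nondecr; rewrite ler_pM2r ?invr_gt0//; lra.
  have : 29 / 100 / sg + 4 / 10 * (23 / 50 + dl) / sg <= (47 / 99 + b) / sg.
    by rewrite -mulrDl ler_pM2r ?invr_gt0//; lra.
  lra.
have /andP[k1 k2] := truncn_itv v0; set K := Num.truncn _ in k1 k2.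
pose w : R := x - K%:R.
have wl : 23 / 50 + dl <= w by rewrite /w; lra.
have wu : w <= 23 / 50 + 1 + dl by rewrite /w; move: k2; rewrite -natr1; lra.
have [ck|ck] := leP (c * K%:R) (9 / 25).
  right; exists K, (w - 9 / 25); split; [lra|exact: ck|rewrite /w; lra|].
  have := poisson_normal_upper K.+1 m0.
  have : (m - K.+1%:R) / sg = (m - x + (w - 1)) / sg.
    by congr (_ / _); rewrite /w -natr1; ring.
  rewrite -/sg negE => -> hP.
  have := @smoothed_bound (23 / 50) (9 / 25) dl (m - x) w _ dl0 h1 h2 wl wu.
  move=> hs; have {}hs := hs ltac:(lra).
  have : (4 / 10 * (23 / 50) + b) / sg + 29 / 100 / sg <= (47 / 99 + b) / sg.
    by rewrite -mulrDl ler_pM2r ?invr_gt0//; lra.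
  lra.
have c1 : 0 < c.
  rewrite lt_def c0 andbT; apply/eqP => cc; move: ck; rewrite cc mul0r; lra.
have hk : 9 / 25 / c < K%:R by rewrite ltr_pdivrMr// [_ * c]mulrC.
have q0 : 0 <= 9 / 25 / c by apply: divr_ge0 => //; lra.
have /andP[j1 j2] := truncn_itv q0; set j := Num.truncn _ in j1 j2.
have jK : (j < K)%N by rewrite -(ltr_nat R); exact: le_lt_trans hk.
have jK' : j%:R + 1 <= K%:R :> R by rewrite natr1 ler_nat.
right; exists j, (x - j%:R - 9 / 25); split.
- by move: wl; rewrite /w; lra.
- by rewrite [c * _]mulrC -ler_pdivlMr.
- lra.
have := poisson_normal_upper j.+1 m0; rewrite -/sg.
have := @upper_exp_tail R sg c sg_ge c1; rewrite sgm => /(_ (hexp c1)).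
rewrite -PhiN -mulNr opprB.
have : Phi ((m - j.+1%:R) / sg) <= Phi ((m - 9 / 25 / c) / sg).
  by apply: Phi_nondecr; rewrite ler_pM2r ?invr_gt0//; lra.
have : D / (x - j%:R - 9 / 25) ^+ 2 <= b / sg.
  rewrite varE ler_pM2r ?invr_gt0//; apply: h3; move: wl; rewrite /w; lra.
have : b / sg + 23 / 125 / sg + 29 / 100 / sg <= (47 / 99 + b) / sg.
  by rewrite -!mulrDl ler_pM2r ?invr_gt0//; lra.
have := Phi_le1 ((x - m) / sg).
lra.
Qed.

End thresholds.

(** * Tail probabilities of the statistic *)

Section tail_comparison.
Context {R : realType} {r : nat}.
Variables (p : 'I_r -> R) (n : nat) (l : R).
Hypotheses (p0 : forall j, 0 < p j) (p1 : \sum_j p j = 1).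
Hypotheses (p13 : forall j, p j <= 13 / 100).
Hypotheses (np4 : forall j, (n%:R + 1) * p j < 4) (n4 : (4 <= n)%N).
Hypotheses (r0 : (0 < r)%N) (l1 : -1 < l).

Let T k := normalised_power_divergence l n p k.
Let linear_part (k : 'I_r -> nat) := \sum_j (k j)%:R * linear_weight p l j.
Let quadratic_part (k : 'I_r -> nat) := \sum_j (k j == 2)%:R * cell_weight p l j.
Let crowded (k : 'I_r -> nat) := [exists j, 2 < k j]%N.
Let p_ge0 j : 0 <= p j. Proof. exact: ltW. Qed.
Let n0 : (0 < n)%N. Proof. exact: leq_trans n4. Qed.

Lemma cell_weight_ge0 j : 0 <= cell_weight p l j.
Proof.
by rewrite /cell_weight divr_ge0// mulr_ge0 ?powR_ge0// ltW// mean_powRN_gt0.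
Qed.

Lemma natr_pairs (k : 'I_r -> nat) : (pairs k)%:R = \sum_j (k j == 2)%:R :> R.
Proof. by rewrite /pairs natr_sum. Qed.

Lemma quadratic_part_le k : quadratic_part k <= (1 + c_ l p) * (pairs k)%:R.
Proof.
rewrite natr_pairs mulr_sumr; apply: ler_sum => j _; rewrite mulrC ler_wpM2r//.
by have := cell_weight_close p l j; rewrite ler_norml; lra.
Qed.

Lemma quadratic_part_ge k : (1 - c_ l p) * (pairs k)%:R <= quadratic_part k.
Proof.
rewrite natr_pairs mulr_sumr; apply: ler_sum => j _; rewrite [leRHS]mulrC ler_wpM2r//.
by have := cell_weight_close p l j; rewrite ler_norml; lra.
Qed.

Lemma statisticE k : (\sum_j k j = n)%N -> ~~ crowded k ->
  T k = quadratic_part k + linear_part k.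
Proof.
move=> kn; rewrite negb_exists => /forallP k2.
by apply: statistic_decomposition => // j; rewrite leqNgt k2.
Qed.

Let chebyshev (u : R) : 0 < u ->
  mexp p n (fun k => (u <= `|linear_part k|)%R%:R) <= d_ l n p / u ^+ 2.
Proof.
rewrite -(var_linear_weight p n l).
by apply: linear_statistic_chebyshev => //; exact: mean_linear_weight.
Qed.

Let c0 : 0 <= c_ l p. Proof. exact: bigmax_ge_id. Qed.

(** With at least [k] pairs, no crowded cell and a linear part below [u] in absolute value, the
    statistic exceeds [k - 0.3 - u >= x]. The exceptional events are charged separately. *)
Lemma tail_ge x k u : 0 < u -> c_ l p * k%:R <= 3 / 10 -> u + x + 3 / 10 <= k%:R ->
  1 <= mexp p n (fun h => (x <= T h)%R%:R) + mexp p n (fun h => (pairs h < k)%N%:R)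
    + d_ l n p / u ^+ 2 + mexp p n (fun h => (crowded h)%:R).
Proof.
move=> u0 ck uk.
apply: (@le_trans _ _ (mexp p n (fun h => (x <= T h)%R%:R)
  + mexp p n (fun h => (pairs h < k)%N%:R)
  + mexp p n (fun h => (u <= `|linear_part h|)%R%:R)
  + mexp p n (fun h => (crowded h)%:R))); last first.
  by rewrite lerD2r lerD2l chebyshev.
rewrite -!mexpD -[leLHS](mexp_cst n _ p1); apply: le_mexp => // h hn.
case: (boolP (crowded h)) => [_|hc]; first by rewrite lerDr !addr_ge0.
case: (leP u) => [_|Lu]; first by rewrite addr0 lerDr !addr_ge0.
case: (ltnP (pairs h) k) => [_|kh]; first by rewrite !addr0 lerDr.
case: (leP x) => [_|Tx]; first by rewrite !addr0.
exfalso; move: Tx Lu; rewrite (statisticE hn hc) ltr_norml => Tx /andP[Lu _].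
suff : k%:R - 3 / 10 <= quadratic_part h by lra.
(* For [k = 0] nothing bounds [c_ l p] and [1 - c_ l p] may be negative; nonnegativity of the
   weights replaces [quadratic_part_ge]. *)
case: k => [|k] in ck uk kh *.
  have : 0 <= quadratic_part h.
    by apply: sumr_ge0 => j _; rewrite mulr_ge0// cell_weight_ge0.
  lra.
have c1 : c_ l p <= 1.
  have : 1 <= k.+1%:R :> R by rewrite ler1n.
  by have := c0; nra.
apply: le_trans (quadratic_part_ge h).
apply: (@le_trans _ _ ((1 - c_ l p) * k.+1%:R)); first by lra.
by rewrite ler_wpM2l ?subr_ge0// ler_nat.
Qed.

Lemma tail_le x j u : 0 < u -> c_ l p * j%:R <= 9 / 25 -> j%:R + 9 / 25 + u <= x ->
  mexp p n (fun h => (x <= T h)%R%:R) <=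
  1 - mexp p n (fun h => (pairs h <= j)%N%:R)
    + d_ l n p / u ^+ 2 + mexp p n (fun h => (crowded h)%:R).
Proof.
move=> u0 cj uj.
apply: (@le_trans _ _ (1 - mexp p n (fun h => (pairs h <= j)%N%:R)
  + mexp p n (fun h => (u <= `|linear_part h|)%R%:R)
  + mexp p n (fun h => (crowded h)%:R))); last first.
  by rewrite lerD2r lerD2l chebyshev.
rewrite -[X in X - _](mexp_cst n _ p1) -mexpB -!mexpD; apply: le_mexp => // h hn.
have jb : 0 <= 1 - (pairs h <= j)%N%:R :> R by case: (_ <= _)%N; rewrite ?subrr// subr0.
have bb (b : bool) : b%:R <= 1 :> R by case: b.
case: (boolP (crowded h)) => [_|hc]; first by rewrite ler_wpDl// addr_ge0.
case: (leP u) => [_|Lu]; first by rewrite addr0 ler_wpDl.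
case: (leqP (pairs h) j) => [jh|_]; last by rewrite subr0 !addr0.
case: (leP x) => [Tx|_]; last by rewrite subrr !addr0.
exfalso; move: Tx Lu; rewrite (statisticE hn hc) ltr_norml => Tx /andP[_ Lu].
suff : quadratic_part h <= j%:R + 9 / 25 by lra.
apply: (le_trans (quadratic_part_le h)).
apply: (@le_trans _ _ ((1 + c_ l p) * j%:R)); last by lra.
by rewrite ler_wpM2l ?addr_ge0// ler_nat.
Qed.

Let mu := mu_ n p.
Let sg := Num.sqrt mu.
Let e1 := 45 * Num.min 1 mu^-1 *
       (6 * n%:R * (\sum_(j < r) p j * pi_ n p j) ^+ 2
        + \sum_(j < r) (pi_ n p j) ^+ 2
        + 24 * mu ^+ 2 / n%:R).
Let e3 := 8 * n%:R * mu * max0 p / (4 - (n%:R + 1) * max0 p).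

Lemma tail_comparison_aux x b : 47 / 99 < sg ->
  (0 < c_ l p -> expR (288 / 49 * c_ l p) * (111 / 20 * mu * c_ l p) < 1) ->
  b = Num.min (81 / 10 * d_ l n p) (215 / 100 * (d_ l n p / mu) `^ (1 / 3)) ->
  `|mexp p n (fun h => (x <= T h)%R%:R) - (1 - Phi ((x - mu) / sg))| <=
  e1 + e3 + b + 47 / 99 / sg.
Proof.
move=> sg1 hexp hb; have mu0 : 0 < mu := mu_gt0 p0 p13 n4 r0.
have sg0 : 0 < sg by rewrite sqrtr_gt0.
have D0 : 0 <= d_ l n p.
  rewrite -(var_linear_weight p n l) mulr_ge0// sumr_ge0// => j _.
  by rewrite mulr_ge0// sqr_ge0.
have hb' := variance_term mu0 D0; rewrite -hb -/sg in hb'.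
have bE : (47 / 99 + b * sg) / sg = 47 / 99 / sg + b.
  by rewrite mulrDl mulfK ?gt_eqF.
have poisson j := poisson_pairs_bound p0 p1 p13 np4 n4 j r0.
rewrite -/mu -/e1 in poisson.
have crowd := crowded_cells_bound p0 p1 p13 np4 n4; rewrite -/mu -/e3 in crowd.
have P0 : 0 <= mexp p n (fun h => (x <= T h)%R%:R).
  by rewrite -[leLHS](mexp_cst n 0 p1) le_mexp.
have P1 : mexp p n (fun h => (x <= T h)%R%:R) <= 1.
  by rewrite -[leRHS](mexp_cst n 1 p1) le_mexp// => k _; case: (x <= T k).
have e1_ge0 : 0 <= e1 by exact: le_trans (poisson 0%N).
have e3_ge0 : 0 <= e3.
  by apply: le_trans crowd; rewrite -[leLHS](mexp_cst n 0 p1) le_mexp.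
have := lower_threshold x mu0 c0 D0 sg1 hexp hb'.
have := upper_threshold x mu0 c0 D0 sg1 hexp hb'.
rewrite -/sg bE => up low; rewrite ler_norml; apply/andP; split.
  case: low => [|[k [u [u0 ck uk hk]]]]; first by lra.
  have := tail_ge u0 ck uk.
  have : mexp p n (fun h => (pairs h < k)%N%:R) <= pcdf k mu + e1.
    case: k {ck uk hk} => [|k].
      under eq_mexp do rewrite ltn0.
      by rewrite (mexp_cst n 0 p1) pcdf0 add0r.
    by have := poisson k; rewrite ler_norml => /andP[_]; rewrite lerBlDl.
  move: hk crowd; lra.
case: up => [|[j [u [u0 cj uj hj]]]]; first by lra.
have := tail_le u0 cj uj; have := poisson j; rewrite ler_norml => /andP[+ _].
move: hj crowd; lra.
Qed.

(** If the last term or the exponential term is at least 1 the bound is trivial; otherwise both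
    hypotheses of [tail_comparison_aux] hold. *)
Lemma tail_comparison x :
  `|mexp p n (fun h => (x <= T h)%R%:R) - (1 - Phi ((x - mu) / sg))| <=
  e1 + (if c_ l p == 0 then 0
        else 18 * (555 / 100 * mu * c_ l p) `^ (49 / 100 / c_ l p))
     + e3
     + Num.min (81 / 10 * d_ l n p) (215 / 100 * (d_ l n p / mu) `^ (1 / 3))
     + 4748 / 10000 / sg.
Proof.
have mu0 : 0 < mu := mu_gt0 p0 p13 n4 r0.
have sg0 : 0 < sg by rewrite sqrtr_gt0.
have D0 : 0 <= d_ l n p.
  rewrite -(var_linear_weight p n l) mulr_ge0// sumr_ge0// => j _.
  by rewrite mulr_ge0// sqr_ge0.
have b0 : 0 <= Num.min (81 / 10 * d_ l n p) (215 / 100 * (d_ l n p / mu) `^ (1 / 3)).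
  rewrite le_min; apply/andP; split; first by rewrite mulr_ge0.
  by rewrite mulr_ge0// powR_ge0.
have poisson j := poisson_pairs_bound p0 p1 p13 np4 n4 j r0.
have e1_ge0 : 0 <= e1 by exact: le_trans (poisson 0%N).
have e3_ge0 : 0 <= e3.
  apply: le_trans (crowded_cells_bound p0 p1 p13 np4 n4).
  by rewrite -[leLHS](mexp_cst n 0 p1) le_mexp.
have P0 : 0 <= mexp p n (fun h => (x <= T h)%R%:R).
  by rewrite -[leLHS](mexp_cst n 0 p1) le_mexp.
have P1 : mexp p n (fun h => (x <= T h)%R%:R) <= 1.
  by rewrite -[leRHS](mexp_cst n 1 p1) le_mexp// => k _; case: (x <= T k).
have d1 : `|mexp p n (fun h => (x <= T h)%R%:R) - (1 - Phi ((x - mu) / sg))| <= 1.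
  have := Phi_ge0 ((x - mu) / sg); have := Phi_le1 ((x - mu) / sg).
  by move=> h0 h1; rewrite ler_norml; apply/andP; split; lra.
have cE : 555 / 100 * mu * c_ l p = 111 / 20 * mu * c_ l p.
  by congr (_ * _ * _); lra.
rewrite cE.
have : 47 / 99 <= 4748 / 10000 :> R by lra.
move: (4748 / 10000) => A hA.
have [A1|A1] := leP 1 (A / sg).
  apply: (le_trans d1); apply: (le_trans A1); rewrite lerDr.
  rewrite !addr_ge0//; case: (c_ l p == 0); first by [].
  by rewrite mulr_ge0// powR_ge0.
have sgA : 47 / 99 < sg.
  by apply: (le_lt_trans hA); move: A1; rewrite (ltr_pdivrMr _ _ sg0) mul1r.
have As : 47 / 99 / sg <= A / sg by rewrite ler_pM2r ?invr_gt0.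
have := c0; rewrite le_eqVlt => /predU1P[c00|c1].
  rewrite -c00 eqxx addr0.
  have hexp : 0 < c_ l p -> expR (288 / 49 * c_ l p) * (111 / 20 * mu * c_ l p) < 1.
    by move=> h; exfalso; move: h; rewrite -c00 ltxx.
  have := tail_comparison_aux x sgA hexp erefl; lra.
rewrite gt_eqF//.
have a0 : 0 < 111 / 20 * mu * c_ l p.
  by rewrite (pmulr_lgt0 _ c1) (pmulr_lgt0 _ mu0).
have t0 := powR_ge0 (111 / 20 * mu * c_ l p) (49 / 100 / c_ l p).
have [t1|t1] := leP 1 (18 * (111 / 20 * mu * c_ l p) `^ (49 / 100 / c_ l p)).
  apply: (le_trans d1); apply: (le_trans t1).
  have : 0 <= A / sg by apply: le_trans As; rewrite divr_ge0// ltW.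
  by move: (_ `^ _) (A / _) t0 e1_ge0 e3_ge0 b0 => *; lra.
have := tail_comparison_aux x sgA (fun=> exp_term_small a0 c1 t1) erefl.
by move: (_ `^ _) t0 => *; lra.
Qed.

End tail_comparison.

(** * The multinomial law *)

Section multinomial_law.
Context {R : realType} {r : nat}.
Variable p : 'I_r -> R.

Definition multinomial_pmf n (f : 'I_r -> nat) : R :=
  n`!%:R / (\prod_j (f j)`!)%:R * \prod_j p j ^+ f j.

Definition remove_ball (f : 'I_r -> nat) j : 'I_r -> nat := fun i => (f i - (i == j))%N.

Lemma remove_add_ball f j : (0 < f j)%N -> add_ball (remove_ball f j) j = f.
Proof.
move=> fj; apply/funext => i; rewrite /add_ball /remove_ball subnK//.
by case: eqVneq => // ->.
Qed.

Lemma pmf_remove_ball n f j : (0 < f j)%N ->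
  p j * multinomial_pmf n (remove_ball f j) =
  (f j)%:R * (n`!%:R / (\prod_j (f j)`!)%:R * \prod_j p j ^+ f j).
Proof.
move=> fj; rewrite /multinomial_pmf !natr_prod.
rewrite (bigD1 j)//= [\prod_j0 p j0 ^+ _](bigD1 j)//=.
rewrite [\prod_j0 (f j0)`!%:R](bigD1 j)//= [\prod_j0 p j0 ^+ f j0](bigD1 j)//=.
have other i : i != j -> remove_ball f j i = f i.
  by move=> /negbTE ij; rewrite /remove_ball ij subn0.
rewrite (eq_bigr (fun i => (f i)`!%:R)) => [|i ij]; last by rewrite other.
rewrite [X in p j * (_ * (_ * X))](eq_bigr (fun i => p i ^+ f i)) => [|i ij];
  last by rewrite other.
rewrite /remove_ball eqxx subn1.
have A0 : \prod_(i < r | i != j) (f i)`!%:R != 0 :> R.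
  by rewrite -natr_prod pnatr_eq0 -lt0n prodn_gt0// => i; exact: fact_gt0.
case: (f j) fj => // m _; rewrite factS natrM/= exprS.
have m0 : (m.+1)%:R != 0 :> R by rewrite pnatr_eq0.
have a0 : (m`!%:R : R) != 0 by rewrite pnatr_eq0 -lt0n fact_gt0.
move: (\prod_(i | _) (f i)`!%:R) A0 (\prod_(i | _) p i ^+ _) (n`!%:R) (m`!%:R) a0 (m.+1%:R) m0.
by move=> A A0 B x y a0 z z0; field; rewrite a0 z0 A0.
Qed.

(** Splitting by the cell of one ball and summing [pmf_remove_ball] over the cells produces the
    factor [n + 1], the total of [f]. *)
Lemma mexp_pmf n f : (\sum_j f j = n)%N ->
  mexp p n (fun k => [forall j, k j == f j]%:R) = multinomial_pmf n f.
Proof.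
elim: n f => [|n IHn] f fn /=.
  have f0 j : f j = 0%N by move/eqP: fn; rewrite sum_nat_eq0 => /forallP/(_ j)/eqP.
  rewrite /multinomial_pmf !big1 => [|j _|j _]; rewrite ?f0//.
  by rewrite (introT forallP) ?fact0 ?divr1 ?mulr1// => j; rewrite f0.
have step j : p j * mexp p n (fun k => [forall i, add_ball k j i == f i]%:R) =
    (f j)%:R * (n`!%:R / (\prod_j (f j)`!)%:R * \prod_j p j ^+ f j).
  have [fj|fj] := posnP (f j).
    rewrite fj mul0r -[RHS](mulr0 (p j)); congr (_ * _).
    rewrite -[RHS](mul0r (mexp p n (fun=> 0))) -mexpZ; apply: eq_mexp => k _.
    rewrite mul0r; case: forallP => // /(_ j).
    by rewrite /add_ball eqxx addn1 fj.
  rewrite -pmf_remove_ball// -IHn; last first.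
    by apply/eqP; rewrite -eqSS -(sum_add_ball _ j) remove_add_ball// fn.
  congr (_ * _); apply: eq_mexp => k _; congr (_%:R); congr nat_of_bool.
  apply/forallP/forallP => h i; have := h i; rewrite /add_ball /remove_ball.
    by move=> /eqP <-; rewrite addnK.
  by move=> /eqP ->; rewrite subnK//; case: eqVneq => // ->.
under eq_bigr => j _ do rewrite step.
rewrite -mulr_suml -natr_sum fn /multinomial_pmf factS natrM !mulrA; ring.
Qed.

(** Count vectors of total [n] have entries at most [n], so they are found in a finite type over
    which sums make sense. *)
Definition counts n (f : {ffun 'I_r -> 'I_n.+1}) : 'I_r -> nat := fun j => f j.

Lemma mexp_enum n (phi : ('I_r -> nat) -> bool) :
  mexp p n (fun k => (phi k)%:R) =
  \sum_(f : {ffun 'I_r -> 'I_n.+1} | (\sum_j counts f j == n)%N && phi (counts f))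
    multinomial_pmf n (counts f).
Proof.
rewrite [RHS](eq_bigr (fun f : {ffun 'I_r -> 'I_n.+1} =>
    mexp p n (fun k => [forall j, k j == counts f j]%:R))); last first.
  by move=> f /andP[/eqP fn _]; rewrite mexp_pmf.
rewrite -mexp_sum; apply: eq_mexp => k kn.
have kb j : (k j < n.+1)%N by rewrite ltnS -kn (bigD1 j)//= leq_addr.
pose F : {ffun 'I_r -> 'I_n.+1} := [ffun j => Ordinal (kb j)].
have FE : counts F = k by apply/funext => j; rewrite /counts ffunE.
have other f : f != F -> [forall j, k j == counts f j] = false.
  move=> /eqP fF; apply/negbTE/negP => /forallP h; apply: fF.
  by apply/ffunP => j; apply: val_inj; rewrite ffunE/=; apply/esym/eqP/h.
case: (boolP (phi k)) => phik.
  rewrite (bigD1 F)/=; last by rewrite FE kn eqxx.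
  rewrite big1 => [|f /andP[_ fF]]; last by rewrite other.
  by rewrite addr0 (introT forallP)// => j; rewrite FE.
rewrite big1// => f /andP[_ phif]; rewrite other//.
by apply/eqP => fF; move: phif; rewrite fF FE (negbTE phik).
Qed.

End multinomial_law.

(** * From the joint mass function to probabilities of events *)

Section transfer.
Context {R : realType} {r : nat}.
Variables (p : 'I_r -> R) (n : nat) (d : measure_display) (T : measurableType d).
Variables (Pr : probability T R) (N : 'I_r -> {RV Pr >-> nat}).
Hypotheses (p1 : \sum_j p j = 1) (hN : multinomial n p N).

Let cell_event (f : 'I_r -> nat) : set T := [set w | forall j, N j w = f j].

Lemma measurable_cell_event f : measurable (cell_event f).
Proof.
have -> : cell_event f = \bigcap_(j in [set: 'I_r]) (N j @^-1` [set f j]).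
  by apply/seteqP; split => w h j => [_|]; [exact: h|exact: (h j)].
apply: fin_bigcap_measurable => // j _.
by rewrite -[X in measurable X]setTI; exact: measurable_funP.
Qed.

Let event (phi : ('I_r -> nat) -> bool) : set T := [set w | phi (fun j => N j w)].

Lemma measurable_event phi : measurable (event phi).
Proof.
have -> : event phi = \bigcup_(f : {ffun 'I_r -> nat})
    (if phi (fun j => f j) then cell_event (fun j => f j) else set0).
  apply/seteqP; split => [w phiw|w [f _]].
    exists [ffun j => N j w] => //.
    rewrite (_ : (fun j => [ffun j => N j w] j) = (fun j => N j w)).
      by rewrite phiw.
    by apply/funext => j; rewrite ffunE.
  case: ifP => // phif wf; rewrite /event/= (_ : (fun j => N j w) = (fun j => f j))//.
  by apply/funext => j; exact: wf.
apply: countable_bigcupT_measurable => // f.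
by case: ifP => // _; exact: measurable_cell_event.
Qed.

(** Only the finitely many vectors of total [n] are summed, hence an inequality. Applied to [phi]
    and to its negation, whose [mexp] values add up to 1, it becomes an equality. *)
Let event_ge (phi : ('I_r -> nat) -> bool) :
  ((mexp p n (fun k => (phi k)%:R))%:E <= Pr (event phi))%E.
Proof.
pose D (f : {ffun 'I_r -> 'I_n.+1}) := (\sum_j counts f j == n)%N && phi (counts f).
have mU : measurable (\bigcup_(f in [set` D]) cell_event (counts f)).
  by apply: fin_bigcup_measurable => // f _; exact: measurable_cell_event.
apply: (@le_trans _ _ (Pr (\bigcup_(f in [set` D]) cell_event (counts f)))); last first.
  apply: le_measure; rewrite ?inE//; first exact: measurable_event.
  move=> w [f /andP[_ phif] wf]; rewrite /event/=.
  by rewrite (_ : (fun j => N j w) = counts f)//; apply/funext.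
rewrite measure_fin_bigcup//; last 2 first.
- move=> f g _ _ [w [wf wg]]; apply/ffunP => j; apply: val_inj.
  by have := wf j; rewrite (wg j).
- by move=> f _; exact: measurable_cell_event.
rewrite -(@bigfs _ _ _ _ (index_enum {ffun 'I_r -> 'I_n.+1}) D) ?index_enum_uniq//.
  rewrite mexp_enum -sumEFin le_eqVlt; apply/orP; left; apply/eqP.
  apply: eq_bigr => f /andP[fn _]; apply/esym.
  by apply: (etrans (hN (counts f))); rewrite fn.
by move=> f _; rewrite mem_index_enum.
Qed.

Lemma probability_multinomial (phi : ('I_r -> nat) -> bool) :
  Pr [set w | phi (fun j => N j w)] = (mexp p n (fun k => (phi k)%:R))%:E.
Proof.
apply/eqP; rewrite eq_le; apply/andP; split; last exact: event_ge.
have := event_ge (fun k => ~~ phi k).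
have -> : event (fun k => ~~ phi k) = ~` event phi.
  by apply/seteqP; split => w /negP.
rewrite probability_setC; last exact: measurable_event.
have -> : mexp p n (fun k => (~~ phi k)%:R) = 1 - mexp p n (fun k => (phi k)%:R).
  rewrite -[X in X - _](mexp_cst n _ p1) -mexpB; apply: eq_mexp => k _.
  by case: (phi k); rewrite ?subrr ?subr0.
have fin : Pr (event phi) \is a fin_num by exact: fin_num_measure (measurable_event phi).
rewrite -/(event phi) -(fineK fin) -EFinB !lee_fin; lra.
Qed.

End transfer.

Theorem theorem7 (R : realType)
    (l : R) (hl : -1 < l)
    (n : nat) (hn : (4 <= n)%N)
    (r : nat) (hr : (1 <= r)%N)
    (p : 'I_r -> R) (hp0 : forall j, 0 < p j) (hp1 : \sum_(j < r) p j = 1)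
    (hp13 : forall j, p j <= 13 / 100) (hp4 : forall j, (n%:R + 1) * p j < 4)
    (d : measure_display) (T : measurableType d) (Pr : probability T R)
    (N : 'I_r -> {RV Pr >-> nat}) (hN : multinomial n p N)
    (d' : measure_display) (T' : measurableType d') (Q : probability T' R)
    (Z : {RV Q >-> R}) (hZ : standard_gaussian Z) :
  let mu := mu_ n p in
  let c := c_ l p in
  let dl := d_ l n p in
  let pmax := max0 p in
  kolmogorov_distance Pr Q
    (fun w => (normalised_power_divergence l n p (fun j => N j w) - mu)
              / Num.sqrt mu)
    Z
  <= 45 * Num.min 1 mu^-1 *
       (6 * n%:R * (\sum_(j < r) p j * pi_ n p j) ^+ 2
        + \sum_(j < r) (pi_ n p j) ^+ 2
        + 24 * mu ^+ 2 / n%:R)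
     + (if c == 0 then 0
        else 18 * (555 / 100 * mu * c) `^ (49 / 100 / c))
     + 8 * n%:R * mu * pmax / (4 - (n%:R + 1) * pmax)
     + Num.min (81 / 10 * dl) (215 / 100 * (dl / mu) `^ (1 / 3))
     + 4748 / 10000 / Num.sqrt mu.
Proof.
cbv zeta; set mu := mu_ n p.
have mu0 : 0 < mu := mu_gt0 hp0 hp13 hn hr.
have s0 : 0 < Num.sqrt mu by rewrite sqrtr_gt0.
rewrite /kolmogorov_distance; apply: ge_sup; first by exists (`|fine (Pr [set w | 0 <=
  (normalised_power_divergence l n p (fun j => N j w) - mu) / Num.sqrt mu]) -
  fine (Q [set w | 0 <= Z w])|); exists 0.
move=> _ [y _ <-].
have -> : Q [set w | y <= Z w] = normal_prob 0 1 `[y, +oo[.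
  rewrite -hZ//; congr (Q _); apply/seteqP; split => w /=.
    by rewrite /= in_itv/= andbT.
  by rewrite /= in_itv/= andbT.
rewrite (probability_multinomial hp1 hN
  (fun k => y <= (normalised_power_divergence l n p k - mu) / Num.sqrt mu)).
have -> : mexp p n (fun k =>
    (y <= (normalised_power_divergence l n p k - mu) / Num.sqrt mu)%R%:R) =
  mexp p n (fun k =>
    (y * Num.sqrt mu + mu <= normalised_power_divergence l n p k)%R%:R).
  by apply: eq_mexp => k _; rewrite ler_pdivlMr// lerBrDr.
have := tail_comparison hp0 hp1 hp13 hp4 hn hr hl (y * Num.sqrt mu + mu).
rewrite -/mu addrK (mulfK (lt0r_neq0 s0)) => h.
by rewrite gauss_itvcy.
Qed.
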